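(* Let $g\in L^1(\Omega;L^1_{loc}([0,\infty);L^1(E,\nu;L^\infty(\mathbb R^d))))$ be such that $\{g(t,v,x,\cdot)\}_{t\ge0}$, as a family of $L^1(\Omega,\mathcal F,\mathbb P)$-valued random variables, is $\{\mathcal F_t\}_{t\ge0}$-adapted. Let $p\ge1$ and $0<\vartheta<1/p$. Let $\varphi$ be a nonnegative, nondecreasing, continuous function on $(0,+\infty)$ with $\lim_{r\to0+}\varphi(r)=0$, such that $$\sum_{i=0}^\infty\varphi(2^{-i})^\vartheta<+\infty,$$ and such that there is a constant $\lambda\ge1$ with $\lambda^{-1}\le\varphi(2^{-n})/\varphi(2^{-n-1})\le\lambda$ for all sufficiently large natural numbers $n$. Assume there is a nonnegative measurable function $$h\in L^p\big(\Omega;\,L^1_{loc}([0,\infty);L^1(E,\nu))\cap L^p_{loc}([0,\infty);L^p(E,\nu))\big)$$ such that for every $x,y\in\mathbb R^d$, $$|g(t,v,x)-g(t,v,y)|\le h(t,v)\,|x-y|^{\frac dp}\,\varphi(|x-y|)^{\frac1p}.$$ Let $u$ be defined by $$u(t,x)=\int_{(0,t]}\int_E \big(K(t-r,\cdot)\ast g(r,v,\cdot)\big)(x)\,\tilde N(dr,dv).$$ Then $u$ admits a realization $\tilde u$ which is continuous in $x$, and for every $\beta\in(0,1/p-\vartheta]$, every $T>0$ and every $c_1>0$, $$\mathbb E\sup_{0\le t\le T}\ \sup\Big\{\frac{|\tilde u(t,x)-\tilde u(t,y)|^p}{\varphi(|x-y|)^{\beta p}}:\ x,y\in B_{c_1},\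 x\neq y\Big\}<+\infty.$$
   Context: Setting. $(\Omega,\mathcal F,\{\mathcal F_t\}_{t\ge0},\mathbb P)$ is a filtered complete probability space with right-continuous filtration. $E=B_c(0)\setminus\{0\}\subset\mathbb R^d$ is the ball of radius $c>0$ centered at $0$ with its center removed, and $\nu$ is a Lévy measure on $E$, i.e. $\int_E 1\wedge|v|^2\,\nu(dv)<\infty$. $N$ is a time-homogeneous Poisson random measure on $(E,\mathcal B(E))$ over this filtered space with intensity $\nu\times$Lebesgue measure on $\mathbb R_+$: (i) for $B\in\mathcal B(E)$ with $\nu(B)<\infty$ and $I\in\mathcal B(\mathbb R_+)$, $N(B\times I)$ is Poisson distributed with parameter $\nu(B)$ times the Lebesgue measure of $I$; (ii) values of $N$ on pairwise disjoint sets of the form $B_j\times I_j$ are mutually independent; (iii) for each $U\in\mathcal B(E)$, the process $\{N((0,t],U)\}_{t>0}$ is $\{\mathcal F_t\}$-adapted with increments independent of the past. The compensated measure is $\tilde N((0,t],A)=N((0,t],A)-\nu(A)t$. Heat kernel. For a fixed $\alpha\in(0,2]$, $\Delta^{\alpha/2}:=-(-\Delta)^{\alpha/2}$; for $\alpha\in(0,2)$ and $\phi\in C_c^\infty(\mathbb R^d)$, $$(-\Delta)^{\alpha/2}\phi(x)=c(d,\alpha)\,\mathrm{P.V.}\int_{\mathbb R^d}\frac{\phi(x)-\phi(x+z)}{|z|^{d+\alpha}}\,dz,\qquad c(d,\alpha)=\frac{\alpha2^{\alpha-1}\pi^{-d/2}\Gamma(\frac{d+\alpha}2)}{\Gamma(\frac{2-\alpha}2)},$$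 and for $\alpha=2$ it is the usual Laplacian. $K(t,x)$ is the heat kernel of $\partial_tu=\Delta^{\alpha/2}u$, $t>0$, $x\in\mathbb R^d$, and $\ast$ denotes convolution in the space variable. The function $u$ is the mild solution of $$du(t,x)=\Delta^{\alpha/2}u(t,x)\,dt+\int_E g(t,v,x)\,\tilde N(dt,dv),\ t>0,\ x\in\mathbb R^d,\qquad u(0,x)=0.$$ Conventions. $B_{c_1}$ is the ball in $\mathbb R^d$ centered at $0$ of radius $c_1$; $\varphi(0)$ is read as $0$. A realization $\tilde u$ of $u$ is a random field on the same probability space such that, for each $x$, $\mathbb P\{\tilde u(t,x)=u(t,x)\text{ for all }t\}=1$. ''Continuous in $x$'' means that for almost every $\omega$, for every $t$, the map $x\mapsto\tilde u(t,x,\omega)$ is continuous. *)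

(* Defs.v *)
From HB Require Import structures.
From mathcomp Require Import all_boot all_order all_algebra.
From mathcomp Require Import all_classical all_reals all_analysis.
From mathcomp Require Import measurable_realfun.
Set Implicit Arguments.
Unset Strict Implicit.
Unset Printing Implicit Defensive.
Import Order.TTheory GRing.Theory Num.Theory.
Import numFieldNormedType.Exports.
Local Open Scope classical_set_scope.
Local Open Scope ring_scope.

(* R^d is ['rV[R]_d].  Its topology is the library one; its Borel             *)
(* sigma-algebra is generated by the coordinate functions.                    *)
Definition rV_display : measure_display. Proof. exact: default_measure_display. Qed.

Section borel_rV.
Context {R : realType} {n : nat}.

Definition rV_cylinder : set (set 'rV[R]_n) :=
  [set A | exists i : 'I_n, exists2 Y : set R,
    measurable Y & A = (fun x : 'rV[R]_n => x 0 i) @^-1` Y].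

Let cyl0 : <<s rV_cylinder >> set0.
Proof. exact: sigma_algebra0. Qed.

Let cylC A : <<s rV_cylinder >> A -> <<s rV_cylinder >> (~` A).
Proof. exact: sigma_algebraC. Qed.

Let cyl_bigcup (A : (set 'rV[R]_n)^nat) :
  (forall i, <<s rV_cylinder >> (A i)) -> <<s rV_cylinder >> (\bigcup_i A i).
Proof. exact: sigma_algebra_bigcup. Qed.

HB.instance Definition _ := @isMeasurable.Build rV_display 'rV[R]_n
  <<s rV_cylinder >> cyl0 cylC cyl_bigcup.

Lemma measurable_coord (i : 'I_n) :
  measurable_fun [set: 'rV[R]_n] (fun x : 'rV[R]_n => x 0 i).
Proof.
by move=> _ Y mY; rewrite setTI; apply: sub_sigma_algebra; exists i, Y.
Qed.

Lemma measurable_fun_rV d (T : measurableType d) (f : T -> 'rV[R]_n) :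
  (forall i, measurable_fun [set: T] (fun x => f x 0 i)) ->
  measurable_fun [set: T] f.
Proof.
move=> mf _ Y mY; rewrite setTI.
suff : <<s rV_cylinder >> `<=` [set Y | measurable (f @^-1` Y)] by exact.
apply: smallest_sub.
  split => /=; first by rewrite preimage_set0.
  - by move=> A mA; rewrite setTD preimage_setC; exact: measurableC.
  - by move=> A mA; rewrite preimage_bigcup; exact: bigcup_measurable.
move=> _ [i [Z mZ ->]] /=.
by have := mf i measurableT Z mZ; rewrite setTI.
Qed.

End borel_rV.

(* Lebesgue measure on R^(n+1) is the image of the product of the Lebesgue    *)
(* measures on R and R^n.                                                     *)
Section lebesgue_step.
Context {R : realType} {n : nat}.
Variable mu : {sigma_finite_measure set 'rV[R]_n -> \bar R}.

Definition rV_cons (q : R * 'rV[R]_n) : 'rV[R]_n.+1 := row_mx q.1%:M q.2.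

Definition rV_uncons (x : 'rV[R]_n.+1) : R * 'rV[R]_n :=
  (x 0 ord0, \row_j x 0 (lift ord0 j)).

Lemma rV_cons0 q : rV_cons q 0 ord0 = q.1.
Proof.
rewrite /rV_cons (_ : ord0 = lshift n (ord0 : 'I_1)); last exact/val_inj.
by rewrite (@row_mxEl _ 1 1 n) mxE eqxx.
Qed.

Lemma rV_consS q j : rV_cons q 0 (lift ord0 j) = q.2 0 j.
Proof.
rewrite /rV_cons (_ : lift ord0 j = rshift 1 j); last exact/val_inj.
by rewrite (@row_mxEr _ 1 1 n).
Qed.

Lemma rV_consK : cancel rV_cons rV_uncons.
Proof.
move=> q; rewrite /rV_uncons rV_cons0 [RHS]surjective_pairing; congr pair.
by apply/rowP => j; rewrite mxE rV_consS.
Qed.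

Lemma measurable_rV_cons : measurable_fun [set: R * 'rV[R]_n] rV_cons.
Proof.
apply: measurable_fun_rV => i; case: (unliftP ord0 i) => [j ->|->].
- under eq_fun do rewrite rV_consS.
  exact: (measurableT_comp (measurable_coord j)).
- by under eq_fun do rewrite rV_cons0; exact: measurable_fst.
Qed.

Lemma measurable_rV_uncons : measurable_fun [set: 'rV[R]_n.+1] rV_uncons.
Proof.
apply/measurable_fun_pairP; split; first exact: measurable_coord.
apply: measurable_fun_rV => i; rewrite /comp/=.
by under eq_fun do rewrite mxE; exact: measurable_coord.
Qed.

Definition lebesgue_rVS : set 'rV[R]_n.+1 -> \bar R :=
  pushforward (@lebesgue_measure R \x mu)%E rV_cons.

Let lebS0 : lebesgue_rVS set0 = 0%E.
Proof. by rewrite /lebesgue_rVS /pushforward preimage_set0 measure0. Qed.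

Let lebS_ge0 A : (0 <= lebesgue_rVS A)%E.
Proof. exact: (measure_ge0 (@lebesgue_measure R \x mu)%E). Qed.

Let lebS_sigma_additive : semi_sigma_additive lebesgue_rVS.
Proof.
move=> F mF tF mUF; rewrite /lebesgue_rVS /pushforward preimage_bigcup.
apply: measure_semi_sigma_additive.
- by move=> k; rewrite -[X in measurable X]setTI; exact: measurable_rV_cons.
- apply/trivIsetP => /= i j _ _ ij; rewrite -preimage_setI.
  by move/trivIsetP : tF => /(_ _ _ _ _ ij) ->//; rewrite preimage_set0.
- rewrite -preimage_bigcup -[X in measurable X]setTI.
  exact: measurable_rV_cons.
Qed.

HB.instance Definition _ := isMeasure.Build _ _ _ lebesgue_rVS
  lebS0 lebS_ge0 lebS_sigma_additive.

Let lebS_sigma_finite : sigma_finite setT lebesgue_rVS.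
Proof.
have /sigma_finiteP[F [TF ndF Foo]] := sigma_finiteT (@lebesgue_measure R).
have /sigma_finiteP[G [TG ndG Goo]] := sigma_finiteT mu.
exists (fun k => rV_uncons @^-1` (F k `*` G k)).
  rewrite -preimage_bigcup (_ : \bigcup_k _ = setT) ?preimage_setT//.
  apply/seteqP; split=> // -[x y] _.
  have : setT x by []. rewrite TF => -[i _ Fix].
  have : setT y by []. rewrite TG => -[j _ Gjy].
  exists (maxn i j) => //; split.
  - by move: x Fix; exact/subsetPset/ndF/leq_maxl.
  - by move: y Gjy; exact/subsetPset/ndG/leq_maxr.
move=> k; have [mF Fkoo] := Foo k; have [mG Gkoo] := Goo k.
have mFG : measurable (F k `*` G k) by exact: measurableX.
split; first by rewrite -[X in measurable X]setTI; exact: measurable_rV_uncons.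
rewrite /lebesgue_rVS /pushforward -comp_preimage.
rewrite (_ : _ \o _ = id) ?preimage_id; last exact/funext/rV_consK.
by rewrite product_measure1E// lte_mul_pinfty// ge0_fin_numE.
Qed.

HB.instance Definition _ := Measure_isSigmaFinite.Build _ _ _ lebesgue_rVS
  lebS_sigma_finite.

End lebesgue_step.

Fixpoint lebesgue_rV {R : realType} (n : nat) :
    {sigma_finite_measure set 'rV[R]_n -> \bar R} :=
  match n with
  | 0 => @dirac _ 'rV[R]_0 0 R
  | m.+1 => lebesgue_rVS (lebesgue_rV m)
  end.

(* The library norm of ['rV[R]_d] is the sup norm. *)
Definition enorm {R : realType} {d : nat} (x : 'rV[R]_d) : R :=
  Num.sqrt (\sum_(i < d) x 0 i ^+ 2).

Definition eball {R : realType} {d : nat} (c : R) : set 'rV[R]_d :=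
  [set x | enorm x < c].

Definition punctured_ball {R : realType} {d : nat} (c : R) : set 'rV[R]_d :=
  eball c `\ 0.

Section heat_kernel.
Context {R : realType} {d : nat}.
Implicit Types (f : 'rV[R]_d -> R) (x : 'rV[R]_d).

Fixpoint iter_partial (s : seq 'I_d) f : 'rV[R]_d -> R :=
  match s with
  | [::] => f
  | i :: s' => 'D_(delta_mx 0 i) (iter_partial s' f)
  end.

Definition smooth f : Prop := forall s : seq 'I_d,
  continuous (iter_partial s f) /\
  forall x (i : 'I_d), derivable (iter_partial s f) x (delta_mx 0 i).

Definition test_function f : Prop :=
  smooth f /\ exists r : R, forall x, r < enorm x -> f x = 0.

Definition laplacian f x : R := \sum_(i < d) iter_partial [:: i; i] f x.

Definition Gamma (s : R) : R :=
  \int[@lebesgue_measure R]_(x in `]0, +oo[) (x `^ (s - 1) * expR (- x)).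

Definition frac_const (alpha : R) : R :=
  alpha * 2 `^ (alpha - 1) * pi `^ (- (d%:R / 2)) * Gamma ((d%:R + alpha) / 2)
  / Gamma ((2 - alpha) / 2).

Definition PV_integral (F : 'rV[R]_d -> R) : R :=
  lim ((fun e : R => \int[lebesgue_rV d]_(z in [set z | e <= enorm z]) F z)
       @ 0^'+).

(* Delta^(alpha/2) = - (- Delta)^(alpha/2) *)
Definition frac_laplacian (alpha : R) f x : R :=
  if alpha == 2 then laplacian f x
  else - (frac_const alpha *
          PV_integral (fun z => (f x - f (x + z)) / enorm z `^ (d%:R + alpha))).

(* The fundamental solution of du/dt = Delta^(alpha/2) u : the (unique)       *)
(* jointly continuous family of probability densities K(t, .), t > 0, which   *)
(* solves the equation tested against C_c^oo functions, on which              *)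
(* Delta^(alpha/2) is defined, and tends weakly to the Dirac mass at 0 as t   *)
(* tends to 0.  Values of K at t <= 0 are irrelevant.                         *)
Record is_heat_kernel (alpha : R) (K : R -> 'rV[R]_d -> R) : Prop := {
  heat_kernel_continuous : forall (t : R) x, 0 < t ->
    {for (t, x), continuous (fun q : R * 'rV[R]_d => K q.1 q.2)};
  heat_kernel_ge0 : forall (t : R) x, 0 < t -> 0 <= K t x;
  heat_kernel_mass : forall t : R, 0 < t ->
    (\int[lebesgue_rV d]_x (K t x)%:E = 1)%E;
  heat_kernel_equation : forall f (t : R), test_function f -> 0 < t ->
    is_derive t 1 (fun s => \int[lebesgue_rV d]_x (K s x * f x))
      (\int[lebesgue_rV d]_x (K t x * frac_laplacian alpha f x));
  heat_kernel_initial : forall f, continuous f ->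
    (exists M : R, forall x, `|f x| <= M) ->
    (\int[lebesgue_rV d]_x (K t x * f x)) @[t --> 0^'+] --> f 0 }.

(* (K(s, .) * f)(x), with K(0, .) the Dirac mass at 0. *)
Definition heat_conv (K : R -> 'rV[R]_d -> R) (s : R) f x : R :=
  if s == 0 then f x else \int[lebesgue_rV d]_y (K s (x - y) * f y).

End heat_kernel.

Arguments frac_const {R} d alpha.

Section filtration.
Context {R : realType} {dO : measure_display} {Omega : measurableType dO}.
Implicit Types (F : R -> set (set Omega)).

(* Only the times t >= 0 matter. *)
Record right_continuous_filtration F : Prop := {
  filtration_sigma_algebra : forall t : R, 0 <= t -> sigma_algebra setT (F t);
  filtration_measurable : forall t : R, 0 <= t -> F t `<=` measurable;
  filtration_nondecreasing : forall s t : R, 0 <= s -> s <= t -> F s `<=` F t;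
  filtration_right_continuous : forall t : R, 0 <= t ->
    \bigcap_(s in `]t, +oo[) F s = F t }.

Definition measurable_for (G : set (set Omega)) {dT : measure_display}
    {T : measurableType dT} (X : Omega -> T) : Prop :=
  forall Y : set T, measurable Y -> G (X @^-1` Y).

End filtration.

Section poisson_random_measure.
Context {R : realType} {d : nat}.
Context {dO : measure_display} {Omega : measurableType dO}.
Variable P : probability Omega R.

Definition mutually_independent (n : nat) (X : 'I_n -> Omega -> \bar R) : Prop :=
  forall C : 'I_n -> set (\bar R), (forall i, measurable (C i)) ->
    P (\bigcap_(i in [set: 'I_n]) (X i @^-1` C i)) =
    (\prod_(i < n) P (X i @^-1` C i))%E.

Definition independent_of_events (G : set (set Omega)) (X : Omega -> \bar R) :
    Prop :=
  forall (A : set Omega) (C : set (\bar R)), G A -> measurable C ->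
    P (A `&` X @^-1` C) = (P A * P (X @^-1` C))%E.

Definition levy_measure (E : set 'rV[R]_d)
    (nu : {measure set 'rV[R]_d -> \bar R}) : Prop :=
  (\int[nu]_(v in E) (Num.min 1 (enorm v ^+ 2))%:E < +oo)%E.

(* A random measure is a kernel from Omega to (time x space); only its values *)
(* on subsets of R_+ x E, and those of nu on subsets of E, are used.  When    *)
(* nu(B) is finite and I has infinite length, N(I x B) is determined by       *)
(* countable additivity.  The second argument of    *)
(* [poisson_prob] is a dummy, and [poisson_prob 0] is the Dirac mass at 0.    *)
Record poisson_random_measure (E : set 'rV[R]_d)
    (nu : {measure set 'rV[R]_d -> \bar R}) (F : R -> set (set Omega))
    (N : R.-ker Omega ~> (R * 'rV[R]_d)%type) : Prop := {
  prm_poisson : forall (I : set R) (B : set 'rV[R]_d),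
    measurable I -> I `<=` `[0, +oo[ -> (@lebesgue_measure R I < +oo)%E ->
    measurable B -> B `<=` E -> (nu B < +oo)%E ->
    forall A : set nat,
      P [set w | exists2 k, A k & N w (I `*` B) = (k%:R)%:E] =
      poisson_prob (fine (nu B * @lebesgue_measure R I)%E) 0 A;
  prm_independent : forall (n : nat) (I : 'I_n -> set R)
      (B : 'I_n -> set 'rV[R]_d),
    (forall i, measurable (I i)) -> (forall i, I i `<=` `[0, +oo[) ->
    (forall i, measurable (B i)) -> (forall i, B i `<=` E) ->
    trivIset setT (fun i => I i `*` B i) ->
    mutually_independent (fun i w => N w (I i `*` B i));
  prm_adapted : forall (U : set 'rV[R]_d) (t : R),
    measurable U -> U `<=` E -> 0 < t ->
    measurable_for (F t) (fun w => N w (`]0, t] `*` U));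
  prm_increments : forall (U : set 'rV[R]_d) (s t : R),
    measurable U -> U `<=` E -> 0 <= s -> s < t ->
    independent_of_events (F s) (fun w => N w (`]s, t] `*` U)) }.

End poisson_random_measure.

Section mild_solution.
Context {R : realType} {d : nat}.
Context {dO : measure_display} {Omega : measurableType dO}.
Variables (P : probability Omega R) (F : R -> set (set Omega)).
Variables (E : set 'rV[R]_d) (nu : {measure set 'rV[R]_d -> \bar R}).
Variable N : R.-ker Omega ~> (R * 'rV[R]_d)%type.
Implicit Types g : Omega -> R -> 'rV[R]_d -> 'rV[R]_d -> R.

(* Almost every (w, t, v) in Omega x R_+ x E for P x dt x nu. *)
Definition ae_wtv (Q : Omega -> R -> 'rV[R]_d -> Prop) : Prop :=
  {ae P, forall w, {ae @lebesgue_measure R, forall t : R, 0 <= t ->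
    {ae nu, forall v, E v -> Q w t v}}}.

Definition adapted g : Prop :=
  forall (t : R) (v x : 'rV[R]_d), 0 <= t -> E v ->
    exists2 X : Omega -> R, measurable_for (F t) X &
      {ae P, forall w, g w t v x = X w}.

(* The product of the predictable sigma-algebra on Omega x (0, +oo) with the  *)
(* Borel sigma-algebras of E and R^d.                                         *)
Definition predictable_domain : set (Omega * R * 'rV[R]_d * 'rV[R]_d) :=
  (setT `*` `]0, +oo[) `*` E `*` setT.

Definition predictable_rectangle : set (set (Omega * R * 'rV[R]_d * 'rV[R]_d)) :=
  [set A | exists (A0 : set Omega) (s t : R) (B C : set 'rV[R]_d),
    [/\ 0 <= s, F s A0, measurable B, B `<=` E & measurable C] /\
    A = (A0 `*` `]s, t]) `*` B `*` C].

Definition predictable g : Prop := forall Y : set R, measurable Y ->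
  <<s predictable_domain, predictable_rectangle >>
    (predictable_domain `&`
     (fun q => g q.1.1.1 q.1.1.2 q.1.2 q.2) @^-1` Y).

Definition predictable_version g g' : Prop :=
  predictable g' /\
  forall x : 'rV[R]_d, ae_wtv (fun w t v => g' w t v x = g w t v x).

(* The integral over (0, t] x E of f against N - dr x nu, for one sample [w]. *)
Definition compensated_integral (w : Omega) (t : R) (f : R -> 'rV[R]_d -> R) : R :=
  \int[N w]_(q in `]0, t] `*` E) f q.1 q.2 -
  \int[@lebesgue_measure R]_(r in `]0, t]) \int[nu]_(v in E) f r v.

(* As for any integral against a compensated Poisson random measure, an       *)
(* adapted integrand, which is a class for P x dt x nu, is replaced by a      *)
(* predictable version: [N w] charges dt-null sets.  The integrand being      *)
(* absolutely integrable, the integral is computed sample by sample, which    *)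
(* defines u(., x) for all t at once, up to indistinguishability.             *)
Definition is_mild_solution (K : R -> 'rV[R]_d -> R) g
    (u : R -> 'rV[R]_d -> Omega -> R) : Prop :=
  exists2 g', predictable_version g g' &
    forall x : 'rV[R]_d, {ae P, forall w, forall t : R, 0 <= t ->
      u t x w =
      compensated_integral w t (fun r v => heat_conv K (t - r) (g' w r v) x)}.

Definition is_realization (u u' : R -> 'rV[R]_d -> Omega -> R) : Prop :=
  (forall (t : R) x, 0 <= t -> measurable_fun [set: Omega] (u' t x)) /\
  forall x, {ae P, forall w, forall t : R, 0 <= t -> u' t x w = u t x w}.

Definition continuous_in_space (u : R -> 'rV[R]_d -> Omega -> R) : Prop :=
  {ae P, forall w, forall t : R, 0 <= t -> continuous (fun x => u t x w)}.

(* L^1(Omega; L^1_loc([0, oo); L^1(E, nu; L^oo(R^d)))) *)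
Definition in_L1_L1loc_L1_Loo g : Prop :=
  measurable_fun
    ([set: Omega] `*` `[(0 : R), +oo[%classic `*` E `*` [set: 'rV[R]_d])
    (fun q => g q.1.1.1 q.1.1.2 q.1.2 q.2) /\
  forall T : R, 0 < T ->
    (\int[P]_w \int[@lebesgue_measure R]_(t in `[0%R, T]) \int[nu]_(v in E)
       'N[lebesgue_rV d]_+oo[EFin \o g w t v] < +oo)%E.

(* L^p(Omega; L^1_loc([0, oo); L^1(E, nu)) \cap L^p_loc([0, oo); L^p(E, nu))) *)
Definition in_Lp_L1loc_Lploc (p : R) (h : Omega -> R -> 'rV[R]_d -> R) : Prop :=
  [/\ measurable_fun ([set: Omega] `*` `[(0 : R), +oo[%classic `*` E)
        (fun q => h q.1.1 q.1.2 q.2),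
      forall T : R, 0 < T ->
        (\int[P]_w (\int[@lebesgue_measure R]_(t in `[0%R, T]) \int[nu]_(v in E)
           `|h w t v|%:E) `^ p < +oo)%E &
      forall T : R, 0 < T ->
        (\int[P]_w \int[@lebesgue_measure R]_(t in `[0%R, T]) \int[nu]_(v in E)
           (`|h w t v| `^ p)%:E < +oo)%E].

Definition sup_modulus (phi : R -> R) (p beta T c1 : R)
    (u : R -> 'rV[R]_d -> Omega -> R) (w : Omega) : \bar R :=
  ereal_sup [set ereal_sup
    [set (`|u t q.1 w - u t q.2 w| `^ p
          / phi (enorm (q.1 - q.2)) `^ (beta * p))%:E
    | q in [set q : 'rV[R]_d * 'rV[R]_d |
            [/\ eball c1 q.1, eball c1 q.2 & q.1 <> q.2]]]
  | t in `[0, T]].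

End mild_solution.

(* Main.v *)
Require Import Defs.
From HB Require Import structures.
From mathcomp Require Import all_boot all_order all_algebra.
From mathcomp Require Import all_classical all_reals all_analysis.
From mathcomp Require Import measurable_realfun.
From mathcomp Require Import lra ring.
Set Implicit Arguments.
Unset Strict Implicit.
Unset Printing Implicit Defensive.
Import Order.TTheory GRing.Theory Num.Theory.
Import numFieldNormedType.Exports.
Local Open Scope classical_set_scope.
Local Open Scope ring_scope.

(** K(s, .) being a probability density, convolution with it preserves a modulus
    of continuity.  With omega(r) = r^(d/p) phi(r)^(1/p), M the random measure
    and Q its intensity dr x nu, this gives sample by sample, for all t <= T,
    |u(t,x) - u(t,y)| <= omega(|x-y|) (int h dM + int h dQ) over (0, T] x E, and
    omega(r)^p / phi(r)^(beta p) = r^d phi(r)^(1 - beta p) is bounded because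
    beta p < 1.  So no chaining is needed, only a bound for the p-th moment of
    int h dM by E (int h dQ)^p and E int h^p dQ: expand (a + b)^p over the
    increments of a fine time grid, apply the compensation formula, and absorb
    the mixed terms a^(p-1) b by Young's inequality.

    The bound on g(t,v,x) - g(t,v,y) holds almost everywhere for each pair x, y,
    whereas M charges sets of times of measure zero.  Hence the predictable
    version of g is replaced by its extension from the rational points, which is
    predictable, continuous in x and equal to it off a predictable null set for
    P x Q; by the compensation formula such a set is also null for M. *)

(** * Poisson random variables *)

(** Since [p] is any real number at least 1, the moment bound is proved by hand. Over the cells of
    the grid the powers [b^p] have to be compared with the integral of [h^p]. Jensen's inequality
    does this in every cell of mass at most 1, and two jumps in one cell become improbable on a fine
    grid. This needs finitely many jumps, and absorbing the mixed terms needs a moment known to be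
    finite. Hence the integrand is first bounded and the marks are kept away from 0; the constants
    depend on [p] only, so both restrictions can be removed. Integrability of the supremum also
    includes its measurability, although [t], [x] and [y] range over uncountable sets. Continuity in
    space and right-continuity in time reduce it to a countable supremum. Right-continuity comes
    from the initial condition and the continuity of the kernel, with Scheffe's lemma in place of a
    dominating function. For the same reason the field is built so that its regularity holds for
    every sample, with value 0 where an integral diverges. *)

Section kernel_exhaustion.
Local Open Scope ereal_scope.
Context d1 d2 (X : measurableType d1) (Y : measurableType d2) (R : realType).
Variables (k : R.-ker X ~> Y) (D : (set Y)^nat).
Hypotheses (mD : forall n, measurable (D n)) (ndD : nondecreasing_seq D).
Hypothesis k_fin : forall n x, k x (D n) < +oo.
Hypothesis k_out : forall x, k x (~` \bigcup_n D n) = 0.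

Lemma kernel_exhaustion_cvg x (A : set Y) : measurable A ->
  k x (A `&` D n) @[n --> \oo] --> k x A.
Proof.
move=> mA.
have mU : measurable (\bigcup_n D n) by exact: bigcup_measurable.
have -> : k x A = k x (\bigcup_n (A `&` D n)).
  rewrite -setI_bigcupr -[in LHS](setUIDK A (\bigcup_n D n)) measureU.
  - rewrite [X in _ + X](_ : _ = 0) ?adde0//.
    apply/eqP; rewrite eq_le measure_ge0 andbT -(k_out x) le_measure ?inE//.
    + exact: measurableD.
    + exact: measurableC.
  - exact: measurableI.
  - exact: measurableD.
  - by apply/seteqP; split => // y [[_ ?] [_]].
apply: nondecreasing_cvg_mu => //.
- by move=> n; exact: measurableI.
- by apply: bigcup_measurable => n _; exact: measurableI.
- move=> m n mn; apply/subsetPset; apply: setIS; exact/subsetPset/ndD.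
Qed.

(** A jump measure may have infinite total mass. It is finite on each [D n], with a bound depending
    on [x]; this gives measurability there, and the general case is a limit in [n]. *)
Lemma measurable_kernel_xsection (A : set (X * Y)) : measurable A ->
  measurable_fun setT (fun x => k x (xsection A x)).
Proof.
move=> mA.
apply: (emeasurable_fun_cvg (fun n x => k x (xsection A x `&` D n))).
  move=> n.
  have [] := @measurable_prod_subset_xsection_kernel _ _ _ _ _ k (D n) (mD n) _ A mA => // x.
  exists (fine (k x (D n)) + 1)%R => B mB.
  apply: (@le_lt_trans _ _ (k x (D n))).
    rewrite /= /mrestr; apply: le_measure; rewrite ?inE//.
    exact: measurableI.
  rewrite -[ltLHS]fineK ?lte_fin ?ltrDl//.
  by rewrite ge0_fin_numE//.
move=> x _; apply: kernel_exhaustion_cvg; exact: measurable_xsection.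
Qed.

Import HBNNSimple.

Lemma measurable_kernel_integral (f : X * Y -> \bar R) :
  (forall z, 0 <= f z) -> measurable_fun setT f ->
  measurable_fun setT (fun x => \int[k x]_y f (x, y)).
Proof.
move=> f0 mf; pose f_ := nnsfun_approx measurableT mf.
apply: (measurable_fun_xsection_integral f k f_).
- by move=> a b ab; exact/nd_nnsfun_approx.
- by move=> z; exact/cvg_nnsfun_approx.
- by move => n r; exact: measurable_kernel_xsection.
Qed.

End kernel_exhaustion.

(** * Composition of a measure with a kernel *)

Section semidirect.
Local Open Scope ereal_scope.
Context d1 d2 (X : measurableType d1) (Y : measurableType d2) (R : realType).
Variables (P : {measure set X -> \bar R}) (k : R.-ker X ~> Y).
Hypothesis mk : forall A : set (X * Y), measurable A ->
  measurable_fun setT (fun x => k x (xsection A x)).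

(** The measure [P(dx) k(x, dy)]. Binding [mk] makes the constant depend on the measurability from
    which its measure structure is derived. *)
Definition semidirect (A : set (X * Y)) : \bar R :=
  let _ := mk in \int[P]_x k x (xsection A x).

Let semi0 : semidirect set0 = 0.
Proof.
by rewrite /semidirect/=; apply: integral0_eq => x _; rewrite xsection0 measure0.
Qed.

Let semi_ge0 A : 0 <= semidirect A.
Proof. by apply: integral_ge0 => x _. Qed.

Let semi_sigma_additive : semi_sigma_additive semidirect.
Proof.
move=> F mF tF mUF; rewrite /semidirect/=.
have -> : \int[P]_x k x (xsection (\bigcup_n F n) x) =
    \sum_(n <oo) \int[P]_x k x (xsection (F n) x).
  rewrite -integral_nneseries//; last by move=> n; exact: mk.
  apply: eq_integral => x _; rewrite xsection_bigcup.
  apply/esym/cvg_lim => //.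
  apply: measure_semi_sigma_additive.
  - by move=> n; exact: measurable_xsection.
  - exact: trivIset_xsection.
  - by apply: bigcup_measurable => n _; exact: measurable_xsection.
by apply: is_cvg_nneseries => n _ _; apply: integral_ge0.
Qed.

HB.instance Definition _ := isMeasure.Build _ _ _ semidirect
  semi0 semi_ge0 semi_sigma_additive.

Import HBNNSimple.

Lemma integral_semidirect (f : X * Y -> \bar R) :
  (forall z, 0 <= f z) -> measurable_fun setT f ->
  \int[semidirect]_z f z = \int[P]_x \int[k x]_y f (x, y).
Proof.
move=> f0 mf; pose f_ := nnsfun_approx measurableT mf.
have ndf : nondecreasing_seq (f_ : (X * Y -> R)^nat).
  by move=> a b ab; exact/nd_nnsfun_approx.
have cf z : (f_ n z)%:E @[n --> \oo] --> f z by exact/cvg_nnsfun_approx.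
have mfx n x : measurable_fun setT (fun y => (f_ n (x, y))%:E).
  by apply/measurable_EFinP; apply: measurableT_comp => //; exact: measurable_pair1.
have Esec r n x : \int[k x]_y (r * \1_(f_ n @^-1` [set r]) (x, y))%:E =
    r%:E * k x (xsection (f_ n @^-1` [set r]) x).
  have E : (fun y => \1_(f_ n @^-1` [set r]) (x, y)) =
      \1_(xsection (f_ n @^-1` [set r]) x) :> (Y -> R).
    by apply/funext => y; rewrite !indicE mem_xsection.
  have mE : measurable (xsection (f_ n @^-1` [set r]) x) by exact: measurable_xsection.
  under eq_integral do rewrite (congr1 (fun h : Y -> R => h _) E) EFinM.
  have [r0|r0] := leP 0%R r.
    by rewrite ge0_integralZl//=; [rewrite integral_indic// setIT|
      exact/measurable_EFinP].
  rewrite integral0_eq; first by rewrite preimage_nnfun0// xsection0 measure0 mule0.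
  by move=> y _; rewrite preimage_nnfun0// xsection0 indic0 mule0.
have simple n : \int[semidirect]_z (f_ n z)%:E = \int[P]_x \int[k x]_y (f_ n (x, y))%:E.
  under [in LHS]eq_integral do rewrite fimfunE -fsumEFin//.
  rewrite ge0_integral_fsum//; last 2 first.
  - by move=> r; exact/measurable_EFinP/measurableT_comp.
  - by move=> r z _; rewrite EFinM nnfun_muleindic_ge0.
  transitivity (\int[P]_x \sum_(r \in range (f_ n)) (r%:E * k x (xsection (f_ n @^-1` [set r]) x))).
    rewrite ge0_integral_fsum//; last 2 first.
    + by move=> r; apply: measurable_funeM; exact: mk.
    + move=> r x _.
      have [r0|r0] := leP 0%R r; first by rewrite mule_ge0.
      by rewrite preimage_nnfun0// xsection0 measure0 mule0.
    apply: eq_fsbigr => r _.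
    under eq_integral do rewrite EFinM.
    have [r0|r0] := leP 0%R r.
      rewrite ge0_integralZl//=; last exact/measurable_EFinP.
      rewrite integral_indic//= setIT /semidirect/= ge0_integralZl//.
      exact: mk.
    rewrite integral0_eq; last by move=> y _; rewrite preimage_nnfun0// indic0 mule0.
    rewrite integral0_eq// => y _.
    by rewrite preimage_nnfun0// xsection0 measure0 mule0.
  apply: eq_integral => x _.
  transitivity (\int[k x]_y (\sum_(r \in range (f_ n)) (r * \1_(f_ n @^-1` [set r]) (x, y))%:E)).
    rewrite ge0_integral_fsum//; last 2 first.
    - move=> r; apply/measurable_EFinP; apply: measurable_funM => //.
      apply: (measurableT_comp (f := \1_(f_ n @^-1` [set r]) : X * Y -> R)) => //.
    - by move=> r z _; rewrite EFinM nnfun_muleindic_ge0.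
    by apply: eq_fsbigr => r _; rewrite Esec.
  by apply: eq_integral => y _; rewrite [in RHS]fimfunE -fsumEFin.
transitivity (limn (fun n => \int[semidirect]_z (f_ n z)%:E)).
  rewrite -monotone_convergence//.
  - by apply: eq_integral => y _; apply/esym/cvg_lim => //; exact: cf.
  - by move=> n; exact/measurable_EFinP.
  - by move=> n y _; rewrite lee_fin.
  - by move=> y _ m n mn; rewrite lee_fin; exact/lefP/ndf.
transitivity (limn (fun n => \int[P]_x \int[k x]_y (f_ n (x, y))%:E)).
  by congr (limn _); apply/funext => n; exact: simple.
rewrite -monotone_convergence//.
- apply: eq_integral => x _; rewrite -monotone_convergence//.
  + by apply: eq_integral => y _; apply/cvg_lim => //; exact: cf.
  + by move=> n y _; rewrite lee_fin.
  + by move=> y _ m n mn; rewrite lee_fin; exact/lefP/ndf.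
- move=> n.
  (* The approximating sequence is constant because [f_ n] is already simple. *)
  apply: (measurable_fun_xsection_integral (EFin \o f_ n) k (fun=> f_ n)).
  + by move=> a b ab.
  + by move=> z; exact: cvg_cst.
  + by move=> m r; exact: mk.
- by move=> n x _; apply: integral_ge0 => y _; rewrite lee_fin.
- move=> x _ m n mn; apply: ge0_le_integral => //.
  + by move=> y _; rewrite lee_fin.
  + by move=> y _; rewrite lee_fin; exact/lefP/ndf.
Qed.

End semidirect.

Lemma measure_bigcupT d (T : measurableType d) (R : realType)
    (mu : {measure set T -> \bar R}) (A : (set T)^nat) :
  (forall n, measurable (A n)) -> trivIset setT A ->
  mu (\bigcup_n A n) = (\sum_(0 <= k <oo) mu (A k))%E.
Proof.
move=> mA tA; rewrite measure_bigcup//.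
by apply: eq_eseriesl => k; rewrite in_setT.
Qed.

(** * Moments and tail of the Poisson law *)

Section poisson_law.
Local Open Scope ereal_scope.
Context {R : realType}.

Lemma poisson_prob1 (r : R) k : (0 < r)%R ->
  poisson_prob r 0 [set k] = (r ^+ k * k`!%:R^-1 * expR (- r))%:E.
Proof.
move=> r0; rewrite /poisson_prob r0 esum_set1 ?lee_fin ?poisson_pmf_ge0//.
by rewrite /poisson_pmf r0.
Qed.

Lemma poisson_prob1_0 k : poisson_prob (0 : R) 0 [set k] = (k == 0%N)%:R%:E.
Proof.
rewrite /poisson_prob ltxx diracE; congr (_%:R%:E).
have [->|k0] := eqVneq k 0%N; first by rewrite mem_set.
by rewrite memNset//= => /esym/eqP; rewrite (negbTE k0).
Qed.

(* The Chen-Stein identity. *)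
Lemma poisson_shift (r : R) (f : nat -> \bar R) : (0 <= r)%R -> (forall k, 0 <= f k) ->
  \sum_(0 <= k <oo) (k%:R%:E * f k * poisson_prob r 0 [set k]) =
  r%:E * \sum_(0 <= k <oo) (f k.+1 * poisson_prob r 0 [set k]).
Proof.
move=> r0 f0; rewrite nneseries_recl//; last first.
  by move=> k _; rewrite !mule_ge0.
rewrite mul0e mul0e add0e -(nneseries_addn 1); last first.
  by move=> k; rewrite !mule_ge0.
rewrite -nneseriesZl; last by move=> k _; rewrite mule_ge0.
apply: eq_eseriesr => k _; rewrite addn1.
move: r0; rewrite le_eqVlt => /predU1P[<-|r0].
  by rewrite poisson_prob1_0 mule0 mul0e.
rewrite !poisson_prob1// muleCA -muleA muleCA; congr (_ * _).
rewrite -!EFinM factS natrM invfM exprS; congr (_%:E).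
have k0 : (k.+1%:R : R) != 0%R by rewrite pnatr_eq0.
have kf0 : (k`!%:R : R) != 0%R by rewrite pnatr_eq0 -lt0n fact_gt0.
by field; rewrite kf0 addrC natr1 k0.
Qed.

Lemma poisson_sum1 (r : R) : \sum_(0 <= k <oo) (poisson_prob r 0 [set k]) = 1.
Proof.
rewrite -[RHS](@probability_setT _ _ _ (poisson_prob r 0)).
have -> : [set: nat] = \bigcup_k [set k] by apply/seteqP; split => // k _; exists k.
rewrite measure_bigcupT//; apply/trivIsetP => i j _ _ ij; apply/seteqP.
by split => // x [/= ->] /eqP; rewrite (negbTE ij).
Qed.

Lemma poisson_mean (r : R) : (0 <= r)%R ->
  \sum_(0 <= k <oo) (k%:R%:E * poisson_prob r 0 [set k]) = r%:E.
Proof.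
move=> r0; have := @poisson_shift r (fun=> 1) r0 (fun=> lee01).
under eq_eseriesr do rewrite mule1.
by under [in RHS]eq_eseriesr do rewrite mul1e; rewrite poisson_sum1 mule1.
Qed.

(** By induction: the shift identity gives [E X^(m+1) = r E (X+1)^m], and [(k+1)^m <= 2^m k^m + 1]
    for every natural number [k]. *)
Lemma poisson_moment (r : R) m : (0 <= r)%R ->
  \sum_(0 <= k <oo) ((k%:R ^+ m)%:E * poisson_prob r 0 [set k]) < +oo.
Proof.
move=> r0; elim: m => [|m ih].
  by under eq_eseriesr do rewrite expr0 mul1e; rewrite poisson_sum1 ltry.
have := @poisson_shift r (fun k => (k%:R ^+ m)%:E) r0.
under eq_eseriesr do rewrite -EFinM -exprS.
move=> ->; last by move=> k; rewrite lee_fin exprn_ge0.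
rewrite lte_mul_pinfty//.
apply: (@le_lt_trans _ _ (\sum_(0 <= k <oo) ((2 ^+ m)%:E * ((k%:R ^+ m)%:E * poisson_prob r 0 [set k])
   + poisson_prob r 0 [set k]))).
  apply: lee_nneseries => k _; first by rewrite mule_ge0// lee_fin exprn_ge0.
  rewrite muleA -EFinM -[X in _ + X]mul1e -ge0_muleDl// ?lee_fin ?mulr_ge0 ?exprn_ge0//.
  rewrite lee_wpmul2r// -EFinD lee_fin -exprMn.
  case: k => [|k]; first by rewrite expr1n lerDr mulr0 exprn_ge0.
  rewrite (@le_trans _ _ ((2 * k.+1%:R) ^+ m))%R ?lerDl//.
  by rewrite lerXn2r ?nnegrE ?mulr_ge0// -natrM ler_nat mul2n -addnn -addn1 leq_add2l.
rewrite nneseriesD; last 2 first.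
- by move=> k _ _; rewrite !mule_ge0// lee_fin exprn_ge0.
- by move=> k _ _.
rewrite poisson_sum1 nneseriesZl; last by move=> k _; rewrite mule_ge0// lee_fin exprn_ge0.
by rewrite lte_add_pinfty ?ltry// lte_mul_pinfty// lee_fin exprn_ge0.
Qed.

(** Markov's inequality for the factorial moment [E X (X-1) = r^2], itself a case of the shift
    identity. *)
Lemma poisson_tail (r : R) : (0 <= r)%R ->
  poisson_prob r 0 [set k | (1 < k)%N] <= (r ^+ 2)%:E.
Proof.
move=> r0.
have -> : (r ^+ 2)%:E = \sum_(0 <= k <oo) (k%:R%:E * (k.-1%:R%:E * poisson_prob r 0 [set k])).
  under eq_eseriesr do rewrite muleA.
  by rewrite (@poisson_shift r (fun k => k.-1%:R%:E))//= poisson_mean// -EFinM expr2.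
have -> : [set k | (1 < k)%N] = \bigcup_k ([set k] `&` [set k | (1 < k)%N]).
  by rewrite -setI_bigcupl; apply/seteqP; split => [k ?|k []//]; split => //; exists k.
rewrite measure_bigcupT//; last first.
  apply/trivIsetP => i j _ _ ij; apply/seteqP; split => // x [[/= -> _] [/eqP]].
  by rewrite (negbTE ij).
apply: lee_nneseries => // k _.
have [k1|k1] := ltnP 1 k.
  apply: (@le_trans _ _ (poisson_prob r 0 [set k])).
    by apply: le_measure; rewrite ?inE//.
  rewrite muleA -[leLHS]mul1e lee_wpmul2r// -EFinM lee_fin -natrM ler1n.
  by case: k k1 => [//|[//|k _]].
rewrite (_ : _ `&` _ = set0) ?measure0 ?mule_ge0//.
by apply/seteqP; split => // j [/= ->]; rewrite ltnNge k1.
Qed.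

End poisson_law.

Section poisson_variable.
Local Open Scope ereal_scope.
Context {R : realType} d (T : measurableType d) (P : probability T R).
Variables (X : T -> \bar R) (r : R).
Hypotheses (mX : measurable_fun setT X) (r0 : (0 <= r)%R).
Hypothesis lawX : forall A : set nat,
  P [set w | exists2 k, A k & X w = k%:R%:E] = poisson_prob r 0 A.

Let Xk k := X @^-1` [set k%:R%:E].

Let mXk k : measurable (Xk k).
Proof. by rewrite -[Xk k]setTI; apply: mX. Qed.

Let PXk k : P (Xk k) = poisson_prob r 0 [set k].
Proof.
rewrite -lawX; congr (P _); apply/seteqP; split => w /=; first by exists k.
by move=> [_ ->].
Qed.

Let tXk : trivIset setT Xk.
Proof.
apply/trivIsetP => i j _ _ ij; apply/seteqP; split => // w [/= Xi] /=.
rewrite /Xk/= Xi => /eqP; rewrite eqe eqr_nat.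
by rewrite (negbTE ij).
Qed.

(** [X] takes values in the extended reals and its law is prescribed only on events where it is a
    natural number. Taking [A = setT] shows that these events have total mass 1. *)
Lemma poisson_ae_nat : P (~` \bigcup_k Xk k) = 0.
Proof.
have mU : measurable (\bigcup_k Xk k) by apply: bigcup_measurable.
rewrite probability_setC//.
have := lawX setT; rewrite probability_setT.
rewrite (_ : [set w | _] = \bigcup_k Xk k); first by move=> ->; rewrite subee.
by apply/seteqP; split => w [k _ Xw]; exists k.
Qed.

Lemma poisson_fin : P (X @^-1` [set +oo]) = 0.
Proof.
apply: (subset_measure0 _ _ _ poisson_ae_nat).
- by rewrite -[_ @^-1` _]setTI; apply: mX.
- by apply: measurableC; exact: bigcup_measurable.
- by move=> w /= Xw [k _ /=]; rewrite /Xk/= Xw.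
Qed.

Lemma integral_poisson (C : set T) (g : T -> \bar R) (f : nat -> \bar R) :
  measurable C -> measurable_fun setT g -> (forall w, 0 <= g w) ->
  (forall w k, X w = k%:R%:E -> g w = f k) ->
  (forall k, P (C `&` Xk k) = P C * P (Xk k)) ->
  \int[P]_(w in C) g w = P C * \sum_(0 <= k <oo) (f k * poisson_prob r 0 [set k]).
Proof.
move=> mC mg g0 gf ind.
(* [f k] is tied to the nonnegative [g] only if the event [X = k] is nonempty; otherwise its weight
   is 0. *)
have f0 k : poisson_prob r 0 [set k] != 0 -> 0 <= f k.
  rewrite -PXk => PX0; have [w Xw] : Xk k !=set0.
    by apply/set0P; apply: contra_neq PX0 => ->; rewrite measure0.
  by rewrite -(gf _ _ Xw).
have f0' k : 0 <= f k * poisson_prob r 0 [set k].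
  have [->|?] := eqVneq (poisson_prob r 0 [set k]) 0; first by rewrite mule0.
  by rewrite mule_ge0// f0.
have mU : measurable (\bigcup_k Xk k) by apply: bigcup_measurable.
rewrite (@ge0_negligible_integral _ _ _ _ _ (~` \bigcup_k Xk k))//; last 3 first.
- exact: measurableC.
- exact: measurable_funTS.
- exact: poisson_ae_nat.
rewrite setDE setCK setI_bigcupr ge0_integral_bigcup//; last 3 first.
- by move=> k; exact: measurableI.
- exact: measurable_funTS.
- apply/trivIsetP => i j _ _ ij; rewrite setIACA.
  by move/trivIsetP : tXk => ->//; rewrite setI0.
have PC : P C = (fine (P C))%:E by rewrite fineK// fin_num_measure.
rewrite PC -nneseriesZl//; apply: eq_eseriesr => k _.
rewrite -PC; under eq_integral => w /[!inE] -[_ Xw] do rewrite (gf _ _ Xw).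
rewrite integral_cst; last exact: measurableI.
transitivity (f k * (P C * P (Xk k))); first by congr (_ * _); exact: ind.
by rewrite PXk muleCA.
Qed.

Lemma poisson_integral (C : set T) : measurable C -> (forall w, 0 <= X w) ->
  (forall k, P (C `&` Xk k) = P C * P (Xk k)) ->
  \int[P]_(w in C) X w = P C * r%:E.
Proof.
move=> mC X0 ind.
by rewrite (@integral_poisson _ _ (fun k => k%:R%:E))// poisson_mean.
Qed.

End poisson_variable.

(** * Time, marks and their intensity *)

Section restriction.
Local Open Scope ereal_scope.
Context d (T : measurableType d) (R : realType) (mu : {measure set T -> \bar R}).
Variables (D : set T) (mD : measurable D).

Lemma ge0_integral_mrestr (U : set T) (f : T -> \bar R) :
  measurable U -> measurable_fun U f -> (forall x, U x -> 0 <= f x) ->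
  \int[mrestr mu mD]_(x in U) f x = \int[mu]_(x in U `&` D) f x.
Proof.
move=> mU mf f0.
rewrite [LHS](@ge0_negligible_integral _ _ _ _ _ (~` D))//; last 2 first.
- exact: measurableC.
- by rewrite /= /mrestr setICl measure0.
rewrite setDE setCK; apply: eq_measure_integral => A mA AD /=.
by rewrite /mrestr; congr (mu _); apply: setIidl => x /AD[].
Qed.

Lemma mrestr_sigma_finite (F : (set T)^nat) : (forall n, measurable (F n)) ->
  D `<=` \bigcup_n F n -> (forall n, mu (F n `&` D) < +oo) ->
  sigma_finite setT (mrestr mu mD).
Proof.
move=> mF UF Foo; exists (fun n => F n `|` ~` D).
  apply/esym; rewrite -subTset => x _.
  have [/UF[n _ Fnx]|Dx] := pselect (D x); first by exists n => //; left.
  by exists 0%N => //; right.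
move=> n; split; first by apply: measurableU => //; exact: measurableC.
by rewrite /mrestr/= setIUl setICl setU0.
Qed.

End restriction.

Section null_sets.
Context d (T : measurableType d) (R : realType) (mu : {measure set T -> \bar R}).

Lemma measure_bigcup0 (Z : (set T)^nat) :
  (forall n, measurable (Z n) /\ mu (Z n) = 0%E) -> mu (\bigcup_n Z n) = 0%E.
Proof.
move=> hZ; apply: measure_negligible.
  by apply: bigcup_measurable => n _; exact: (hZ n).1.
apply: negligible_bigcup => n; apply/negligibleP; first exact: (hZ n).1.
exact: (hZ n).2.
Qed.

Lemma measureU_eq0 (A B : set T) : measurable A -> measurable B ->
  mu A = 0%E -> mu B = 0%E -> mu (A `|` B) = 0%E.
Proof.
move=> mA mB A0 B0; apply/eqP; rewrite -measure_le0.
have : (mu (A `|` B) <= mu A + mu B)%E by exact: measureU2.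
by rewrite A0 B0 add0e.
Qed.

Lemma ae_of_null (Z : set T) (Q : T -> Prop) : measurable Z -> mu Z = 0%E ->
  (forall x, ~ Z x -> Q x) -> {ae mu, forall x, Q x}.
Proof.
move=> mZ Z0 ZQ; exists Z; split => // x /= Qx.
by apply: contrapT => Zx; apply: Qx; exact: ZQ.
Qed.

Lemma null_of_ae (Q : T -> Prop) : {ae mu, forall x, Q x} ->
  exists Z, [/\ measurable Z, mu Z = 0%E & forall x, ~ Z x -> Q x].
Proof.
move=> [Z [mZ Z0 QZ]]; exists Z; split => // x Zx.
by apply: contrapT => Qx; apply: Zx; apply: QZ.
Qed.

Lemma measure_eq_null (A B Z : set T) : measurable A -> measurable B ->
  measurable Z -> mu Z = 0%E -> A `\` Z = B `\` Z -> mu A = mu B.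
Proof.
move=> mA mB mZ Z0 AB; rewrite (measureDI mu mA mZ) (measureDI mu mB mZ) AB.
by congr (_ + _)%E; rewrite (subset_measure0 _ mZ (@subIsetr _ A Z))//;
  [rewrite (subset_measure0 _ mZ (@subIsetr _ B Z))//|]; exact: measurableI.
Qed.

End null_sets.

(** * Augmentation of the filtration by null events *)

Section augmentation.
Context {R : realType} {dO : measure_display} {Omega : measurableType dO}.
Variables (P : probability Omega R) (F : R -> set (set Omega)).
Hypothesis hF : right_continuous_filtration F.

(** [F s] need not contain the null events, whereas [jump_measure] below differs from [N] on one.
    Adaptedness therefore holds only for these events, which agree with an event of [F s] off a
    measurable null set. *)
Definition augmentation (s : R) : set (set Omega) :=
  [set A | measurable A /\ exists2 A', F s A' &
     exists2 Z, measurable Z /\ P Z = 0%E & A `\` Z = A' `\` Z].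

Lemma sigma_algebra_augmentation s : 0 <= s ->
  sigma_algebra setT (augmentation s).
Proof.
move=> s0; have [F0 FC FU] := filtration_sigma_algebra hF s0; split.
- by split=> //; exists set0 => //; exists set0.
- move=> A [mA [A' FA' [Z [mZ Z0] AZ]]]; split; first exact: measurableD.
  exists (setT `\` A'); first exact: FC.
  exists Z => //.
  by apply/seteqP; split => x [[_ Ax] Zx]; split => //; split => // A'x;
    apply: Ax; have /seteqP[i1 i2] := AZ; [have [] := i2 x|have [] := i1 x].
- move=> A AA.
  have /choice[A' hA'] : forall n, exists A', F s A' /\
     exists2 Z, measurable Z /\ P Z = 0%E & A n `\` Z = A' `\` Z.
    by move=> n; have [_ [A' ? ?]] := AA n; exists A'.
  have /choice[Z hZ] : forall n, exists Z, (measurable Z /\ P Z = 0%E) /\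
      A n `\` Z = A' n `\` Z.
    by move=> n; have [_ [Z ? ?]] := hA' n; exists Z.
  split; first by apply: bigcup_measurable => n _; exact: (AA n).1.
  exists (\bigcup_k A' k); first by apply: FU => n; have [] := hA' n.
  exists (\bigcup_k Z k).
    split; first by apply: bigcup_measurable => n _; exact: (hZ n).1.1.
    by apply: measure_bigcup0 => n; exact: (hZ n).1.
  apply/seteqP; split => x [[n _ An] nZ]; split => //; exists n => //.
  + have [_ /seteqP[+ _]] := hZ n => /(_ x)[]//; split => // Zx.
    by apply: nZ; exists n.
  + have [_ /seteqP[_ +]] := hZ n => /(_ x)[]//; split => // Zx.
    by apply: nZ; exists n.
Qed.

Lemma augmentation_le s t : 0 <= s -> s <= t -> augmentation s `<=` augmentation t.
Proof.
move=> s0 st A [mA [A' FA' h]]; split => //; exists A' => //.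
exact: (filtration_nondecreasing hF s0 st).
Qed.

Lemma sub_augmentation s : 0 <= s -> F s `<=` augmentation s.
Proof.
move=> s0 A FA; split; first exact: (filtration_measurable hF s0).
by exists A => //; exists set0.
Qed.

Lemma augmentation_measurable s : augmentation s `<=` measurable.
Proof. by move=> A []. Qed.

Lemma augmentation_eq s (A A' Z : set Omega) : measurable Z -> P Z = 0%E ->
  A `\` Z = A' `\` Z -> measurable A -> augmentation s A' -> augmentation s A.
Proof.
move=> mZ PZ AA' mA [mA' [A1 FA1 [Z1 [mZ1 PZ1] A1Z]]]; split => //.
exists A1 => //; exists (Z `|` Z1).
  split; first exact: measurableU.
  exact: measureU_eq0.
rewrite -[LHS]classical_sets.setDDl AA' [LHS]classical_sets.setDDl setUC.
by rewrite -[LHS]classical_sets.setDDl A1Z classical_sets.setDDl.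
Qed.

(** Both sides see [A] only up to null sets, so independence of the past survives the
    augmentation. *)
Lemma augmentation_independent s (A : set Omega) (X : Omega -> \bar R) :
  0 <= s -> measurable_fun setT X ->
  augmentation s A -> independent_of_events P (F s) X ->
  forall C, measurable C -> P (A `&` X @^-1` C) = (P A * P (X @^-1` C))%E.
Proof.
move=> s0 mX [mA [A' FA' [Z [mZ PZ] AZ]]] ind C mC.
have mXC : measurable (X @^-1` C) by rewrite -[_ @^-1` _]setTI; exact: mX.
have mA' := filtration_measurable hF s0 FA'.
rewrite (measure_eq_null mA mA' mZ PZ AZ) -ind//.
apply: (measure_eq_null _ _ mZ PZ); [exact: measurableI..|].
by rewrite ![_ `&` X @^-1` C]setIC -!classical_sets.setIDA AZ.
Qed.

End augmentation.

Section time_measure.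
Local Open Scope ereal_scope.
Context {R : realType}.

(* Unlike [lebesgue_measure], it lives on the canonical Borel structure of R. *)
Definition time_measure (A : set R) : \bar R :=
  @lebesgue_measure R (A `&` `]0%R, +oo[).

Let time0 : time_measure set0 = 0.
Proof. by rewrite /time_measure set0I measure0. Qed.

Let time_ge0 A : 0 <= time_measure A.
Proof. exact: measure_ge0. Qed.

Let time_sigma_additive : semi_sigma_additive time_measure.
Proof.
move=> A mA tA mUA; rewrite /time_measure setI_bigcupl.
have mAD n : measurable (A n `&` `]0%R, +oo[) by exact: measurableI.
apply: (@measure_semi_sigma_additive _ _ _ (@lebesgue_measure R)) => //.
- by apply: trivIset_setIr.
- by rewrite -setI_bigcupl; exact: measurableI.
Qed.

HB.instance Definition _ := isMeasure.Build _ _ _ time_measure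
  time0 time_ge0 time_sigma_additive.

Let time_sigma_finite : sigma_finite setT time_measure.
Proof.
exists (fun n => `]- n%:R, n%:R[%classic)%R.
  apply/esym; rewrite -subTset => x _; exists (Num.truncn `|x|).+1 => //=.
  by rewrite in_itv/= -ltr_norml truncnS_gt.
move=> n; split; first exact: measurable_itv.
have : @lebesgue_measure R (`]- n%:R, n%:R[%classic)%R < +oo.
  by rewrite lebesgue_measure_itv/=; case: ifPn => //= _; rewrite ltry.
apply: le_lt_trans; apply: (@le_measure _ _ _ (@lebesgue_measure R));
  rewrite ?inE//.
by apply: measurableI; exact: measurable_itv.
Qed.

HB.instance Definition _ :=
  Measure_isSigmaFinite.Build _ _ _ time_measure time_sigma_finite.

Lemma ge0_integral_time_measure (U : set R) (f : R -> \bar R) :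
  measurable U -> measurable_fun U f -> (forall x, U x -> 0 <= f x) ->
  \int[time_measure]_(x in U) f x =
  \int[@lebesgue_measure R]_(x in U `&` `]0%R, +oo[) f x.
Proof.
move=> mU mf f0.
pose L := mrestr (@lebesgue_measure R) (measurable_itv `]0%R, +oo[).
(* The identity between the two measurable structures on [R]; pushing forward along it relates the
   two integrals. *)
pose i : measurableTypeR R -> R := idfun.
have mi : measurable_fun setT i by move=> _ Y mY; rewrite setTI.
rewrite -(@ge0_integral_mrestr _ _ _ (@lebesgue_measure R) _ (measurable_itv `]0%R, +oo[) U f)//.
rewrite -(@ge0_integral_pushforward _ _ _ _ _ i mi L U f)//; last first.
  by move=> x /[!inE]; exact: f0.
Qed.

End time_measure.

Section prod_sigma_finite.
Local Open Scope ereal_scope.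
Context d1 d2 (T1 : measurableType d1) (T2 : measurableType d2) (R : realType).
Variables (m1 : {sigma_finite_measure set T1 -> \bar R}).
Variables (m2 : {sigma_finite_measure set T2 -> \bar R}).

(* The library has no sigma-finite instance for [m1 \x m2]. *)
Definition prod_sigma_finite : set (T1 * T2) -> \bar R := m1 \x m2.

HB.instance Definition _ := Measure.on prod_sigma_finite.

Let sigma_finite_prod : sigma_finite setT prod_sigma_finite.
Proof.
have /sigma_finiteP[F [TF ndF Foo]] := sigma_finiteT m1.
have /sigma_finiteP[G [TG ndG Goo]] := sigma_finiteT m2.
exists (fun n => F n `*` G n).
  apply/esym; rewrite -subTset => -[x y] _.
  have : setT x by []. rewrite TF => -[i _ Fix].
  have : setT y by []. rewrite TG => -[j _ Gjy].
  exists (maxn i j) => //; split.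
  - by move: x Fix; exact/subsetPset/ndF/leq_maxl.
  - by move: y Gjy; exact/subsetPset/ndG/leq_maxr.
move=> k; have [mF Fkoo] := Foo k; have [mG Gkoo] := Goo k.
split; first exact: measurableX.
by rewrite /prod_sigma_finite product_measure1E// lte_mul_pinfty// ge0_fin_numE.
Qed.

HB.instance Definition _ := Measure_isSigmaFinite.Build _ _ _ prod_sigma_finite
  sigma_finite_prod.

End prod_sigma_finite.

Section levy_intensity.
Local Open Scope ereal_scope.
Context {R : realType} dV (V : measurableType dV).
Variables (nu : {measure set V -> \bar R}) (E : set V) (B : (set V)^nat).
Hypotheses (mE : measurable E) (mB : forall n, measurable (B n)).
Hypotheses (ndB : nondecreasing_seq B) (EB : E = \bigcup_n B n).
Hypothesis nuB : forall n, nu (B n) < +oo.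

(** The bound hypotheses record the exhaustion by sets of finite mass, on which the sigma-finite
    structure of this constant rests. *)
Definition mark_measure : set V -> \bar R := let _ := (mB, EB, nuB) in mrestr nu mE.

HB.instance Definition _ := Measure.on mark_measure.

Let mark_sigma_finite : sigma_finite setT mark_measure.
Proof.
apply: (@mrestr_sigma_finite _ _ _ _ _ _ B) => //; first by rewrite EB.
by move=> n; rewrite setIidl// EB; exact: bigcup_sup.
Qed.

HB.instance Definition _ :=
  Measure_isSigmaFinite.Build _ _ _ mark_measure mark_sigma_finite.

Definition jump_domain : set (R * V) := `]0%R, +oo[ `*` E.

Definition jump_piece n : set (R * V) := `]0%R, n.+1%:R] `*` B n.

Definition intensity : set (R * V) -> \bar R := prod_sigma_finite time_measure mark_measure.

HB.instance Definition _ := SigmaFiniteMeasure.on intensity.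

Lemma measurable_jump_domain : measurable jump_domain.
Proof. exact: measurableX. Qed.

Lemma measurable_jump_piece n : measurable (jump_piece n).
Proof. exact: measurableX. Qed.

Lemma nondecreasing_jump_piece : nondecreasing_seq jump_piece.
Proof.
move=> m n mn; apply/subsetPset => -[t v] [/=]; rewrite !in_itv/= => /andP[t0 tm] Bv.
split=> /=; last by move/subsetPset : (ndB mn); exact.
by rewrite in_itv/= t0 (le_trans tm)// ler_nat.
Qed.

Lemma bigcup_jump_piece : \bigcup_n jump_piece n = jump_domain.
Proof.
apply/seteqP; split=> [[t v] [n _ [/= ]]|[t v] [/=]].
  rewrite in_itv/= => /andP[t0 _] Bv; split => /=; first by rewrite in_itv/= t0.
  by rewrite EB; exists n.
rewrite in_itv/= andbT EB => t0 [n _ Bnv].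
exists (maxn n (Num.truncn t)) => //; split => /=.
  rewrite in_itv/= t0/=.
  rewrite (le_trans (ltW (truncnS_gt _)))// ler_nat ltnS leq_maxr//.
by move/subsetPset : (ndB (leq_maxl n (Num.truncn t))); exact.
Qed.

Lemma intensity_rect (a b : R) (C : set V) : (0 <= a)%R -> measurable C -> C `<=` E ->
  intensity (`]a, b] `*` C) = @lebesgue_measure R `]a, b] * nu C.
Proof.
move=> a0 mC CE.
rewrite [LHS](product_measure1E time_measure mark_measure (measurable_itv `]a, b]) mC)/=.
rewrite /time_measure/= /mark_measure/= /mrestr; congr (lebesgue_measure _ * nu _).
  apply: setIidl => x /=; rewrite !in_itv/= andbT => /andP[ax _].
  exact: le_lt_trans ax.
exact: setIidl.
Qed.

Lemma intensity_jump_piece n : intensity (jump_piece n) < +oo.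
Proof.
rewrite /jump_piece intensity_rect//; last by rewrite EB; exact: bigcup_sup.
rewrite lebesgue_measure_itv/= lte_fin ltr0n/= oppr0 adde0.
by rewrite lte_mul_pinfty.
Qed.

Lemma intensity_out : intensity (~` jump_domain) = 0.
Proof.
have mEc : measurable (~` E) by exact: measurableC.
have mTc : measurable (~` (`]0%R, +oo[%classic : set R)).
  by apply: measurableC; exact: measurable_itv.
rewrite (_ : ~` _ = (~` `]0%R, +oo[ `*` setT) `|` (setT `*` ~` E)).
  apply: measureU_eq0; [exact: measurableX..| |].
  - rewrite [LHS](product_measure1E time_measure mark_measure mTc measurableT)/=.
    by rewrite /time_measure setICl measure0 mul0e.
  - rewrite [LHS](product_measure1E time_measure mark_measure measurableT mEc)/=.
    by rewrite /mark_measure/= /mrestr setICl measure0 mule0.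
apply/seteqP; split => [[t v] /= /not_andP[?|?]|[t v] /= [[? _]|[_ ?]] []//]; [by left|by right].
Qed.

End levy_intensity.

(** * The compensation formula *)

Section jump_measure.
Local Open Scope ereal_scope.
Context {R : realType} {d : nat} {dO : measure_display} {Omega : measurableType dO}.
Variables (P : probability Omega R) (F : R -> set (set Omega)).
Hypothesis hF : right_continuous_filtration F.
Local Notation V := 'rV[R]_d.
Variables (E : set V) (nu : {measure set V -> \bar R}).
Variable N : R.-ker Omega ~> (R * V)%type.
Hypothesis hN : poisson_random_measure P E nu F N.
Variable B : (set V)^nat.
Hypotheses (mE : measurable E) (mB : forall n, measurable (B n)).
Hypotheses (ndB : nondecreasing_seq B) (EB : E = \bigcup_n B n).
Hypothesis nuB : forall n, nu (B n) < +oo.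

Local Notation D := (jump_domain E).
Local Notation Dn := (jump_piece B).

Let BE n : B n `<=` E. Proof. by rewrite EB; exact: bigcup_sup. Qed.

Definition finite_samples : set Omega := \bigcap_n [set w | N w (Dn n) < +oo].

Lemma measurable_finite_samples : measurable finite_samples.
Proof.
apply: bigcapT_measurable => n; rewrite -[X in measurable X]setTI.
apply: emeasurable_fun_infty_o => //.
exact: (measurable_kernel N _ (measurable_jump_piece mB n)).
Qed.

Lemma interval_count_law (a b : R) (C : set V) : (0 <= a)%R -> measurable C ->
  C `<=` E -> nu C < +oo -> forall A : set nat,
  P [set w | exists2 k, A k & N w (`]a, b] `*` C) = k%:R%:E] =
  poisson_prob (fine (nu C * @lebesgue_measure R `]a, b])) 0 A.
Proof.
move=> a0 mC CE nuC A; apply: (prm_poisson hN) => //.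
- by move=> x; rewrite /= !in_itv/= andbT => /andP[/ltW ax _]; exact: le_trans ax.
- by rewrite lebesgue_measure_itv/=; case: ifPn => //= _; rewrite ltry.
Qed.

Lemma measurable_interval_count (a b : R) (C : set V) : measurable C ->
  measurable_fun setT (fun w => N w (`]a, b] `*` C)).
Proof. by move=> mC; apply: (measurable_kernel N); exact: measurableX. Qed.

Lemma finite_samples_full : P (~` finite_samples) = 0.
Proof.
rewrite setC_bigcap; apply: measure_bigcup0 => n.
have nuBn := nuB n.
have -> : ~` [set w | N w (Dn n) < +oo] = (fun w => N w (Dn n)) @^-1` [set +oo].
  by apply/seteqP; split => w /=; [move/negP; rewrite -leNgt leye_eq => /eqP|
    move=> ->; rewrite ltxx].
have mN := measurable_interval_count 0 n.+1%:R (mB n).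
split; first by rewrite -[X in measurable X]setTI; exact: mN.
apply: (poisson_fin mN) => A.
exact: interval_count_law.
Qed.

(** [N w] may be infinite on some piece for exceptional [w]. Replacing it there by 0 makes every
    piece have finite mass for every sample, as differences of masses and the measurability lemmas
    require. *)
Definition jump_measure (w : Omega) : {measure set (R * V)%type -> \bar R} :=
  if w \in finite_samples then
    [the {measure set (R * V)%type -> \bar R} of
      mrestr (N w) (measurable_jump_domain mE)]
  else [the {measure set (R * V)%type -> \bar R} of mzero].

Let measurable_jump_measure U : measurable U ->
  measurable_fun [set: Omega] (jump_measure ^~ U).
Proof.
move=> mU.
rewrite (_ : (fun _ => _) = (fun w => if w \in finite_samples
   then N w (U `&` D) else 0)).
  apply: measurable_fun_ifT => //.
    apply: (@measurable_fun_bool _ _ _ _ true); rewrite setTI.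
    rewrite (_ : _ @^-1` _ = finite_samples); first exact: measurable_finite_samples.
    by apply/seteqP; split => w /= => [/set_mem|/mem_set].
  by apply: (measurable_kernel N); apply: measurableI => //; exact: measurable_jump_domain.
by apply/funext => w; rewrite /jump_measure; case: ifPn.
Qed.

HB.instance Definition _ := isKernel.Build _ _ _ _ R jump_measure
  measurable_jump_measure.

Lemma jump_measureE w A : finite_samples w -> jump_measure w A = N w (A `&` D).
Proof. by move=> hw; rewrite /jump_measure mem_set. Qed.

Lemma jump_measure_piece n w : jump_measure w (Dn n) < +oo.
Proof.
rewrite /jump_measure; case: ifPn => [/set_mem hw|_] /=; last by rewrite /mzero.
rewrite /mrestr setIidl; first exact: hw.
by rewrite -(bigcup_jump_piece ndB EB); exact: bigcup_sup.
Qed.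

Lemma jump_measure_out w : jump_measure w (~` \bigcup_n Dn n) = 0.
Proof.
rewrite (bigcup_jump_piece ndB EB).
rewrite /jump_measure; case: ifPn => [/set_mem hw|_] /=; last by rewrite /mzero.
by rewrite /mrestr setICl measure0.
Qed.

Local Notation M := jump_measure.

Lemma jump_rect_finite w n (b : R) (C : set V) : measurable C -> C `<=` B n ->
  M w (`]0%R, b] `*` C) < +oo.
Proof.
move=> mC CB; have := jump_measure_piece (maxn n (Num.truncn b)) w.
apply: le_lt_trans; apply: le_measure; rewrite ?inE.
- exact: measurableX.
- exact: measurable_jump_piece.
move=> [t v] [/=]; rewrite !in_itv/= => /andP[t0 tb] Cv; split => /=.
  rewrite in_itv/= t0/= (le_trans tb)// (le_trans (ltW (truncnS_gt _)))//.
  by rewrite ler_nat ltnS leq_maxr.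
by move/subsetPset : (ndB (leq_maxl n (Num.truncn b))); apply; exact: CB.
Qed.

Lemma jump_rectE w (a b : R) (C : set V) : finite_samples w -> (0 <= a)%R ->
  C `<=` E -> M w (`]a, b] `*` C) = N w (`]a, b] `*` C).
Proof.
move=> hw a0 CE; rewrite jump_measureE//; congr (N w _); apply: setIidl.
move=> [t v] [/=]; rewrite !in_itv/= => /andP[ta _] Cv; split => /=.
  by rewrite in_itv/= andbT (le_lt_trans a0).
exact: CE.
Qed.

(** Adaptedness is prescribed for intervals starting at 0. Other intervals are reached as
    differences, which is why [C] lies in some [B n], where masses are finite. *)
Lemma jump_rect_diff w n (a b : R) (C : set V) : (0 <= a)%R -> (a <= b)%R ->
  measurable C -> C `<=` B n ->
  M w (`]a, b] `*` C) = M w (`]0%R, b] `*` C) - M w (`]0%R, a] `*` C).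
Proof.
move=> a0 ab mC CB.
have -> : `]0%R, b] `*` C = (`]0%R, a] `*` C) `|` (`]a, b] `*` C).
  apply/seteqP; split => [[t v]|[t v] [|]] [/=]; rewrite !in_itv/= => /andP[t1 t2] Cv.
  - have [ta|ta] := leP t a; [left|right]; split => //=; rewrite ?t1 ?ta//.
  - by split => //=; rewrite t1 (le_trans t2).
  - by split => //=; rewrite t2 andbT (le_lt_trans a0).
rewrite measureU.
- by rewrite addeAC subee ?add0e// ge0_fin_numE// (jump_rect_finite _ _ mC CB).
- exact: measurableX.
- exact: measurableX.
- apply/seteqP; split => // -[t v] [[/=]]; rewrite !in_itv/= => /andP[_ ta] _ [/=].
  by rewrite ltNge ta.
Qed.

Lemma measurable_jump_rect0 (t b : R) (C : set V) : (0 <= b)%R -> (b <= t)%R ->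
  measurable C -> C `<=` E ->
  measurable_fun [set: g_sigma_algebraType (augmentation P F t)]
    (fun w => M w (`]0%R, b] `*` C)).
Proof.
move=> b0 bt mC CE _ Y mY; rewrite setTI.
have t0 := le_trans b0 bt.
have [b00|b_gt0] := leP b 0%R.
  rewrite (_ : (fun w => _) = cst 0).
    by have := @measurable_cst _ _ (g_sigma_algebraType (augmentation P F t)) _ setT (0 : \bar R) measurableT Y mY; rewrite setTI.
  apply/funext => w; rewrite (_ : _ `*` _ = set0) ?measure0//.
  by rewrite set_itv_ge ?set0X// bnd_simp -leNgt.
apply: sub_sigma_algebra.
(* On finite samples the count is that of [N], which is adapted; the other samples form a null
   event, absorbed by the augmentation. *)
apply: (@augmentation_eq _ _ _ P F t _ ((fun w => N w (`]0%R, b] `*` C)) @^-1` Y) (~` finite_samples)).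
- by apply: measurableC; exact: measurable_finite_samples.
- exact: finite_samples_full.
- by apply/seteqP; split => w /= [Yw hw]; split => //; move: Yw; rewrite jump_rectE//;
    exact: contrapT.
- have := measurable_kernel M (`]0%R, b] `*` C) (measurableX (measurable_itv _) mC).
  by move=> /(_ measurableT Y mY); rewrite setTI.
- apply: (augmentation_le hF (ltW b_gt0) bt); apply: (sub_augmentation P hF (ltW b_gt0)).
  exact: (prm_adapted hN).
Qed.

Lemma measurable_jump_rect n (t a b : R) (C : set V) : (0 <= a)%R -> (0 <= t)%R ->
  (b <= t)%R -> measurable C -> C `<=` B n ->
  measurable_fun [set: g_sigma_algebraType (augmentation P F t)]
    (fun w => M w (`]a, b] `*` C)).
Proof.
move=> a0 t0 bt mC CB.
have CE : C `<=` E by exact: subset_trans (@BE n).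
have [ab|ba] := leP a b; last first.
  rewrite (_ : (fun w => _) = cst 0); first exact: measurable_cst.
  apply/funext => w; rewrite (_ : _ `*` _ = set0) ?measure0//.
  by rewrite set_itv_ge ?set0X// bnd_simp -leNgt ltW.
under eq_fun do rewrite (jump_rect_diff _ a0 ab mC CB).
apply: emeasurable_funB.
- exact: measurable_jump_rect0 (le_trans a0 ab) bt mC CE.
- exact: measurable_jump_rect0 a0 (le_trans ab bt) mC CE.
Qed.

(** The compensation formula for one predictable rectangle: the count in []a, b]] is independent of
    the past event [A] and its Poisson mean is the intensity. *)
Lemma jump_rect_mean n (a b : R) (C : set V) (A : set Omega) : (0 <= a)%R ->
  measurable C -> C `<=` B n -> augmentation P F a A ->
  \int[P]_(w in A) M w (`]a, b] `*` C) =
  P A * intensity mE mB EB nuB (`]a, b] `*` C).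
Proof.
move=> a0 mC CB hA.
have CE : C `<=` E by exact: subset_trans (@BE n).
have mA : measurable A by exact: (augmentation_measurable hA).
rewrite intensity_rect//.
have [ba|ab] := leP b a.
  rewrite integral0_eq; last first.
    move=> w _; rewrite (_ : _ `*` _ = set0) ?measure0//.
    by rewrite set_itv_ge ?set0X// bnd_simp -leNgt.
  by rewrite set_itv_ge ?measure0 ?mul0e ?mule0// bnd_simp -leNgt.
have nuC : nu C < +oo by rewrite (le_lt_trans _ (nuB n))// le_measure// inE.
have mN := measurable_interval_count a b mC.
transitivity (\int[P]_(w in A) N w (`]a, b] `*` C)).
  apply: ae_eq_integral => //.
  - apply: measurable_funTS; apply: (measurable_kernel M); exact: measurableX.
  - exact: measurable_funTS.
  - apply: (ae_of_null _ finite_samples_full).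
      by apply: measurableC; exact: measurable_finite_samples.
    by move=> w /contrapT hw _; rewrite jump_rectE.
have lab : @lebesgue_measure R `]a, b] = (b - a)%:E.
  by rewrite lebesgue_measure_itv/= lte_fin ab -EFinD.
rewrite (@poisson_integral _ _ _ P _ _ mN _ (interval_count_law b a0 mC CE nuC))//.
- have fnu : nu C \is a fin_num by rewrite ge0_fin_numE.
  by rewrite lab fineK ?fin_numM// [nu C * _]muleC.
- by rewrite fine_ge0// mule_ge0.
- move=> k; apply: (augmentation_independent hF a0 mN hA) => //.
  exact: (prm_increments hN).
Qed.

Local Notation Q := (intensity mE mB EB nuB).

(** The additional set makes the class cover the whole space; it is null for both measures compared
    in [predictable_measureE]. Marks are confined to some [B n] so that rectangles have finite
    mass. *)
Definition predictable_class : set (set (Omega * (R * V))) :=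
  [set A | (exists A0 a b C n, [/\ (0 <= a)%R, augmentation P F a A0,
     measurable C, C `<=` B n & A = A0 `*` (`]a, b] `*` C)]) \/
     A = ~` (setT `*` D)].

Lemma sub_predictable_measurable : predictable_class `<=` measurable.
Proof.
move=> A [[A0 [a [b [C [n [a0 hA mC CB ->]]]]]]|->].
  by apply: measurableX; [exact: (augmentation_measurable hA)|exact: measurableX].
apply: measurableC; apply: measurableX => //; exact: measurable_jump_domain mE.
Qed.

Lemma setI_closed_predictable : setI_closed predictable_class.
Proof.
have rectD A0 (a b : R) C n : (0 <= a)%R -> C `<=` B n ->
    A0 `*` (`]a, b] `*` C) `<=` (setT : set Omega) `*` D.
  move=> a0 CB -[w [t v]] [_ [/=]]; rewrite in_itv/= => /andP[at_ _] Cv.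
  by split => //; split => /=; [rewrite in_itv/= andbT (le_lt_trans a0)|exact/BE/CB].
have e0 : predictable_class set0.
  left; exists set0, 0%R, 0%R, set0, 0%N; split => //.
  - by have [] := sigma_algebra_augmentation P hF (lexx 0%R).
  - by rewrite set0X.
move=> A1 A2 [[A [a [b [C [n [a0 hA mC CB ->]]]]]]|->]; last first.
  move=> [[A [a [b [C [n [a0 hA mC CB ->]]]]]]|->]; last by right; rewrite setIid.
  by rewrite setIC (_ : _ `&` _ = set0)//; apply/disjoints_subset; rewrite setCK; exact: rectD a0 CB.
move=> [[A' [a' [b' [C' [n' [a0' hA' mC' CB' ->]]]]]]|->]; last first.
  by rewrite (_ : _ `&` _ = set0)//; apply/disjoints_subset; rewrite setCK; exact: rectD a0 CB.
(* The common time interval begins at the later of the two left ends, where both events are already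
   known. *)
left; exists (A `&` A'), (Num.max a a'), (Num.min b b'), (C `&` C'), n; split.
- by rewrite le_max a0.
- have m0 : (0 <= Num.max a a')%R by rewrite le_max a0.
  have h := sigma_algebra_augmentation P hF m0.
  have hm : augmentation P F (Num.max a a') A.
    by apply: (augmentation_le hF a0 _ hA); rewrite le_max lexx.
  have hm' : augmentation P F (Num.max a a') A'.
    by apply: (augmentation_le hF a0' _ hA'); rewrite le_max lexx orbT.
  have := @measurableI _ (g_sigma_algebraType (augmentation P F (Num.max a a'))) A A'.
  by rewrite /measurable/= sigma_algebra_id//; exact.
- exact: measurableI.
- by apply: subset_trans CB; exact: subIsetl.
- apply/seteqP; split => -[w [t v]] /=; rewrite !in_itv/= gt_max le_min.
    by move=> [[Aw [/andP[at_ tb] Cv]] [A'w [/andP[at' tb'] C'v]]]; rewrite at_ tb at' tb'.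
  by move=> [[Aw A'w] [/andP[/andP[at_ tb] /andP[at' tb']] [Cv C'v]]];
    rewrite at_ tb at' tb'.
Qed.

Lemma measurable_jump_xsection (A : set (Omega * (R * V))) : measurable A ->
  measurable_fun setT (fun w => M w (xsection A w)).
Proof.
apply: (@measurable_kernel_xsection _ _ _ _ _ M Dn).
- exact: measurable_jump_piece.
- exact: nondecreasing_jump_piece.
- exact: jump_measure_piece.
- exact: jump_measure_out.
Qed.

Let semi_rect (A : set Omega) (S : set (R * V)) : measurable A ->
  semidirect P measurable_jump_xsection (A `*` S) = \int[P]_(w in A) M w S.
Proof.
move=> mA; rewrite /semidirect/= [RHS]integral_mkcond; apply: eq_integral => w _.
rewrite patchE; case: ifPn => wA; first by rewrite in_xsectionX.
by rewrite notin_xsectionX// measure0.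
Qed.

Let jump_out_prod : (P \x Q) (~` (setT `*` D)) = 0.
Proof.
have mD := @measurable_jump_domain R _ _ _ mE.
rewrite (_ : ~` _ = setT `*` ~` D).
  rewrite [LHS](product_measure1E P Q measurableT (measurableC mD))/=.
  by rewrite [X in _ * X]intensity_out// mule0.
apply/seteqP; split => [[w z] /= /not_andP[//|]//|[w z] /= [_ hz] [_]//].
Qed.

Let semi_out : semidirect P measurable_jump_xsection (~` (setT `*` D)) = 0.
Proof.
rewrite (_ : ~` _ = setT `*` ~` D).
  rewrite semi_rect//; apply: integral0_eq => w _.
  by have := jump_measure_out w; rewrite (bigcup_jump_piece ndB EB).
apply/seteqP; split => [[w z] /= /not_andP[//|]//|[w z] /= [_ hz] [_]//].
Qed.

(** Two measures agreeing on a class stable under intersection agree on the generated sigma-algebra,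
    given a cover by members of finite mass. The cover consists of the pieces [setT] times [Dn k],
    with the null outside as member 0. *)
Lemma predictable_measureE (A : set (Omega * (R * V))) :
  <<s predictable_class >> A ->
  semidirect P measurable_jump_xsection A = (P \x Q) A.
Proof.
have pE A0 : predictable_class A0 ->
    semidirect P measurable_jump_xsection A0 = (P \x Q) A0.
  move=> [[A1 [a [b [C [n [a0 hA mC CB ->]]]]]]|->]; last first.
    by rewrite semi_out; exact/esym/jump_out_prod.
  have mA := augmentation_measurable hA.
  have mS : measurable (`]a, b] `*` C) by exact: measurableX.
  rewrite semi_rect// (jump_rect_mean b a0 mC CB hA).
  exact/esym/(product_measure1E P Q mA mS).
move=> hA.
apply: (@g_sigma_algebra_measure_unique _ R (Omega * (R * V))%type predictable_class
  sub_predictable_measurable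
  (fun k => if k is k'.+1 then setT `*` Dn k' else ~` (setT `*` D))) => //.
- case=> [|k]; first by right.
  left; exists setT, 0%R, k.+1%:R, (B k), k; split => //.
  by have := @measurableT _ (g_sigma_algebraType (augmentation P F 0));
    rewrite /measurable/= sigma_algebra_id//; exact: sigma_algebra_augmentation.
- rewrite -subTset => -[w z] _.
  have [Dz|Dz] := pselect (D z); last by exists 0%N => //= -[].
  by move: Dz; rewrite -(bigcup_jump_piece ndB EB) => -[k _ Dk]; exists k.+1.
- exact: setI_closed_predictable.
- case=> [|k]; first by rewrite [ltLHS]semi_out.
  rewrite [ltLHS]pE; last first.
    left; exists setT, 0%R, k.+1%:R, (B k), k; split => //.
    by have := @measurableT _ (g_sigma_algebraType (augmentation P F 0));
      rewrite /measurable/= sigma_algebra_id//; exact: sigma_algebra_augmentation.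
  rewrite [ltLHS](product_measure1E P Q measurableT (measurable_jump_piece mB k))/=.
  by rewrite probability_setT mul1e; exact: intensity_jump_piece.
Qed.

Local Notation PZ := (g_sigma_algebraType predictable_class).

Lemma predictable_measurable_fun dU (U : measurableType dU) (f : Omega * (R * V) -> U) :
  measurable_fun [set: PZ] f -> measurable_fun setT f.
Proof.
move=> mf _ Y mY; have := mf measurableT Y mY; rewrite !setTI.
apply: smallest_sub; last exact: sub_predictable_measurable.
exact: sigma_algebra_measurable.
Qed.

Lemma compensation (f : Omega * (R * V) -> \bar R) : (forall z, 0 <= f z) ->
  measurable_fun [set: PZ] f ->
  \int[P]_w \int[M w]_z f (w, z) = \int[P]_w \int[Q]_z f (w, z).
Proof.
move=> f0 mf; have mf' := predictable_measurable_fun mf.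
rewrite -(integral_semidirect P measurable_jump_xsection f0 mf').
transitivity (\int[P \x Q]_z f z); last by rewrite fubini_tonelli1.
(* The two measures agree only on predictable sets. Their images under the identity into [PZ] are
   therefore equal, and [f] is measurable there. *)
pose i : Omega * (R * V) -> PZ := idfun.
have mi : measurable_fun setT i.
  by apply: (@predictable_measurable_fun _ PZ i); exact: measurable_id.
have h1 := @ge0_integral_pushforward _ _ _ _ _ i mi
  [the measure _ _ of semidirect P measurable_jump_xsection] setT f measurableT mf
  (fun z _ => f0 z).
have h2 := @ge0_integral_pushforward _ _ _ _ _ i mi
  [the measure _ _ of P \x Q] setT f measurableT mf (fun z _ => f0 z).
rewrite preimage_setT in h1 h2; rewrite -[LHS]h1 -[RHS]h2.
by apply: eq_measure_integral => A mA _; exact: predictable_measureE.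
Qed.

End jump_measure.

(** * Moments of jump integrals *)

Section powers.
Context {R : realType}.
Implicit Types p a b x y C : R.

(* Young's inequality, i.e. the tangent inequality of the convex power p. *)
Lemma powR_tangent p y a : 1 <= p -> 0 <= y -> 0 <= a ->
  p * (y * a `^ (p - 1)) <= y `^ p + (p - 1) * a `^ p.
Proof.
move=> p1 y0 a0; have [->|pn1] := eqVneq p 1.
  by rewrite subrr powRr0 mulr1 mul1r mul0r addr0 powRr1.
have p0 : 0 < p by exact: lt_le_trans p1.
have p10 : 0 < p - 1 by rewrite subr_gt0 lt_neqAle eq_sym pn1.
pose q := p / (p - 1).
have q0 : 0 < q by rewrite divr_gt0.
have pq : p^-1 + q^-1 = 1 by rewrite /q; field; rewrite !gt_eqF.
have := conjugate_powR y0 (powR_ge0 a (p - 1)) p0 q0 pq.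
rewrite -powRrM (_ : (p - 1) * q = p); last by rewrite /q; field; rewrite gt_eqF.
rewrite -(ler_pM2l p0) => /le_trans; apply.
by rewrite le_eqVlt; apply/orP; left; apply/eqP; rewrite /q; field; rewrite !gt_eqF.
Qed.

(** The tangent inequality at [a + b] gives [(a+b)^p <= a^p + p b (a+b)^(p-1)], and [(a+b)^(p-1)] is
    at most [2^(p-1)] times the larger of [a^(p-1)] and [b^(p-1)]. The coefficient of [a^p] stays 1,
    so the inequality can be iterated over a grid of any fineness. *)
Lemma powRD_le p a b : 1 <= p -> 0 <= a -> 0 <= b ->
  (a + b) `^ p <= a `^ p + p * 2 `^ (p - 1) * (a `^ (p - 1) * b + b `^ p).
Proof.
move=> p1 a0 b0.
have p0 : 0 < p by exact: lt_le_trans p1.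
have c0 : 0 <= a + b by exact: addr_ge0.
have cp : (a + b) `^ p = (a + b) * (a + b) `^ (p - 1) by rewrite mulr_powRB1.
have h : (a + b) `^ p <= a `^ p + p * (b * (a + b) `^ (p - 1)).
  have := powR_tangent p1 a0 c0.
  rewrite cp; set c := (a + b) `^ (p - 1).
  by rewrite mulrDl => hh; nra.
apply: (le_trans h); rewrite lerD2l -mulrA ler_pM2l//.
have bp : b `^ p = b * b `^ (p - 1) by rewrite mulr_powRB1.
rewrite bp (_ : _ * (_ + _) = b * (2 `^ (p - 1) * (a `^ (p - 1) + b `^ (p - 1))));
  last by ring.
rewrite ler_wpM2l//.
have m0 : 0 <= Num.max a b by rewrite le_max a0.
apply: (@le_trans _ _ ((2 * Num.max a b) `^ (p - 1))).
  apply: ge0_ler_powR; rewrite ?nnegrE ?subr_ge0 ?mulr_ge0//.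
  by rewrite mulr_natl mulr2n lerD// le_max lexx ?orbT.
rewrite powRM// ler_wpM2l ?powR_ge0//.
have [ab|ba] := leP a b; first by rewrite lerDr powR_ge0.
by rewrite lerDl powR_ge0.
Qed.

(** If [x >= 2 C a] then the left side is at most [x^p / 2]; otherwise
    [x^(p-1) <= (2 C a)^(p-1)]. *)
Lemma powR_absorb p C x a : 1 <= p -> 0 <= C -> 0 <= x -> 0 <= a ->
  C * (x `^ (p - 1) * a) <= x `^ p / 2 + C * (2 * C) `^ (p - 1) * a `^ p.
Proof.
move=> p1 C0 x0 a0.
have p0 : 0 < p by exact: lt_le_trans p1.
have xp : x `^ p = x * x `^ (p - 1) by rewrite mulr_powRB1.
have ap : a `^ p = a * a `^ (p - 1) by rewrite mulr_powRB1.
have h1 := powR_ge0 x (p - 1); have h2 := powR_ge0 a p.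
have h3 := powR_ge0 (2 * C) (p - 1).
have [Cx|xC] := leP (2 * C * a) x.
  have h4 : 0 <= C * (2 * C) `^ (p - 1) * a `^ p by rewrite !mulr_ge0.
  apply: (@le_trans _ _ (x `^ p / 2)); last by rewrite lerDl.
  by rewrite xp; nra.
apply: (@le_trans _ _ (C * (2 * C) `^ (p - 1) * a `^ p)); last first.
  by rewrite lerDr xp divr_ge0// mulr_ge0.
rewrite ap -mulrA ler_wpM2l// [leRHS]mulrCA [leRHS]mulrC -[leRHS]mulrA.
rewrite [leRHS]mulrA ler_wpM2r//.
rewrite (le_trans (ge0_ler_powR _ _ _ (ltW xC)))//.
- by rewrite subr_ge0.
- by rewrite nnegrE !mulr_ge0.
- by rewrite powRM ?mulr_ge0.
Qed.

End powers.

Section jensen.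
Local Open Scope ereal_scope.
Context d (T : measurableType d) (R : realType) (mu : {measure set T -> \bar R}).

(** The tangent inequality at the integral [a] of [f] is integrated over [S]; its constant term
    [(p-1) a^p] is multiplied by [mu S], so mass at most 1 is enough. *)
Lemma jensen_powR_subprob (S : set T) (f : T -> R) (p : R) : measurable S ->
  mu S <= 1 -> (1 <= p)%R -> measurable_fun S f -> (forall x, S x -> (0 <= f x)%R) ->
  \int[mu]_(x in S) (f x)%:E < +oo ->
  (fine (\int[mu]_(x in S) (f x)%:E) `^ p)%:E <= \int[mu]_(x in S) (f x `^ p)%:E.
Proof.
move=> mS S1 p1 mf f0 foo; set I := \int[mu]_(x in S) (f x)%:E.
have I0 : 0 <= I by apply: integral_ge0 => x Sx; rewrite lee_fin f0.
have IE : I = (fine I)%:E by rewrite fineK// ge0_fin_numE.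
set a := fine I; have a0 : (0 <= a)%R by rewrite fine_ge0.
have p0 : (0 < p)%R by exact: lt_le_trans p1.
have mfp : measurable_fun S (fun x => f x `^ p)%R.
  exact: (measurableT_comp (measurable_powR _)).
set J := \int[mu]_(x in S) _.
have J0 : 0 <= J by apply: integral_ge0 => x Sx; rewrite lee_fin powR_ge0.
have : \int[mu]_(x in S) ((p * a `^ (p - 1))%:E * (f x)%:E) <=
       \int[mu]_(x in S) ((f x `^ p)%:E + ((p - 1) * a `^ p)%:E).
  apply: ge0_le_integral => //.
  - by move=> x Sx; rewrite mule_ge0// lee_fin ?f0// mulr_ge0 ?powR_ge0// ltW.
  - by apply: measurable_funeM; exact/measurable_EFinP.
  - by apply: emeasurable_funD; [exact/measurable_EFinP|exact: measurable_cst].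
  - move=> x Sx; rewrite -EFinM -EFinD lee_fin -mulrA [(a `^ _ * _)%R]mulrC.
    by rewrite powR_tangent// f0.
rewrite ge0_integralZl//; last 2 first.
- exact/measurable_EFinP.
- by rewrite lee_fin mulr_ge0 ?powR_ge0// ltW.
have c0 : (0 <= (p - 1) * a `^ p)%R by rewrite mulr_ge0 ?powR_ge0// subr_ge0.
rewrite ge0_integralD//; last 2 first.
- by move=> x Sx; rewrite lee_fin powR_ge0.
- exact/measurable_EFinP.
rewrite integral_cst// -/I -/J IE -EFinM -mulrA [(a `^ _ * _)%R]mulrC mulr_powRB1//.
move=> h.
have : (p * a `^ p)%:E <= J + ((p - 1) * a `^ p)%:E.
  apply: (le_trans h); rewrite leeD2l// -[leRHS]mule1 lee_wpmul2l//.
move: J J0 {h} => [j| |]//; rewrite ?leey// => j0; rewrite -EFinD !lee_fin mulrBl mul1r.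
by lra.
Qed.

End jensen.

(** * Jump counts in short intervals and integrals over the past *)

Section moments.
Local Open Scope ereal_scope.
Context {R : realType} {d : nat} {dO : measure_display} {Omega : measurableType dO}.
Variables (P : probability Omega R) (F : R -> set (set Omega)).
Hypothesis hF : right_continuous_filtration F.
Local Notation V := 'rV[R]_d.
Variables (E : set V) (nu : {measure set V -> \bar R}).
Variable N : R.-ker Omega ~> (R * V)%type.
Hypothesis hN : poisson_random_measure P E nu F N.
Variable B : (set V)^nat.
Hypotheses (mE : measurable E) (mB : forall n, measurable (B n)).
Hypotheses (ndB : nondecreasing_seq B) (EB : E = \bigcup_n B n).
Hypothesis nuB : forall n, nu (B n) < +oo.

Local Notation M := (jump_measure N B mE).
Local Notation Q := (intensity mE mB EB nuB).
Local Notation PZ := (g_sigma_algebraType (predictable_class P F E B)).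
Local Notation Om t := (g_sigma_algebraType (augmentation P F t)).

Let BE n : B n `<=` E. Proof. by rewrite EB; exact: bigcup_sup. Qed.

Let mM (S : set (R * V)) : measurable S -> measurable_fun setT (M ^~ S).
Proof. exact: measurable_kernel. Qed.

Lemma jump_rate n (a b : R) : (a <= b)%R ->
  fine (nu (B n) * @lebesgue_measure R `]a, b]) = (fine (nu (B n)) * (b - a))%R.
Proof.
move=> ab; rewrite lebesgue_measure_itv/= lte_fin.
have nuf : nu (B n) \is a fin_num by rewrite ge0_fin_numE.
have [_|ba] := ltP a b; first by rewrite fineM.
have -> : b = a by apply/eqP; rewrite eq_le ab andbT.
by rewrite mule0 subrr mulr0.
Qed.

Lemma jump_count_moment n (T : R) q : (0 <= T)%R ->
  \int[P]_w ((fine (M w (`]0%R, T] `*` B n))) ^+ q)%:E < +oo.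
Proof.
move=> T0.
have mS : measurable (`]0%R, T] `*` B n) by exact: measurableX.
have mN := measurable_interval_count N 0 T (mB n).
have law := interval_count_law hN T (lexx 0%R) (mB n) (@BE n) (nuB n).
have mg (k : Omega -> \bar R) : measurable_fun setT k ->
    measurable_fun setT (fun w => (fine (k w) ^+ q)%:E).
  move=> mk; apply/measurable_EFinP; apply: measurable_funX.
  exact: (measurableT_comp (@fine_measurable _ _ measurableT)).
rewrite (_ : \int[P]_w _ = \int[P]_w ((fine (N w (`]0%R, T] `*` B n))) ^+ q)%:E).
  rewrite (integral_poisson mN law (f := fun k => (k%:R ^+ q)%:E))//.
  - by rewrite probability_setT mul1e; apply: poisson_moment; apply: fine_ge0; exact: mule_ge0.
  - exact: mg.
  - by move=> w k ->.
  - by move=> k; rewrite setTI probability_setT mul1e.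
apply: ae_eq_integral => //; [exact/mg/mM|exact: mg|].
apply: (ae_of_null _ (finite_samples_full hN mB EB nuB)).
  by apply: measurableC; exact: measurable_finite_samples.
by move=> w /contrapT hw _; rewrite jump_rectE.
Qed.

(** The bound is quadratic in the length of the interval, so its sum over the cells of a grid tends
    to 0 with the mesh. *)
Lemma jump_count_tail n (a b : R) : (0 <= a)%R -> (a <= b)%R ->
  P [set w | 1 < M w (`]a, b] `*` B n)] <= ((fine (nu (B n)) * (b - a)) ^+ 2)%:E.
Proof.
move=> a0 ab.
have mS : measurable (`]a, b] `*` B n) by exact: measurableX.
have mN := measurable_interval_count N a b (mB n).
have law := interval_count_law hN b a0 (mB n) (@BE n) (nuB n).
have r0 : (0 <= fine (nu (B n) * @lebesgue_measure R `]a, b]))%R by apply: fine_ge0; exact: mule_ge0.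
rewrite -jump_rate//; apply: le_trans (poisson_tail r0).
rewrite -law.
set A := [set w | _]; set A' := [set w | _].
have mA : measurable A.
  by rewrite -[A]setTI; apply: emeasurable_fun_o_infty => //; exact: mM.
have A'U : A' = \bigcup_(k in [set k | (1 < k)%N]) (fun w => N w (`]a, b] `*` B n)) @^-1` [set k%:R%:E].
  by apply/seteqP; split => w [k k1 hk]; exists k.
have mA' : measurable A'.
  rewrite A'U; apply: bigcup_measurable => k _.
  by rewrite -[X in measurable X]setTI; exact: mN.
(* Off [Z] the count is that of [N] and is a natural number, so exceeding 1 is an event of the
   Poisson law. *)
set Z := ~` finite_samples N B `|`
  ~` \bigcup_k (fun w => N w (`]a, b] `*` B n)) @^-1` [set k%:R%:E].
have mZ1 : measurable (~` finite_samples N B).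
  by apply: measurableC; exact: measurable_finite_samples.
have mZ2 : measurable (~` \bigcup_k (fun w => N w (`]a, b] `*` B n)) @^-1` [set k%:R%:E]).
  apply: measurableC; apply: bigcup_measurable => k _.
  by rewrite -[X in measurable X]setTI; exact: mN.
have mZ : measurable Z by exact: measurableU.
have PZ0 : P Z = 0.
  exact: (measureU_eq0 mZ1 mZ2 (finite_samples_full hN mB EB nuB)
    (poisson_ae_nat mN law)).
rewrite (measure_eq_null mA mA' mZ PZ0)//.
apply/seteqP; split => w [hw Zw]; split => //.
- have [/contrapT g /contrapT [k _ hk]] : ~ (~ finite_samples N B w) /\
    ~ (~ (\bigcup_k (fun w => N w (`]a, b] `*` B n)) @^-1` [set k%:R%:E]) w).
    by split => ?; apply: Zw; [left|right].
  exists k => //=; move: hw; rewrite /A/= jump_rectE// hk/= lte_fin.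
  by rewrite ltr1n.
- have g : finite_samples N B w by apply: contrapT => ?; apply: Zw; left.
  case: hw => k k1 hk; rewrite /A/= jump_rectE// hk lte_fin ltr1n.
  exact: k1.
Qed.

Lemma predictable_rect n (s b : R) (A : set Omega) (C : set V) : (0 <= s)%R ->
  augmentation P F s A -> measurable C -> C `<=` B n ->
  measurable (A `*` (`]s, b] `*` C) : set PZ).
Proof.
move=> s0 hA mC CB; apply: sub_sigma_algebra; left.
by exists A, s, b, C, n.
Qed.

Lemma measurable_augmentation s (A : set Omega) : (0 <= s)%R ->
  measurable (A : set (Om s)) -> augmentation P F s A.
Proof.
by move=> s0; rewrite /measurable/= sigma_algebra_id//; exact: sigma_algebra_augmentation.
Qed.

Lemma sub_predictable_prod (A : set (Omega * (R * V))) :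
  measurable (A : set PZ) -> measurable A.
Proof.
apply: smallest_sub; first exact: sigma_algebra_measurable.
exact: sub_predictable_measurable.
Qed.

(** What a predictable set weighs up to time [s] is known at time [s]. The proof is a Dynkin class
    argument; intersecting with [S] keeps the masses finite, so that proper differences can be
    subtracted. *)
Lemma adapted_xsection n s (A : set (Omega * (R * V))) : (0 <= s)%R ->
  measurable (A : set PZ) ->
  measurable_fun [set: Om s] (fun w => M w (xsection A w `&` (`]0%R, s] `*` B n))).
Proof.
move=> s0; set S := `]0%R, s] `*` B n.
have mS : measurable S by exact: measurableX.
have Sfin w : M w S < +oo by exact: (jump_rect_finite N mE mB ndB EB w s (mB n) (@subset_refl _ _)).
pose H := [set A : set (Omega * (R * V)) | measurable A /\
  measurable_fun [set: Om s] (fun w => M w (xsection A w `&` S))].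
suff : <<s predictable_class P F E B >> `<=` H by move=> h /h[].
apply: lambda_system_subset => //; first exact: setI_closed_predictable.
  split => //.
  - split => //; rewrite (_ : (fun w => _) = (fun w => M w S)); last first.
      by apply/funext => w; rewrite -setXTT in_xsectionX ?setTI// inE.
    exact: (measurable_jump_rect hF hN mE mB ndB EB nuB (lexx 0%R) s0 (lexx s) (mB n) (@subset_refl _ _)).
  - move=> A1 A2 A21 [mA1 h1] [mA2 h2]; split; first exact: measurableD.
    rewrite (_ : (fun w => _) = (fun w => M w (xsection A1 w `&` S) - M w (xsection A2 w `&` S))).
      exact: emeasurable_funB.
    apply/funext => w; have m1 := measurable_xsection w mA1; have m2 := measurable_xsection w mA2.
    have -> : xsection (A1 `\` A2) w `&` S = (xsection A1 w `&` S) `\` (xsection A2 w `&` S).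
      rewrite xsectionD; apply/seteqP; split => z [[h3 h4] h5].
        by split => // -[/h4].
      by split => //; split => // ?; apply: h5.
    have X21 : xsection A2 w `&` S `<=` xsection A1 w `&` S.
      by apply: setSI; exact: le_xsection.
    have X1 : measurable (xsection A1 w `&` S) by exact: measurableI.
    have X2 : measurable (xsection A2 w `&` S) by exact: measurableI.
    rewrite measureD// ?(setIidr X21)//.
    by apply: le_lt_trans (Sfin w); apply: le_measure; rewrite ?inE//; exact: subIsetr.
  - move=> G ndG hG; split; first by apply: bigcupT_measurable => k; have [] := hG k.
    apply: (emeasurable_fun_cvg (fun k (w : Om s) => M w (xsection (G k) w `&` S))).
      by move=> k; have [] := hG k.
    move=> w _; rewrite xsection_bigcup setI_bigcupl.
    have mG k : measurable (xsection (G k) w `&` S).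
      by apply: measurableI => //; apply: measurable_xsection; have [] := hG k.
    apply: nondecreasing_cvg_mu => //; first exact: bigcupT_measurable.
    move=> i j ij; apply/subsetPset; apply: setSI; apply: le_xsection.
    exact/subsetPset/ndG.
move=> _ [[A0 [a [b [C [k [a0 hA mC CB ->]]]]]]|->]; last first.
  split.
    apply: measurableC; apply: measurableX => //; exact: measurable_jump_domain.
  rewrite (_ : (fun w => _) = cst 0); first exact: measurable_cst.
  apply/funext => w; rewrite (_ : _ `&` _ = set0) ?measure0//.
  apply/seteqP; split => // -[t v] [] /=.
  rewrite /xsection/= => /set_mem h [/=]; rewrite in_itv/= => /andP[t0 ts] Bv.
  by apply: h; split => //; split => /=; [rewrite in_itv/= t0|exact: BE Bv].
split.
  by apply: measurableX; [exact: (augmentation_measurable hA)|exact: measurableX].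
have [as_|sa] := leP a s; last first.
  rewrite (_ : (fun w => _) = cst 0); first exact: measurable_cst.
  apply/funext => w; rewrite (_ : _ `&` _ = set0) ?measure0//.
  apply/seteqP; split => // -[t v] [] /=.
  rewrite /xsection/= => /set_mem/= [_ [/=]]; rewrite !in_itv/= => /andP[at_ _] _ [/= ]; rewrite in_itv/= => /andP[_ ts] _.
  by move: (lt_le_trans at_ ts); rewrite ltNge (ltW sa).
rewrite (_ : (fun w => _) = (fun w => if w \in A0 then M w (`]a, Num.min b s] `*` (C `&` B n)) else 0)).
  apply: measurable_fun_ifT => //.
    apply: (@measurable_fun_bool _ _ _ _ true); rewrite setTI.
    rewrite (_ : _ @^-1` _ = A0); last by apply/seteqP; split => w /= => [/set_mem|/mem_set].
    by apply: sub_sigma_algebra; exact: (augmentation_le hF a0 as_).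
  apply: (measurable_jump_rect hF hN mE mB ndB EB nuB (n := n)) => //.
  - by rewrite ge_min lexx orbT.
  - exact: measurableI.
apply/funext => w; case: ifPn => [wA|wA]; last first.
  by rewrite notin_xsectionX// set0I measure0.
rewrite in_xsectionX//; congr (M w _); apply/seteqP; split => -[t v] /=; rewrite !in_itv/= le_min.
  by move=> [[/andP[-> ->] ?] [/=]]; rewrite in_itv/= => /andP[_ ->].
move=> [/andP[at_ /andP[-> ts]] [? ?]]; rewrite at_; split => //; split => //=.
by rewrite in_itv/= ts (le_lt_trans a0 at_).
Qed.

Import HBNNSimple.

(** With this, an integral over the past is an admissible factor in front of a predictable integrand
    living after time [s]. *)
Lemma adapted_integral n s (f : Omega * (R * V) -> \bar R) : (0 <= s)%R ->
  (forall z, 0 <= f z) -> measurable_fun [set: PZ] f ->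
  measurable_fun [set: Om s]
    (fun w => \int[M w]_(z in `]0%R, s] `*` B n) f (w, z)).
Proof.
move=> s0 f0 mf; set S := `]0%R, s] `*` B n.
have mS : measurable S by exact: measurableX.
pose f_ := nnsfun_approx (@measurableT _ PZ) mf.
have ndf : nondecreasing_seq (f_ : (PZ -> R)^nat).
  by move=> a b ab; exact/nd_nnsfun_approx.
have cf z : (f_ k z)%:E @[k --> \oo] --> f z by exact/cvg_nnsfun_approx.
have mE_ r k : measurable (f_ k @^-1` [set r] : set PZ) by [].
have mE2 r k := sub_predictable_prod (mE_ r k).
have mEx r k w := measurable_xsection w (mE2 r k).
have Esec r k w : (fun z => \1_(f_ k @^-1` [set r]) (w, z)) =
    \1_(xsection (f_ k @^-1` [set r]) w) :> (R * V -> R).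
  by apply/funext => y; rewrite !indicE mem_xsection.
have mfx k w : measurable_fun S (fun z => (f_ k (w, z))%:E).
  apply: measurable_funTS; apply/measurable_EFinP.
  have h : measurable_fun setT (f_ k : Omega * (R * V) -> R).
    by apply: (@predictable_measurable_fun _ _ _ _ P F E B mE).
  by apply: (measurableT_comp h); exact: measurable_pair1.
apply: (emeasurable_fun_cvg (fun k (w : Om s) => \int[M w]_(z in S) (f_ k (w, z))%:E)); last first.
  move=> w _; rewrite (_ : \int[M w]_(z in S) f (w, z) =
      \int[M w]_(z in S) limn (fun k => (f_ k (w, z))%:E)); last first.
    by apply: eq_integral => z _; apply/esym/cvg_lim => //; exact: cf.
  apply: cvg_monotone_convergence => //.
  - by move=> k z _; rewrite lee_fin.
  - by move=> z _ i j ij; rewrite lee_fin; exact/lefP/ndf.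
move=> k.
rewrite (_ : (fun w => _) = (fun w => \sum_(r \in range (f_ k))
   r%:E * M w (xsection (f_ k @^-1` [set r]) w `&` S))).
  apply: emeasurable_fsum => // r; apply: measurable_funeM.
  exact: adapted_xsection.
apply/funext => w.
transitivity (\int[M w]_(z in S) (\sum_(r \in range (f_ k))
    (r%:E * (\1_(xsection (f_ k @^-1` [set r]) w) z)%:E))).
  apply: eq_integral => z _; rewrite fimfunE -fsumEFin//.
  by apply: eq_fsbigr => r _; rewrite EFinM -Esec.
rewrite ge0_integral_fsum//; last 2 first.
- move=> r; apply: measurable_funeM; apply/measurable_EFinP.
  by apply: measurable_funTS; exact: measurable_indic.
- move=> r z _; rewrite -Esec -EFinM; exact: nnfun_muleindic_ge0.
apply: eq_fsbigr => r _.
have [r0|r0] := leP 0%R r.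
  rewrite ge0_integralZl//; last first.
    by apply/measurable_EFinP/measurable_funTS; exact: measurable_indic.
  rewrite integral_indic//.
rewrite integral0_eq => [|z _]; rewrite preimage_nnfun0// xsection0 ?set0I ?measure0 ?indic0 ?mule0//.
Qed.

End moments.

Section interval_additivity.
Local Open Scope ereal_scope.
Context {R : realType} dV (V : measurableType dV).
Variables (mu : {measure set (R * V) -> \bar R}) (C : set V) (mC : measurable C).

Lemma integral_interval_split (g : R * V -> \bar R) (a b : R) :
  (forall z, 0 <= g z) -> measurable_fun setT g -> (0 <= a)%R -> (a <= b)%R ->
  \int[mu]_(z in `]0%R, b] `*` C) g z =
  \int[mu]_(z in `]0%R, a] `*` C) g z + \int[mu]_(z in `]a, b] `*` C) g z.
Proof.
move=> g0 mg a0 ab.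
have -> : `]0%R, b] `*` C = (`]0%R, a] `*` C) `|` (`]a, b] `*` C).
  apply/seteqP; split => [[t v]|[t v] [|]] [/=]; rewrite !in_itv/= => /andP[t1 t2] Cv.
  - have [ta|ta] := leP t a; [left|right]; split => //=; rewrite ?t1 ?ta//.
  - by split => //=; rewrite t1 (le_trans t2).
  - by split => //=; rewrite t2 andbT (le_lt_trans a0).
rewrite ge0_integral_setU//.
- exact: measurableX.
- exact: measurableX.
- exact: measurable_funTS.
- apply/disj_setPS => -[t v] [[/=]]; rewrite !in_itv/= => /andP[_ ta] _ [/=].
  by rewrite ltNge ta.
Qed.

End interval_additivity.

Lemma powR_le {R : realType} (r a b : R) : 0 <= r -> 0 <= a -> a <= b ->
  a `^ r <= b `^ r.
Proof.
move=> r0 a0 ab; apply: ge0_ler_powR; rewrite ?nnegrE//; exact: le_trans ab.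
Qed.

Lemma powR_le_mul {R : realType} (p a b : R) : 1 <= p -> 0 <= a -> a <= b ->
  a `^ p <= a * b `^ (p - 1).
Proof.
move=> p1 a0 ab; rewrite -(mulr_powRB1 a0 (lt_le_trans ltr01 p1)).
rewrite ler_wpM2l// ge0_ler_powR ?subr_ge0 ?nnegrE//.
exact: le_trans ab.
Qed.

Lemma ge0_integralZlT {R : realType} {dT} {T : measurableType dT}
    (mu : {measure set T -> \bar R}) (f : T -> R) (k : R) :
  (0 <= k)%R -> (forall x, (0 <= f x)%R) -> measurable_fun setT f ->
  (\int[mu]_x (k * f x)%:E = k%:E * \int[mu]_x (f x)%:E)%E.
Proof.
move=> k0 f0 mf; under eq_integral do rewrite EFinM.
rewrite ge0_integralZl ?lee_fin//; first exact/measurable_EFinP.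
by move=> x _; rewrite lee_fin.
Qed.

Lemma ge0_integralDT {R : realType} {dT} {T : measurableType dT}
    (mu : {measure set T -> \bar R}) (f g : T -> R) :
  (forall x, (0 <= f x)%R) -> measurable_fun setT f ->
  (forall x, (0 <= g x)%R) -> measurable_fun setT g ->
  (\int[mu]_x (f x + g x)%:E = \int[mu]_x (f x)%:E + \int[mu]_x (g x)%:E)%E.
Proof.
move=> f0 mf g0 mg; under eq_integral do rewrite EFinD.
rewrite ge0_integralD//; [|exact/measurable_EFinP| |exact/measurable_EFinP];
  by move=> x _; rewrite lee_fin.
Qed.

Lemma integral_powR_absorb {R : realType} {dT} {T : measurableType dT}
    (mu : {measure set T -> \bar R}) (X A : T -> R) (p k : R) :
  1 <= p -> 0 <= k -> (forall x, 0 <= X x) -> (forall x, 0 <= A x) ->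
  measurable_fun setT X -> measurable_fun setT A ->
  (k%:E * \int[mu]_x (X x `^ (p - 1) * A x)%:E <=
   (2^-1)%:E * \int[mu]_x (X x `^ p)%:E +
   (k * (2 * k) `^ (p - 1))%:E * \int[mu]_x (A x `^ p)%:E)%E.
Proof.
move=> p1 k0 X0 A0 mX mA.
have mpow (f : T -> R) (r : R) : measurable_fun setT f ->
    measurable_fun setT (fun x => f x `^ r).
  by move=> mf; exact: (measurableT_comp (measurable_powR _)).
have C0 : 0 <= k * (2 * k) `^ (p - 1) by rewrite mulr_ge0 ?powR_ge0.
have i2 : 0 <= 2^-1 :> R by rewrite invr_ge0.
have XA0 x : 0 <= X x `^ (p - 1) * A x by rewrite mulr_ge0 ?powR_ge0.
have mXA : measurable_fun setT (fun x => X x `^ (p - 1) * A x).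
  by apply: measurable_funM => //; exact: mpow.
rewrite -(ge0_integralZlT mu k0 XA0 mXA).
rewrite -(ge0_integralZlT mu i2 (fun x => powR_ge0 (X x) p) (mpow _ p mX)).
rewrite -(ge0_integralZlT mu C0 (fun x => powR_ge0 (A x) p) (mpow _ p mA)).
have mX2 : measurable_fun setT (fun x => 2^-1 * X x `^ p).
  by apply: measurable_funM => //; exact: mpow.
have mA2 : measurable_fun setT (fun x => k * (2 * k) `^ (p - 1) * A x `^ p).
  by apply: measurable_funM => //; exact: mpow.
rewrite -(ge0_integralDT mu _ mX2 _ mA2); first last.
- by move=> x; rewrite mulr_ge0 ?powR_ge0.
- by move=> x; rewrite mulr_ge0 ?powR_ge0.
apply: ge0_le_integral => //.
- by move=> x _; rewrite lee_fin mulr_ge0.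
- by apply/measurable_EFinP/measurable_funM.
- by apply/measurable_EFinP/measurable_funD.
- by move=> x _; rewrite lee_fin [2^-1 * _]mulrC; exact: powR_absorb.
Qed.

(** * Moment bound for bounded integrands and finitely many jumps *)

Section moment_bound.
Local Open Scope ereal_scope.
Context {R : realType} {d : nat} {dO : measure_display} {Omega : measurableType dO}.
Variables (P : probability Omega R) (F : R -> set (set Omega)).
Hypothesis hF : right_continuous_filtration F.
Local Notation V := 'rV[R]_d.
Variables (E : set V) (nu : {measure set V -> \bar R}).
Variable N : R.-ker Omega ~> (R * V)%type.
Hypothesis hN : poisson_random_measure P E nu F N.
Variable B : (set V)^nat.
Hypotheses (mE : measurable E) (mB : forall n, measurable (B n)).
Hypotheses (ndB : nondecreasing_seq B) (EB : E = \bigcup_n B n).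
Hypothesis nuB : forall n, nu (B n) < +oo.

Local Notation M := (jump_measure N B mE).
Local Notation Q := (intensity mE mB EB nuB).
Local Notation PZ := (g_sigma_algebraType (predictable_class P F E B)).
Local Notation Om t := (g_sigma_algebraType (augmentation P F t)).

Let BE n : B n `<=` E. Proof. by rewrite EB; exact: bigcup_sup. Qed.

Let mM (S : set (R * V)) : measurable S -> measurable_fun setT (M ^~ S).
Proof. exact: measurable_kernel. Qed.

(** For [g] known at time [s], the preimages of [g] on the strip []s, b]] are predictable
    rectangles. *)
Lemma predictable_mul n (s b : R) (g : Omega -> R) (f : Omega * (R * V) -> R) :
  (0 <= s)%R -> measurable_fun [set: Om s] g -> measurable_fun [set: PZ] f ->
  measurable_fun [set: PZ]
    (fun z => ((g z.1 * f z)%:E * (\1_(`]s, b] `*` B n) z.2)%:E)).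
Proof.
move=> s0 mg mf.
pose D := setT `*` (`]s, b] `*` B n) : set (Omega * (R * V)).
have mD : measurable (D : set PZ).
  apply: (predictable_rect _ s0 _ (mB n) (@subset_refl _ _)).
  by apply: (measurable_augmentation hF s0); exact: measurableT.
have mgD : measurable_fun (D : set PZ) (fun z : PZ => g z.1).
  move=> _ Y mY; rewrite (_ : _ `&` _ = (g @^-1` Y) `*` (`]s, b] `*` B n)).
    apply: (predictable_rect _ s0 _ (mB n) (@subset_refl _ _)).
    apply: (measurable_augmentation hF s0).
    by have := mg measurableT Y mY; rewrite setTI.
  by apply/seteqP; split => -[w z] /=; [move=> [[_ ?] ?]|move=> [? ?]].
have -> : (fun z : PZ => ((g z.1 * f z)%:E * (\1_(`]s, b] `*` B n) z.2)%:E)) =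
   (fun z => (g z.1 * f z)%:E) \_ (D : set PZ).
  apply/funext => -[w z]; rewrite patchE indicE/=; case: ifPn => hz.
    by rewrite mem_set ?mule1//; move/set_mem : hz => [].
  by rewrite memNset ?mule0// => hz2; move/negP : hz; apply; rewrite inE; split.
apply/(measurable_restrictT _ mD); apply/measurable_EFinP; apply: measurable_funM => //.
exact: measurable_funTS.
Qed.

Lemma measurable_jump_integral (f : Omega * (R * V) -> \bar R) :
  (forall z, 0 <= f z) -> measurable_fun setT f ->
  measurable_fun setT (fun w => \int[M w]_z f (w, z)).
Proof.
move=> f0 mf; apply: (measurable_kernel_integral _ _
  (jump_measure_piece N mE ndB EB) (jump_measure_out N mE ndB EB)) => //.
- by move=> n; exact: measurable_jump_piece.
- exact: nondecreasing_jump_piece.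
Qed.

Section bounded.
Variables (n : nat) (T : R) (f : Omega * (R * V) -> R) (K p : R).
Hypotheses (T0 : (0 < T)%R) (f0 : forall z, (0 <= f z)%R) (fK : forall z, (f z <= K)%R).
Hypotheses (mf : measurable_fun [set: PZ] f) (p1 : (1 <= p)%R).

Local Notation S := (`]0%R, T] `*` B n).

Let mf' : measurable_fun setT f := predictable_measurable_fun mE mf.

Let mfw w : measurable_fun setT (fun z => f (w, z)).
Proof. by apply: (measurableT_comp mf'); exact: measurable_pair1. Qed.

Let mS (a b : R) : measurable (`]a, b] `*` B n).
Proof. exact: measurableX. Qed.

Let p0 : (0 < p)%R. Proof. exact: lt_le_trans p1. Qed.

Let I (mu : {measure set (R * V) -> \bar R}) w (a b : R) : R :=
  fine (\int[mu]_(z in `]a, b] `*` B n) (f (w, z))%:E).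

Let finI (mu : {measure set (R * V) -> \bar R}) w (a b : R) :
  mu S < +oo -> (0 <= a)%R -> (b <= T)%R ->
  \int[mu]_(z in `]a, b] `*` B n) (f (w, z))%:E = (I mu w a b)%:E.
Proof.
move=> muS a0 bT; rewrite fineK// ge0_fin_numE; last first.
  by apply: integral_ge0 => z _; rewrite lee_fin.
apply: (@le_lt_trans _ _ (\int[mu]_(z in `]a, b] `*` B n) (cst K%:E z))).
  apply: ge0_le_integral => //.
  - by move=> z _; rewrite lee_fin.
  - by apply/measurable_EFinP/measurable_funTS.
  - by move=> z _; rewrite lee_fin.
rewrite integral_cst//= lte_mul_pinfty//.
  by rewrite lee_fin (le_trans (f0 point)).
apply: le_lt_trans muS; apply: le_measure; rewrite ?inE//.
move=> [t v] [/=]; rewrite !in_itv/= => /andP[at_ tb] Cv; split => //=.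
by rewrite (le_trans tb)// (le_lt_trans a0).
Qed.

Let I_ge0 mu w a b : (0 <= I mu w a b)%R.
Proof. by apply: fine_ge0; apply: integral_ge0 => z _; rewrite lee_fin. Qed.

Let I_split (mu : {measure set (R * V) -> \bar R}) w (a b : R) :
  mu S < +oo -> (0 <= a)%R -> (a <= b)%R -> (b <= T)%R ->
  I mu w 0 b = (I mu w 0 a + I mu w a b)%R.
Proof.
move=> muS a0 ab bT; apply: EFin_inj; rewrite EFinD.
rewrite -!finI// ?(le_trans ab)//; apply: integral_interval_split => //.
- by move=> z; rewrite lee_fin.
- exact/measurable_EFinP.
Qed.

Let MS w : M w S < +oo.
Proof. exact: (jump_rect_finite N mE mB ndB EB w T (mB n) (@subset_refl _ _)). Qed.

Let QS : Q S < +oo.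
Proof.
rewrite intensity_rect//= lebesgue_measure_itv/= lte_fin T0 -EFinD.
by rewrite lte_mul_pinfty// lee_fin subr0 ltW.
Qed.

Let X w := I (M w) w 0 T.
Let A w := I Q w 0 T.

Let X_le w : (X w <= K * fine (M w S))%R.
Proof.
rewrite -lee_fin /X -finI// EFinM fineK ?ge0_fin_numE//.
rewrite -integral_cst//; apply: ge0_le_integral => //.
- by move=> z _; rewrite lee_fin.
- by apply/measurable_EFinP/measurable_funTS.
- by move=> z _; rewrite lee_fin.
Qed.

Let K0 : (0 <= K)%R. Proof. exact: le_trans (f0 point) (fK _). Qed.

Let mfpw w : measurable_fun setT (fun z => (f (w, z) `^ p)%R).
Proof. exact: (measurableT_comp (measurable_powR _)). Qed.

Let mI (a b : R) : measurable_fun setT (fun w => I (M w) w a b).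
Proof.
apply: (measurableT_comp (@fine_measurable _ _ measurableT)).
under eq_fun do rewrite integral_mkcond.
have mD : measurable (setT `*` (`]a, b] `*` B n) : set (Omega * (R * V))).
  by apply: measurableX.
rewrite (_ : (fun w => _) = (fun w => \int[M w]_z
    ((EFin \o f) \_ (setT `*` (`]a, b] `*` B n))) (w, z))).
  apply: measurable_jump_integral.
  - by move=> z; apply: erestrict_ge0 => x _; rewrite lee_fin.
  - by apply/(measurable_restrictT _ mD); apply/measurable_EFinP/measurable_funTS.
apply/funext => w; apply: eq_integral => z _; rewrite !patchE.
congr (if _ then _ else _).
by apply/idP/idP => [/set_mem zS|/set_mem [_ zS]]; exact: mem_set.
Qed.

Let mIQ (a b : R) : measurable_fun setT (fun w => I Q w a b).
Proof.
apply: (measurableT_comp (@fine_measurable _ _ measurableT)).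
under eq_fun do rewrite integral_mkcond.
have mD : measurable (setT `*` (`]a, b] `*` B n) : set (Omega * (R * V))).
  by apply: measurableX.
rewrite (_ : (fun w => _) = fubini_F Q
    ((EFin \o f) \_ (setT `*` (`]a, b] `*` B n)))).
  apply: measurable_fun_fubini_tonelli_F.
  - by apply/(measurable_restrictT _ mD); apply/measurable_EFinP/measurable_funTS.
  - by move=> z; apply: erestrict_ge0 => x _; rewrite lee_fin.
apply/funext => w; apply: eq_integral => z _; rewrite !patchE.
congr (if _ then _ else _).
by apply/idP/idP => [/set_mem zS|/set_mem [_ zS]]; exact: mem_set.
Qed.

Section grid.
Variable m : nat.

Let h := (T / m.+1%:R)%R.
Let t_ (i : nat) : R := (i%:R * h)%R.

Let h0 : (0 < h)%R. Proof. by rewrite divr_gt0. Qed.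

Let t_ge0 i : (0 <= t_ i)%R. Proof. by rewrite mulr_ge0// ltW. Qed.

Let t_le i j : (i <= j)%N -> (t_ i <= t_ j)%R.
Proof. by move=> ij; rewrite ler_pM2r// ler_nat. Qed.

Let t_last : t_ m.+1 = T. Proof. by rewrite /t_ /h mulrCA divff ?mulr1. Qed.

Let t_T i : (i <= m.+1)%N -> (t_ i <= T)%R.
Proof. by move=> im; rewrite -t_last t_le. Qed.

Let t_0 : t_ 0 = 0%R. Proof. by rewrite /t_ mul0r. Qed.

Let I0 (mu : {measure set (R * V) -> \bar R}) w : I mu w 0 0 = 0%R.
Proof. by rewrite /I set_itv_ge ?bnd_simp ?ltxx// set0X integral_set0. Qed.

Let I_sum (mu : {measure set (R * V) -> \bar R}) w k : mu S < +oo -> (k <= m.+1)%N ->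
  I mu w 0 (t_ k) = (\sum_(i < k) I mu w (t_ i) (t_ i.+1))%R.
Proof.
move=> muS; elim: k => [|k ih] km; first by rewrite big_ord0 t_0 I0.
by rewrite (I_split _ muS (t_ge0 k) (t_le (leqnSn k)) (t_T km)) big_ord_recr/= ih// ltnW.
Qed.

Let kappa : R := (p * 2 `^ (p - 1))%R.

Let kappa0 : (0 <= kappa)%R.
Proof. by rewrite mulr_ge0 ?powR_ge0// ltW. Qed.

(** Telescoping [powRD_le], with the integral up to [t_ i] as [a] and the increment over the next
    cell as [b]. *)
Let pathwise w k : (k <= m.+1)%N -> (I (M w) w 0 (t_ k) `^ p <= kappa *
  \sum_(i < k) (I (M w) w 0 (t_ i) `^ (p - 1) * I (M w) w (t_ i) (t_ i.+1) +
    I (M w) w (t_ i) (t_ i.+1) `^ p))%R.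
Proof.
elim: k => [|k ih] km; first by rewrite big_ord0 mulr0 t_0 I0 powR0// gt_eqF.
rewrite (I_split _ (MS w) (t_ge0 k) (t_le (leqnSn k)) (t_T km)).
apply: (le_trans (powRD_le p1 (I_ge0 _ _ _ _) (I_ge0 _ _ _ _))).
rewrite [X in (_ <= kappa * X)%R]big_ord_recr/= [X in (_ <= X)%R]mulrDr; apply: lerD => //.
by apply: ih; exact: ltnW.
Qed.

Let badi i := [set w | 1 < M w (`]t_ i, t_ i.+1] `*` B n)].

Let mbadi i : measurable (badi i).
Proof.
rewrite -[X in measurable X]setTI.
by apply: emeasurable_fun_o_infty => //; exact: mM.
Qed.

Let bad := \big[setU/set0]_(i < m.+1) badi i.

Let mbad : measurable bad.
Proof. exact: bigsetU_measurable. Qed.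

Let Pbad : P bad <= ((fine (nu (B n)) * T) ^+ 2 / m.+1%:R)%:E.
Proof.
apply: (@le_trans _ _ (\sum_(i < m.+1) P (badi i))).
  by apply: Boole_inequality => i _; exact: mbadi.
apply: (@le_trans _ _ (\sum_(i < m.+1) ((fine (nu (B n)) * h) ^+ 2)%:E)).
  apply: lee_sum => i _; apply: (le_trans (jump_count_tail hN mE mB EB nuB _ (t_ge0 _) (t_le (leqnSn i)))).
  by rewrite /t_ -mulrBl -natrB// subSnn mul1r.
rewrite sumEFin lee_fin sumr_const card_ord -mulr_natr /h.
have m0 : (m.+1%:R : R) != 0%R by [].
rewrite le_eqVlt; apply/orP; left; apply/eqP; field.
by rewrite addrC natr1.
Qed.

Let cells_sum (mu : {measure set (R * V) -> \bar R}) (g : R * V -> \bar R) k :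
  (forall z, 0 <= g z) -> measurable_fun setT g -> (k <= m.+1)%N ->
  \int[mu]_(z in `]0%R, t_ k] `*` B n) g z =
  \sum_(i < k) \int[mu]_(z in `]t_ i, t_ i.+1] `*` B n) g z.
Proof.
move=> g0 mg; elim: k => [|k ih] km.
  by rewrite big_ord0 t_0 set_itv_ge ?bnd_simp ?ltxx// set0X integral_set0.
rewrite (integral_interval_split mu (mB n) g0 mg (t_ge0 k) (t_le (leqnSn k))).
by rewrite big_ord_recr/= ih// ltnW.
Qed.

Let D_le w i : (i < m.+1)%N -> (I (M w) w (t_ i) (t_ i.+1) <= X w)%R.
Proof.
move=> im; rewrite /X -t_last I_sum// (bigD1 (Ordinal im))//= lerDl.
exact: sumr_ge0.
Qed.

Let fp_fin w : \int[M w]_(z in S) (f (w, z) `^ p)%:E < +oo.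
Proof.
apply: (@le_lt_trans _ _ (\int[M w]_(z in S) (cst (K `^ p)%:E z))).
  apply: ge0_le_integral => //.
  - by move=> z _; rewrite lee_fin powR_ge0.
  - by apply/measurable_EFinP/measurable_funTS.
  - move=> z _; rewrite lee_fin ge0_ler_powR ?nnegrE//; exact: ltW.
by rewrite integral_cst//= lte_mul_pinfty// lee_fin powR_ge0.
Qed.

(** If no cell has more than one jump, Jensen's inequality applies in each. On the bad event every
    increment is at most [X], so the sum is at most [X^p <= K^p Y^p], with [Y] the number of jumps.
    Either [Y <= L], which leaves [L^p] times the small probability of [bad], or
    [Y^p <= Y^(q+1) / L], which is small for large [L]. *)
Let squares w (L : R) q : (1 <= L)%R -> (p <= q%:R)%R ->
  (\sum_(i < m.+1) I (M w) w (t_ i) (t_ i.+1) `^ p <=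
   fine (\int[M w]_(z in S) (f (w, z) `^ p)%:E) +
   K `^ p * (L `^ p * \1_bad w + fine (M w S) ^+ q.+1 / L))%R.
Proof.
move=> L1 pq.
have L0 : (0 < L)%R by exact: lt_le_trans L1.
have Y0 : (0 <= fine (M w S))%R by exact: fine_ge0.
have h1 : (0 <= fine (\int[M w]_(z in S) (f (w, z) `^ p)%:E))%R.
  by apply: fine_ge0; apply: integral_ge0 => z _; rewrite lee_fin powR_ge0.
have h2 : (0 <= K `^ p * (L `^ p * \1_bad w + fine (M w S) ^+ q.+1 / L))%R.
  by rewrite mulr_ge0 ?powR_ge0// addr_ge0// ?mulr_ge0 ?powR_ge0// ?exprn_ge0// ?invr_ge0 ltW.
have [wbad|wgood] := pselect (bad w).
  apply: (@le_trans _ _ (K `^ p * (L `^ p * \1_bad w + fine (M w S) ^+ q.+1 / L))%R); last by rewrite lerDr.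
  rewrite indicE mem_set// mulr1.
  apply: (@le_trans _ _ (X w `^ p)%R).
    have X0 : (0 <= X w)%R by exact: I_ge0.
    rewrite -(mulr_powRB1 X0 p0) {1}/X -t_last I_sum// mulr_suml.
    apply: ler_sum => i _; exact: (powR_le_mul p1 (I_ge0 (M w) w (t_ i) (t_ i.+1)) (D_le w (ltn_ord i))).
  apply: (@le_trans _ _ ((K * fine (M w S)) `^ p)%R).
    apply: ge0_ler_powR; rewrite ?nnegrE ?(ltW p0) ?mulr_ge0//.
    exact: (I_ge0 (M w) w 0%R T).
  rewrite powRM// ler_wpM2l ?powR_ge0//.
  have [YL|LY] := leP (fine (M w S)) L.
    apply: (@le_trans _ _ (L `^ p)%R).
      by rewrite ge0_ler_powR ?nnegrE// ltW.
    by rewrite lerDl divr_ge0 ?exprn_ge0// ltW.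
  apply: (@le_trans _ _ (fine (M w S) ^+ q.+1 / L)%R); last by rewrite lerDr powR_ge0.
  rewrite ler_pdivlMr// (@le_trans _ _ (fine (M w S) ^+ q * L)%R)//.
    rewrite ler_wpM2r ?(ltW L0)// -powR_mulrn//; apply: ler_powR => //.
    by rewrite (le_trans L1) ?(ltW LY).
  by rewrite exprSr ler_wpM2l ?exprn_ge0// ltW.
apply: (@le_trans _ _ (fine (\int[M w]_(z in S) (f (w, z) `^ p)%:E))%R); last by rewrite lerDl.
rewrite -lee_fin fineK ?ge0_fin_numE//; last first.
  by apply: integral_ge0 => z _; rewrite lee_fin powR_ge0.
rewrite -[in leRHS]t_last cells_sum//; last 2 first.
- by move=> z; rewrite lee_fin powR_ge0.
- exact/measurable_EFinP.
rewrite -sumEFin; apply: lee_sum => i _.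
apply: jensen_powR_subprob => //.
- rewrite leNgt; apply/negP => hi; apply: wgood.
  by rewrite /bad -(@bigcup_mkord _ m.+1 badi); exists i => //=.
- exact: measurable_funTS.
- by rewrite finI ?ltry// t_T.
Qed.

Let mXi (s : R) : (0 <= s)%R -> measurable_fun [set: Om s] (fun w => I (M w) w 0 s).
Proof.
move=> s0; apply: (measurableT_comp (@fine_measurable _ _ measurableT)).
apply: (adapted_integral hF hN mE mB ndB EB nuB n s0 (f := EFin \o f)) => //.
exact/measurable_EFinP.
Qed.

Let integral_cell (mu : {measure set (R * V) -> \bar R}) w (g a b : R) :
  mu S < +oo -> (0 <= g)%R -> (0 <= a)%R -> (b <= T)%R ->
  \int[mu]_z ((g * f (w, z))%:E * (\1_(`]a, b] `*` B n) z)%:E) =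
  (g * I mu w a b)%:E.
Proof.
move=> muS g0 a0 bT; rewrite EFinM -finI//.
rewrite -ge0_integralZl//; last 2 first.
- by apply/measurable_EFinP/measurable_funTS.
- by move=> z _; rewrite lee_fin.
rewrite [RHS]integral_mkcond; apply: eq_integral => z _.
rewrite patchE indicE; case: ifPn => _; first by rewrite mule1 EFinM.
by rewrite mule0.
Qed.

(** The first factor depends on the past of the cell only. The product with [f] on the cell is
    therefore predictable, and the compensation formula replaces [M] by [Q]. *)
Let cross i : (i < m.+1)%N ->
  \int[P]_w (I (M w) w 0 (t_ i) `^ (p - 1) * I (M w) w (t_ i) (t_ i.+1))%:E =
  \int[P]_w (I (M w) w 0 (t_ i) `^ (p - 1) * I Q w (t_ i) (t_ i.+1))%:E.
Proof.
move=> im.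
have mg : measurable_fun [set: Om (t_ i)] (fun w => I (M w) w 0 (t_ i) `^ (p - 1))%R.
  by apply: (measurableT_comp (measurable_powR _)); exact: mXi.
pose phi (z : Omega * (R * V)) := (I (M z.1) z.1 0 (t_ i) `^ (p - 1) * f z)%:E *
    (\1_(`]t_ i, t_ i.+1] `*` B n) z.2)%:E.
have phi0 z : 0 <= phi z by rewrite mule_ge0// lee_fin mulr_ge0 ?powR_ge0.
have comp := compensation hF hN mE mB ndB EB nuB phi0
  (predictable_mul n (t_ i.+1) (t_ge0 i) mg mf).
transitivity (\int[P]_w \int[M w]_z phi (w, z)).
  apply: eq_integral => w _; apply: esym.
  have c0 := powR_ge0 (I (M w) w 0 (t_ i)) (p - 1).
  exact: (@integral_cell (M w) w _ _ _ (MS w) c0 (t_ge0 i) (t_T im)).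
rewrite comp; apply: eq_integral => w _.
have c0 := powR_ge0 (I (M w) w 0 (t_ i)) (p - 1).
exact: (@integral_cell Q w _ _ _ QS c0 (t_ge0 i) (t_T im)).
Qed.

Let fpM w := fine (\int[M w]_(z in S) (f (w, z) `^ p)%:E).

Let mpow (u : Omega -> R) (r : R) : measurable_fun setT u ->
  measurable_fun setT (fun w => u w `^ r)%R.
Proof. by move=> mu; exact: (measurableT_comp (measurable_powR _)). Qed.

Let c i w := (I (M w) w 0 (t_ i) `^ (p - 1) * I (M w) w (t_ i) (t_ i.+1))%R.
Let s i w := (I (M w) w (t_ i) (t_ i.+1) `^ p)%R.
Let cQ i w := (I (M w) w 0 (t_ i) `^ (p - 1) * I Q w (t_ i) (t_ i.+1))%R.

Let c0 i w : (0 <= c i w)%R.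
Proof. by apply: mulr_ge0; [exact: powR_ge0|exact: I_ge0]. Qed.
Let cQ0 i w : (0 <= cQ i w)%R.
Proof. by apply: mulr_ge0; [exact: powR_ge0|exact: I_ge0]. Qed.
Let s0 i w : (0 <= s i w)%R. Proof. exact: powR_ge0. Qed.
Let mc i : measurable_fun setT (c i).
Proof. by apply: measurable_funM; [exact/mpow/mI|exact: mI]. Qed.
Let mcQ i : measurable_fun setT (cQ i).
Proof. by apply: measurable_funM; [exact/mpow/mI|exact: mIQ]. Qed.
Let ms i : measurable_fun setT (s i). Proof. exact/mpow/mI. Qed.

(** After compensation each past integral is at most [X], and the [Q]-increments add up to [A]. *)
Let cross_sum : \int[P]_w (\sum_(i < m.+1) (c i w)%:E) <=
  \int[P]_w (X w `^ (p - 1) * A w)%:E.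
Proof.
rewrite ge0_integral_sum//; last 2 first.
- by move=> i; exact/measurable_EFinP.
- by move=> i w _; rewrite lee_fin c0.
rewrite (eq_bigr (fun i : 'I_m.+1 => \int[P]_w (cQ i w)%:E)); last first.
  by move=> i _; exact: cross.
rewrite -ge0_integral_sum//; last 2 first.
- by move=> i; exact/measurable_EFinP.
- by move=> i w _; rewrite lee_fin cQ0.
apply: ge0_le_integral => //.
- by move=> w _; apply: sume_ge0 => i _; rewrite lee_fin cQ0.
- by apply: emeasurable_sum => i; exact/measurable_EFinP.
- by apply/measurable_EFinP; apply: measurable_funM; [exact/mpow/mI|exact: mIQ].
move=> w _; rewrite sumEFin lee_fin /A -t_last (I_sum w QS (leqnn _)) mulr_sumr.
apply: ler_sum => i _; apply: ler_wpM2r; first exact: I_ge0.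
apply: powR_le; [by rewrite subr_ge0|exact: (I_ge0 (M w) w 0%R (t_ i))|].
rewrite /X -t_last; have im : (i <= m.+1)%N by exact: ltnW.
rewrite (@I_split (M w) w (t_ i) (t_ m.+1) (MS w) (t_ge0 i) (t_le im) (t_T (leqnn _))).
by rewrite lerDl; exact: I_ge0.
Qed.

Let mY q : measurable_fun setT (fun w => fine (M w S) ^+ q)%R.
Proof.
apply: measurable_funX; apply: (measurableT_comp (@fine_measurable _ _ measurableT)).
exact: mM.
Qed.

Let mfpM : measurable_fun setT (fun w => fine (\int[M w]_(z in S) (f (w, z) `^ p)%:E)).
Proof.
apply: (measurableT_comp (@fine_measurable _ _ measurableT)).
under eq_fun do rewrite integral_mkcond.
have mD : measurable (setT `*` S : set (Omega * (R * V))) by exact: measurableX.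
have mfp' : measurable_fun setT (fun z => f z `^ p)%R.
  exact: (measurableT_comp (measurable_powR _)).
rewrite (_ : (fun w => _) = (fun w => \int[M w]_z
    ((fun z => (f z `^ p)%:E) \_ (setT `*` S)) (w, z))).
  apply: measurable_jump_integral.
  - by move=> z; apply: erestrict_ge0 => x _; rewrite lee_fin powR_ge0.
  - by apply/(measurable_restrictT _ mD); apply/measurable_EFinP/measurable_funTS.
apply/funext => w; apply: eq_integral => z _; rewrite !patchE.
congr (if _ then _ else _).
by apply/idP/idP => [/set_mem zS|/set_mem [_ zS]]; exact: mem_set.
Qed.

Lemma grid_bound (L : R) q : (1 <= L)%R -> (p <= q%:R)%R ->
  \int[P]_w (X w `^ p)%:E <=
  kappa%:E * (\int[P]_w (X w `^ (p - 1) * A w)%:E +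
   (\int[P]_w \int[M w]_(z in S) (f (w, z) `^ p)%:E +
   (K `^ p)%:E * ((L `^ p * ((fine (nu (B n)) * T) ^+ 2 / m.+1%:R))%:E +
     (L^-1)%:E * \int[P]_w (fine (M w S) ^+ q.+1)%:E))).
Proof.
move=> L1 pq; have L0 : (0 < L)%R by exact: lt_le_trans L1.
have Y0 w : (0 <= fine (M w S))%R by exact: fine_ge0.
have fpM0 w : (0 <= fine (\int[M w]_(z in S) (f (w, z) `^ p)%:E))%R.
  by apply: fine_ge0; apply: integral_ge0 => z _; rewrite lee_fin powR_ge0.
apply: (@le_trans _ _ (\int[P]_w (kappa%:E * (\sum_(i < m.+1) (c i w)%:E + \sum_(i < m.+1) (s i w)%:E)))).
  apply: ge0_le_integral => //.
  - by move=> w _; rewrite lee_fin powR_ge0.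
  - by apply/measurable_EFinP; apply/mpow/mI.
  - apply: measurable_funeM; apply: emeasurable_funD; apply: emeasurable_sum => i;
      exact/measurable_EFinP.
  - move=> w _; rewrite !sumEFin -EFinD -EFinM lee_fin -big_split/=.
    by rewrite /X -t_last; exact: pathwise.
have sc0 w : 0 <= \sum_(i < m.+1) (c i w)%:E by apply: sume_ge0 => i _; rewrite lee_fin c0.
have ss0 w : 0 <= \sum_(i < m.+1) (s i w)%:E by apply: sume_ge0 => i _; rewrite lee_fin s0.
have msc : measurable_fun setT (fun w => \sum_(i < m.+1) (c i w)%:E).
  by apply: emeasurable_sum => i; exact/measurable_EFinP.
have mss : measurable_fun setT (fun w => \sum_(i < m.+1) (s i w)%:E).
  by apply: emeasurable_sum => i; exact/measurable_EFinP.
rewrite ge0_integralZl//; last 2 first.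
- exact: emeasurable_funD.
- by move=> w _; rewrite adde_ge0.
rewrite ge0_integralD//; apply: lee_wpmul2l => //.
apply: leeD; first exact: cross_sum.
apply: (@le_trans _ _ (\int[P]_w ((fine (\int[M w]_(z in S) (f (w, z) `^ p)%:E))%:E +
   (K `^ p)%:E * ((L `^ p)%:E * (\1_bad w)%:E + (L^-1)%:E * (fine (M w S) ^+ q.+1)%:E)))).
  apply: ge0_le_integral => //.
  - apply: emeasurable_funD; first exact/measurable_EFinP/mfpM.
    apply: measurable_funeM; apply: emeasurable_funD; apply: measurable_funeM.
      by apply/measurable_EFinP; exact: measurable_indic.
    exact/measurable_EFinP/mY.
  - move=> w _; rewrite sumEFin; have := squares w L1 pq.
    by rewrite -lee_fin [(_ / L)%R]mulrC => /le_trans; apply.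
have mind : measurable_fun setT (fun w => (\1_bad w)%:E : \bar R).
  by apply/measurable_EFinP; exact: measurable_indic.
have mYE : measurable_fun setT (fun w => (fine (M w S) ^+ q.+1)%:E).
  exact/measurable_EFinP/mY.
have YE0 w : 0 <= (fine (M w S) ^+ q.+1)%:E by rewrite lee_fin exprn_ge0.
have Lp0 : (0 <= L `^ p)%R by exact: powR_ge0.
have Li0 : (0 <= L^-1)%R by rewrite invr_ge0 ltW.
have in0 w : 0 <= (\1_bad w)%:E :> \bar R by rewrite lee_fin.
rewrite ge0_integralD//; last 4 first.
- by move=> w _; rewrite lee_fin.
- exact/measurable_EFinP/mfpM.
- move=> w _; apply: mule_ge0; first by rewrite lee_fin powR_ge0.
  by rewrite adde_ge0// mule_ge0.
- by apply: measurable_funeM; apply: emeasurable_funD; apply: measurable_funeM.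
apply: leeD.
  rewrite le_eqVlt; apply/orP; left; apply/eqP; apply: eq_integral => w _.
  rewrite fineK// ge0_fin_numE//.
  by apply: integral_ge0 => z _; rewrite lee_fin powR_ge0.
rewrite ge0_integralZl//; last 3 first.
- by apply: emeasurable_funD; apply: measurable_funeM.
- by move=> w _; rewrite adde_ge0// mule_ge0.
- by rewrite lee_fin powR_ge0.
apply: lee_wpmul2l; first by rewrite lee_fin powR_ge0.
rewrite ge0_integralD//; last 4 first.
- by move=> w _; rewrite mule_ge0.
- exact: measurable_funeM.
- by move=> w _; rewrite mule_ge0.
- exact: measurable_funeM.
rewrite !ge0_integralZl//; apply: leeD => //.
rewrite integral_indic// setIT EFinM; apply: lee_wpmul2l => //.
Qed.

End grid.

Let kappa : R := (p * 2 `^ (p - 1))%R.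

Let kappa0 : (0 < kappa)%R.
Proof. by rewrite mulr_gt0 ?powR_gt0. Qed.

Let exists_nat : exists q : nat, (p <= q%:R)%R.
Proof. by exists (Num.truncn p).+1; rewrite ltW// truncnS_gt. Qed.

Let X0 w : (0 <= X w)%R. Proof. exact: I_ge0. Qed.
Let A0 w : (0 <= A w)%R. Proof. exact: I_ge0. Qed.
Let mX : measurable_fun setT X. Proof. exact: mI. Qed.
Let mA : measurable_fun setT A. Proof. exact: mIQ. Qed.

(** The error terms of [grid_bound] are removed: they are made smaller than any [e > 0] by a
    suitable level [L] and a fine enough grid. *)
Let cross_bound : \int[P]_w (X w `^ p)%:E <=
  kappa%:E * (\int[P]_w (X w `^ (p - 1) * A w)%:E +
    \int[P]_w \int[M w]_(z in S) (f (w, z) `^ p)%:E).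
Proof.
apply/lee_addgt0Pr => e e0; have [q pq] := exists_nat.
pose y := fine (\int[P]_w (fine (M w S) ^+ q.+1)%:E).
have Y0 w : (0 <= fine (M w S) ^+ q.+1)%R by rewrite exprn_ge0// fine_ge0.
have yE : \int[P]_w (fine (M w S) ^+ q.+1)%:E = y%:E.
  rewrite /y fineK// ge0_fin_numE; last by apply: integral_ge0 => w _; rewrite lee_fin.
  exact: (jump_count_moment hN mE mB EB nuB n q.+1 (ltW T0)).
have y0 : (0 <= y)%R by apply: fine_ge0; apply: integral_ge0 => w _; rewrite lee_fin.
have Kp0 : (0 <= kappa * K `^ p)%R by rewrite mulr_ge0 ?powR_ge0// ltW.
pose c2 := (kappa * K `^ p * y)%R.
have c20 : (0 <= c2)%R by rewrite mulr_ge0.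
(* [L] is fixed first and makes the term with the jump count at most [e / 2]. The grid size [m] is
   chosen afterwards, because [c1] contains [L^p]. *)
pose L := (1 + 2 * c2 / e)%R.
have L1 : (1 <= L)%R.
  by rewrite lerDl; apply: divr_ge0; [exact: mulr_ge0|exact: ltW].
have L0 : (0 < L)%R by exact: lt_le_trans L1.
pose b := ((fine (nu (B n)) * T) ^+ 2)%R.
pose c1 := (kappa * K `^ p * (L `^ p * b))%R.
have b0 : (0 <= b)%R by exact: exprn_even_ge0.
have Lb0 r : (0 <= r -> 0 <= L `^ p * (b / r))%R.
  by move=> r0; apply: mulr_ge0; [exact: powR_ge0|exact: divr_ge0].
have c10 : (0 <= c1)%R by apply: mulr_ge0 => //; apply: mulr_ge0 => //; exact: powR_ge0.
pose m := Num.truncn (2 * c1 / e)%R.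
have hm : (c1 / m.+1%:R <= e / 2)%R.
  rewrite ler_pdivrMr ?ltr0n//.
  have : (2 * c1 / e <= m.+1%:R)%R by exact/ltW/truncnS_gt.
  by rewrite ler_pdivrMr// => h; lra.
have hL : (c2 / L <= e / 2)%R.
  rewrite ler_pdivrMr// /L mulrDr mulr1.
  have -> : (e / 2 * (2 * c2 / e) = c2)%R by field; rewrite gt_eqF.
  by rewrite lerDr divr_ge0// ltW.
apply: (le_trans (grid_bound m L1 pq)); rewrite yE -/kappa -/b.
set a1 := \int[P]_w _; set a2 := \int[P]_w _.
have a10 : 0 <= a1 by apply: integral_ge0 => w _; rewrite lee_fin mulr_ge0 ?powR_ge0.
have a20 : 0 <= a2.
  by apply: integral_ge0 => w _; apply: integral_ge0 => z _; rewrite lee_fin powR_ge0.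
have d0 : (0 <= K `^ p * (L `^ p * (b / m.+1%:R) + L^-1 * y))%R.
  apply: mulr_ge0; first exact: powR_ge0.
  apply: addr_ge0; first exact: Lb0.
  by apply: mulr_ge0 => //; rewrite invr_ge0 ltW.
rewrite (_ : (K `^ p)%:E * _ = (K `^ p * (L `^ p * (b / m.+1%:R) + L^-1 * y))%:E)//.
have d0' : 0 <= (K `^ p * (L `^ p * (b / m.+1%:R) + L^-1 * y))%:E by rewrite lee_fin.
rewrite addeA [leLHS](ge0_muleDr _ (adde_ge0 a10 a20) d0').
apply: leeD; first exact: lexx.
rewrite -EFinM lee_fin.
have -> : (kappa * (K `^ p * (L `^ p * (b / m.+1%:R) + L^-1 * y)) =
  c1 / m.+1%:R + c2 / L)%R by rewrite /c1 /c2; ring.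
by rewrite [leRHS]splitr lerD.
Qed.

(** Young's inequality leaves half of this moment on the right; only a finite quantity can be
    subtracted from both sides. Here the bound [K] and the Poisson moments of the jump count are
    used. *)
Let moment_fin : \int[P]_w (X w `^ p)%:E < +oo.
Proof.
have [q pq] := exists_nat.
have Y0 w : (0 <= fine (M w S))%R by exact: fine_ge0.
apply: (@le_lt_trans _ _ (\int[P]_w ((K `^ p)%:E * (1 + (fine (M w S) ^+ q)%:E)))).
  apply: ge0_le_integral => //.
  - by move=> w _; rewrite lee_fin powR_ge0.
  - by apply/measurable_EFinP; exact: (measurableT_comp (measurable_powR _)).
  - apply: measurable_funeM; apply: emeasurable_funD => //.
    apply/measurable_EFinP/measurable_funX.
    by apply: (measurableT_comp (@fine_measurable _ _ measurableT)); exact: mM.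
  - move=> w _; rewrite -EFinD -EFinM lee_fin.
    apply: (@le_trans _ _ ((K * fine (M w S)) `^ p)%R).
      by apply: powR_le; [exact: ltW|exact: X0|exact: X_le].
    rewrite powRM//; apply: ler_wpM2l; first exact: powR_ge0.
    have [y1|y1] := leP (fine (M w S)) 1%R.
      rewrite (@le_trans _ _ 1%R)//; last by rewrite lerDl exprn_ge0.
      by have := powR_le (ltW p0) (Y0 w) y1; rewrite powR1.
    rewrite -powR_mulrn// (@le_trans _ _ (fine (M w S) `^ q%:R)%R)//.
      by apply: ler_powR => //; exact: ltW.
    by rewrite lerDr.
rewrite ge0_integralZl//; last 3 first.
- apply: emeasurable_funD => //; apply/measurable_EFinP/measurable_funX.
  by apply: (measurableT_comp (@fine_measurable _ _ measurableT)); exact: mM.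
- by move=> w _; rewrite adde_ge0// lee_fin exprn_ge0.
- by rewrite lee_fin powR_ge0.
rewrite lte_mul_pinfty ?lee_fin ?powR_ge0//.
rewrite ge0_integralD//; last first.
  apply/measurable_EFinP/measurable_funX.
  by apply: (measurableT_comp (@fine_measurable _ _ measurableT)); exact: mM.
apply: lte_add_pinfty; last exact: (jump_count_moment hN mE mB EB nuB n q (ltW T0)).
rewrite integral_cst// mul1e; apply: (@le_lt_trans _ _ 1); last exact: ltry.
exact: probability_le1.
Qed.

(** The factor [2] comes from absorbing half of the left side. The constants are independent of [n],
    [K] and [T], which permits the passage to unbounded integrands. *)
Lemma bounded_moment : \int[P]_w (X w `^ p)%:E <=
  (2 * (kappa * (2 * kappa) `^ (p - 1)))%:E * \int[P]_w (A w `^ p)%:E +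
  (2 * kappa)%:E * \int[P]_w \int[M w]_(z in S) (f (w, z) `^ p)%:E.
Proof.
set C := (kappa * (2 * kappa) `^ (p - 1))%R.
have C0 : (0 <= C)%R by rewrite mulr_ge0 ?powR_ge0// ltW.
have EX0 : 0 <= \int[P]_w (X w `^ p)%:E.
  by apply: integral_ge0 => w _; rewrite lee_fin powR_ge0.
have EA0 : 0 <= \int[P]_w (A w `^ p)%:E.
  by apply: integral_ge0 => w _; rewrite lee_fin powR_ge0.
have Ef0 : 0 <= \int[P]_w \int[M w]_(z in S) (f (w, z) `^ p)%:E.
  by apply: integral_ge0 => w _; apply: integral_ge0 => z _; rewrite lee_fin powR_ge0.
have Ec0 : 0 <= \int[P]_w (X w `^ (p - 1) * A w)%:E.
  by apply: integral_ge0 => w _; rewrite lee_fin mulr_ge0 ?powR_ge0.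
have h := integral_powR_absorb P p1 (ltW kappa0) X0 A0 mX mA.
have := cross_bound; rewrite ge0_muleDr// => /le_trans/(_ (leeD2r _ h)).
have k2 : (0 < 2 * kappa)%R by rewrite mulr_gt0.
move: moment_fin EX0 EA0 Ef0 {h}.
case: (\int[P]_w (X w `^ p)%:E) => [x| |]// _ x0.
(* If one of the two quantities on the right is infinite, so is the bound; otherwise the inequality
   is one between real numbers. *)
case: (\int[P]_w (A w `^ p)%:E) => [a| |]// a0; last first.
  move=> b0 _; rewrite gt0_muley ?lte_fin ?mulr_gt0 ?powR_gt0//.
  by rewrite addye ?leey// gt_eqF// (lt_le_trans (ltNyr 0%R))// mule_ge0 ?lee_fin// ltW.
case: (\int[P]_w \int[M w]_(z in S) (f (w, z) `^ p)%:E) => [b| |]// b0; last first.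
  by move=> _; rewrite gt0_muley ?lte_fin// -EFinM addey ?leey.
rewrite -!EFinM -!EFinD !lee_fin => hx.
rewrite (_ : (2 * C * a + 2 * kappa * b = (2^-1 * x + C * a + kappa * b) + (2^-1 * x + C * a + kappa * b) - x)%R).
  by rewrite lerBrDr lerD.
by field.
Qed.
End bounded.

End moment_bound.

Lemma cvg_powR {R : realType} {T : Type} (F : set_system T) {FF : Filter F}
    (f : T -> R) (a r : R) :
  0 < r -> (forall t, 0 <= f t) -> 0 <= a -> f t @[t --> F] --> a ->
  f t `^ r @[t --> F] --> a `^ r.
Proof.
move=> r0 f0; rewrite le_eqVlt => /predU1P[<-|a0] fa.
  rewrite powR0 ?gt_eqF//; apply/cvgrPdist_lt => e e0.
  have e1 : 0 < e `^ r^-1 by rewrite powR_gt0.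
  move/cvgrPdist_lt : fa => /(_ _ e1); apply: filterS => t.
  rewrite !sub0r !normrN !ger0_norm ?powR_ge0//.
  move=> /(gt0_ltr_powR r0); rewrite !nnegrE => /(_ (f0 t) (ltW e1)).
  by rewrite -powRrM mulVf ?gt_eqF// powRr1// ltW.
have : expR (r * ln (f t)) @[t --> F] --> expR (r * ln a).
  have rl : r * ln (f t) @[t --> F] --> r * ln a.
    by apply: cvgMr; exact: (cvg_comp _ _ fa (continuous_ln a0)).
  exact: (cvg_comp _ _ rl (@continuous_expR R _)).
rewrite [a `^ r]/powR gt_eqF// => h; apply: cvg_trans h; apply: near_eq_cvg.
move/cvgrPdist_lt : fa => /(_ _ a0); apply: filterS => t.
rewrite /powR; case: ifPn => // /eqP ->; by rewrite subr0 gtr0_norm// ltxx.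
Qed.

(** * Unbounded integrands over all marks *)

Section moment.
Local Open Scope ereal_scope.
Context {R : realType} {d : nat} {dO : measure_display} {Omega : measurableType dO}.
Variables (P : probability Omega R) (F : R -> set (set Omega)).
Hypothesis hF : right_continuous_filtration F.
Local Notation V := 'rV[R]_d.
Variables (E : set V) (nu : {measure set V -> \bar R}).
Variable N : R.-ker Omega ~> (R * V)%type.
Hypothesis hN : poisson_random_measure P E nu F N.
Variable B : (set V)^nat.
Hypotheses (mE : measurable E) (mB : forall n, measurable (B n)).
Hypotheses (ndB : nondecreasing_seq B) (EB : E = \bigcup_n B n).
Hypothesis nuB : forall n, nu (B n) < +oo.

Local Notation M := (jump_measure N B mE).
Local Notation Q := (intensity mE mB EB nuB).
Local Notation PZ := (g_sigma_algebraType (predictable_class P F E B)).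

Variables (T : R) (f : Omega * (R * V) -> R) (p : R).
Hypotheses (T0 : (0 < T)%R) (f0 : forall z, (0 <= f z)%R).
Hypotheses (mf : measurable_fun [set: PZ] f) (p1 : (1 <= p)%R).

Local Notation S := (`]0%R, T] `*` E).

Let Sn n : set (R * V) := `]0%R, T] `*` B n.
Let fn n z := Num.min (f z) n%:R.

Let mf' : measurable_fun setT f := predictable_measurable_fun mE mf.

Let mfw w : measurable_fun setT (fun z => f (w, z)).
Proof. by apply: (measurableT_comp mf'); exact: measurable_pair1. Qed.

Let p0 : (0 < p)%R. Proof. exact: lt_le_trans p1. Qed.

Let fn0 n z : (0 <= fn n z)%R. Proof. by rewrite /fn le_min f0 ler0n. Qed.

Let fnf n z : (fn n z <= f z)%R. Proof. by rewrite /fn ge_min lexx. Qed.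

Let mfn n : measurable_fun [set: PZ] (fn n).
Proof. by apply: measurable_minr. Qed.

Let mfnw n w : measurable_fun setT (fun z => fn n (w, z)).
Proof. by apply: measurable_minr. Qed.

Let mS : measurable S. Proof. exact: measurableX. Qed.
Let mSn n : measurable (Sn n). Proof. exact: measurableX. Qed.

Let SnS n : Sn n `<=` S.
Proof. by move=> [t v] [/= tT Bv]; split => //=; rewrite EB; exists n. Qed.

Let ndSn m n : (m <= n)%N -> Sn m `<=` Sn n.
Proof. by move=> mn [t v] [/= tT Bv]; split => //=; move: v Bv; exact/subsetPset/ndB. Qed.

Let ndfn m n z : (m <= n)%N -> (fn m z <= fn n z)%R.
Proof. by move=> mn; rewrite /fn le_min !ge_min lexx/= ler_nat mn orbT. Qed.

Let G w n := (fun z => (fn n (w, z))%:E) \_ (Sn n).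

Let G0 w n z : 0 <= G w n z.
Proof. by apply: erestrict_ge0 => x _; rewrite lee_fin. Qed.

Let ndG w z : {homo G w ^~ z : m n / (m <= n)%N >-> m <= n}.
Proof.
move=> m n mn; rewrite /G !patchE; case: ifPn => [/set_mem mz|_]; last first.
  by case: ifPn => // _; rewrite lee_fin.
by rewrite mem_set ?lee_fin ?ndfn//; exact: ndSn mz.
Qed.

Let limG w z : limn (G w ^~ z) = ((fun z => (f (w, z))%:E) \_ S) z.
Proof.
apply: cvg_lim => //; rewrite patchE; case: ifPn => [/set_mem [/= tT]|zS].
  rewrite {1}EB => -[m _ Bm].
  apply: cvg_near_cst; exists (maxn m (Num.truncn (f (w, z))).+1) => // n /=.
  rewrite geq_max => /andP[mn fm]; rewrite /G patchE mem_set; last first.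
    by split => //=; move: z.2 Bm; exact/subsetPset/ndB.
  rewrite /fn min_l// ltW//; apply: (lt_le_trans (truncnS_gt _)).
  by rewrite ler_nat.
apply: cvg_near_cst; near=> n; rewrite /G patchE memNset// => /SnS zS'.
by move/negP : zS; apply; exact: mem_set.
Unshelve. all: end_near. Qed.

Let mG w n : measurable_fun setT (G w n).
Proof.
apply/(measurable_restrictT _ (mSn n)); apply: measurable_funTS.
exact/measurable_EFinP.
Qed.

Let cvgI (mu : {measure set (R * V) -> \bar R}) w :
  \int[mu]_(z in Sn n) (fn n (w, z))%:E @[n --> \oo] -->
  \int[mu]_(z in S) (f (w, z))%:E.
Proof.
rewrite integral_mkcond (_ : (fun n => _) = (fun n => \int[mu]_z G w n z)); last first.
  by apply/funext => n; rewrite [LHS]integral_mkcond.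
have := cvg_monotone_convergence (mu := mu) measurableT (mG w)
  (fun n z _ => G0 w n z) (fun z _ => @ndG w z).
by under [X in _ --> X -> _]eq_integral do rewrite limG.
Qed.

Let ndI (mu : {measure set (R * V) -> \bar R}) w :
  nondecreasing_seq (fun n => \int[mu]_(z in Sn n) (fn n (w, z))%:E).
Proof.
move=> m n mn; rewrite !(integral_mkcond (Sn _)).
apply: ge0_le_integral; first by [].
- by move=> z _; exact: G0.
- exact: mG.
- exact: mG.
- by move=> z _; exact: ndG.
Qed.

Let I_le (mu : {measure set (R * V) -> \bar R}) w n :
  \int[mu]_(z in Sn n) (fn n (w, z))%:E <= \int[mu]_(z in S) (f (w, z))%:E.
Proof.
have h := @cvgI mu w; rewrite -(cvg_lim _ h)//.
apply: lime_ge; first by apply/cvg_ex; eexists; exact: h.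
by near=> m; apply: ndI; near: m; exists n.
Unshelve. all: end_near. Qed.

Lemma measurable_predictable_strip : measurable (setT `*` S : set PZ).
Proof.
rewrite (_ : setT `*` S = \bigcup_n (setT `*` Sn n)); last first.
  apply/seteqP; split => [[w [t v]] [_ [/= tT]]|[w [t v]] [n _ [_ [/= tT Bv]]]].
    by rewrite EB => -[n _ Bv]; exists n.
  by split => //; split => //=; rewrite EB; exists n.
apply: bigcup_measurable => n _.
apply: (predictable_rect _ (lexx 0%R) _ (mB n) (@subset_refl _ _)).
by apply: (measurable_augmentation hF (lexx 0%R)); exact: measurableT.
Qed.

Lemma compensation_strip (g : Omega * (R * V) -> R) : (forall z, (0 <= g z)%R) ->
  measurable_fun [set: PZ] g ->
  \int[P]_w \int[M w]_(z in S) (g (w, z))%:E = \int[P]_w \int[Q]_(z in S) (g (w, z))%:E.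
Proof.
move=> g0 mg; pose G' := (fun z => (g z)%:E) \_ (setT `*` S).
have gE (mu : {measure set (R * V) -> \bar R}) w :
    \int[mu]_(z in S) (g (w, z))%:E = \int[mu]_z G' (w, z).
  rewrite integral_mkcond; apply: eq_integral => z _; rewrite /G' !patchE.
  congr (if _ then _ else _).
  by apply/idP/idP => [/set_mem zS|/set_mem [_ zS]]; exact: mem_set.
rewrite (eq_integral _ _ (fun w _ => gE (M w) w)).
rewrite (eq_integral _ _ (fun w _ => gE Q w)).
apply: (compensation hF hN mE mB ndB EB nuB).
  by move=> z; apply: erestrict_ge0 => x _; rewrite lee_fin.
by apply/(measurable_restrictT _ measurable_predictable_strip)/measurable_EFinP/measurable_funTS.
Qed.

Let comp_pow : \int[P]_w \int[M w]_(z in S) (f (w, z) `^ p)%:E =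
  \int[P]_w \int[Q]_(z in S) (f (w, z) `^ p)%:E.
Proof.
apply: (compensation_strip (g := fun z => f z `^ p)%R).
  by move=> z; exact: powR_ge0.
exact: (measurableT_comp (measurable_powR _)).
Qed.

Let mIQ D (g : Omega * (R * V) -> R) : measurable D -> (forall z, (0 <= g z)%R) ->
  measurable_fun [set: PZ] g ->
  measurable_fun setT (fun w => \int[Q]_(z in D) (g (w, z))%:E).
Proof.
move=> mD g0 mg; rewrite (_ : (fun w => _) = fubini_F Q
    ((EFin \o g) \_ (setT `*` D))).
  have mD' : measurable (setT `*` D : set (Omega * (R * V))) by exact: measurableX.
  apply: measurable_fun_fubini_tonelli_F.
  - apply/(measurable_restrictT _ mD'); apply/measurable_EFinP/measurable_funTS.
    exact: (predictable_measurable_fun mE mg).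
  - by move=> z; apply: erestrict_ge0 => x _; rewrite lee_fin.
apply/funext => w; rewrite [LHS]integral_mkcond; apply: eq_integral => z _; rewrite !patchE.
congr (if _ then _ else _).
by apply/idP/idP => [/set_mem zS|/set_mem [_ zS]]; exact: mem_set.
Qed.

Let mI D (g : Omega * (R * V) -> R) : measurable D -> (forall z, (0 <= g z)%R) ->
  measurable_fun [set: PZ] g ->
  measurable_fun setT (fun w => \int[M w]_(z in D) (g (w, z))%:E).
Proof.
move=> mD g0 mg; rewrite (_ : (fun w => _) = (fun w => \int[M w]_z
    ((fun z => (g z)%:E) \_ (setT `*` D)) (w, z))).
  have mD' : measurable (setT `*` D : set (Omega * (R * V))) by exact: measurableX.
  apply: (measurable_jump_integral N mE mB ndB EB).
  - by move=> z; apply: erestrict_ge0 => x _; rewrite lee_fin.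
  - apply/(measurable_restrictT _ mD')/measurable_EFinP/measurable_funTS.
    exact: (predictable_measurable_fun mE mg).
apply/funext => w; rewrite integral_mkcond; apply: eq_integral => z _; rewrite !patchE.
congr (if _ then _ else _).
by apply/idP/idP => [/set_mem zS|/set_mem [_ zS]]; exact: mem_set.
Qed.

(** The bound for [min(f, n)] over [B n] is uniform in [n], and its left side converges
    monotonically. The term with [f^p] is turned from [M] to [Q] by compensation. *)
Lemma jump_integral_moment :
  \int[P]_w (\int[Q]_(z in S) (f (w, z))%:E) `^ p < +oo ->
  \int[P]_w \int[Q]_(z in S) (f (w, z) `^ p)%:E < +oo ->
  \int[P]_w (fine (\int[M w]_(z in S) (f (w, z))%:E) `^ p)%:E < +oo.
Proof.
move=> hA hf.
have mfine (g : Omega -> \bar R) : measurable_fun setT g -> measurable_fun setT (fun w => fine (g w)).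
  by move=> mg; exact: (measurableT_comp (@fine_measurable _ _ measurableT)).
pose X n w := fine (\int[M w]_(z in Sn n) (fn n (w, z))%:E).
have I0 (mu : {measure set (R * V) -> \bar R}) w D (g : Omega * (R * V) -> R) :
    (forall z, (0 <= g z)%R) -> 0 <= \int[mu]_(z in D) (g (w, z))%:E.
  by move=> g0; apply: integral_ge0 => z _; rewrite lee_fin.
have finM n w : \int[M w]_(z in Sn n) (fn n (w, z))%:E = (X n w)%:E.
  rewrite /X fineK// ge0_fin_numE ?I0//.
  apply: (@le_lt_trans _ _ (\int[M w]_(z in Sn n) (cst n%:R%:E z))).
    apply: ge0_le_integral => //; first by move=> z _; rewrite lee_fin.
    - by apply/measurable_EFinP/measurable_funTS.
    - by move=> z _; rewrite lee_fin /fn ge_min lexx orbT.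
  rewrite integral_cst//= lte_mul_pinfty//.
  exact: (jump_rect_finite N mE mB ndB EB w T (mB n) (@subset_refl _ _)).
have X0 n w : (0 <= X n w)%R by apply: fine_ge0; exact: I0.
have ndX w : {homo X ^~ w : m n / (m <= n)%N >-> (m <= n)%R}.
  by move=> m n mn; rewrite -lee_fin -!finM; exact: ndI.
have mX n : measurable_fun setT (X n) by exact: mfine (mI (mSn n) (fn0 n) (mfn n)).
have mXp n : measurable_fun setT (fun w => (X n w `^ p)%:E).
  by apply/measurable_EFinP; exact: (measurableT_comp (measurable_powR _)).
have ndXp w : {homo (fun n => (X n w `^ p)%:E) : m n / (m <= n)%N >-> m <= n}.
  by move=> m n mn; rewrite lee_fin; apply: powR_le (ndX _ _ _ mn) => //; exact: ltW.
have mC := cvg_monotone_convergence (mu := P) measurableT mXp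
  (fun n w _ => powR_ge0 (X n w) p) (fun w _ => ndXp w).
have cX w : cvgn (fun n => (X n w `^ p)%:E) by exact: (ereal_nondecreasing_is_cvgn (ndXp w)).
apply: (@le_lt_trans _ _ (\int[P]_w limn (fun n => (X n w `^ p)%:E))).
  apply: ge0_le_integral => //.
  - by move=> w _; rewrite lee_fin powR_ge0.
  - apply/measurable_EFinP; apply: (measurableT_comp (measurable_powR _)).
    exact: mfine (mI mS f0 mf).
  - by apply: (emeasurable_fun_cvg (fun n w => (X n w `^ p)%:E)) => // w _; exact: cX.
  - move=> w _; have := @cvgI (M w) w.
    have : 0 <= \int[M w]_(z in S) (f (w, z))%:E by exact: I0.
    case: (\int[M w]_(z in S) (f (w, z))%:E) => [r| |]// r0 h.
      rewrite (_ : limn _ = (r `^ p)%:E)//; apply/cvg_lim => //.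
      apply: cvg_EFin; first by near=> n.
      apply: cvg_powR => //; first by move: h => /fine_cvgP[].
    (* An infinite integral has [fine] equal to 0, so the inequality is trivial for such a
       sample. *)
    by rewrite powR0 ?gt_eqF//; apply: lime_ge => //; near=> n; rewrite lee_fin powR_ge0.
rewrite -(cvg_lim _ mC)//.
have hM := hf; rewrite -comp_pow in hM.
set K1 := (2 * (p * 2 `^ (p - 1) * (2 * (p * 2 `^ (p - 1))) `^ (p - 1)))%R.
set K2 := (2 * (p * 2 `^ (p - 1)))%R.
apply: (@le_lt_trans _ _ (K1%:E * \int[P]_w (\int[Q]_(z in S) (f (w, z))%:E) `^ p +
  K2%:E * \int[P]_w \int[M w]_(z in S) (f (w, z) `^ p)%:E)); last first.
  have K20 : (0 <= K2)%R by rewrite !mulr_ge0 ?powR_ge0// ltW.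
  have K10 : (0 <= K1)%R by rewrite !mulr_ge0 ?powR_ge0// ltW.
  apply: lte_add_pinfty; apply: lte_mul_pinfty => //.
apply: lime_le; first by apply/cvg_ex; eexists; exact: mC.
near=> n; have fnK z : (fn n z <= n%:R)%R by rewrite /fn ge_min lexx orbT.
apply: (le_trans (bounded_moment hF hN mE mB ndB EB nuB n T0 (fn0 n) fnK (mfn n) p1)).
apply: leeD; apply: lee_wpmul2l.
- by rewrite lee_fin !mulr_ge0 ?powR_ge0// ltW.
- apply: ge0_le_integral; first by [].
  + by move=> w _; rewrite lee_fin powR_ge0.
  + apply/measurable_EFinP; apply: (measurableT_comp (measurable_powR _)).
    exact: mfine (mIQ (mSn n) (fn0 n) (mfn n)).
  + by apply: (measurableT_comp (measurable_poweR _)); exact: (mIQ mS f0 mf).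
  + move=> w _; have := I_le Q w n; have := I0 Q w S f f0.
    have := I0 Q w (Sn n) (fn n) (fn0 n).
    rewrite -/(Sn n); case: (\int[Q]_(z in Sn n) (fn n (w, z))%:E) => [r| |]//=.
      move=> r0; case: (\int[Q]_(z in S) (f (w, z))%:E) => [r'| |]//=.
        by rewrite !lee_fin => r'0 rr'; apply: powR_le => //; exact: ltW.
      by move=> _ _; rewrite gt_eqF// leey.
    by move=> _ _ _; rewrite powR0 ?gt_eqF// poweR_ge0.
- by rewrite lee_fin !mulr_ge0 ?powR_ge0// ltW.
- have mfp n' : measurable_fun [set: PZ] (fun z => (fn n' z `^ p)%R).
    exact: (measurableT_comp (measurable_powR _)).
  have mfp' : measurable_fun [set: PZ] (fun z => (f z `^ p)%R).
    exact: (measurableT_comp (measurable_powR _)).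
  apply: ge0_le_integral; first by [].
  + by move=> w _; apply: integral_ge0 => z _; rewrite lee_fin powR_ge0.
  + by apply: (mI (mSn n) _ (mfp n)) => z; exact: powR_ge0.
  + by apply: (mI mS _ mfp') => z; exact: powR_ge0.
  + move=> w _; apply: (@le_trans _ _ (\int[M w]_(z in Sn n) (f (w, z) `^ p)%:E)).
      have mw (g : Omega * (R * V) -> R) : measurable_fun [set: PZ] g ->
          measurable_fun (Sn n) (fun z => (g (w, z))%:E).
        move=> /(predictable_measurable_fun mE) mg; apply/measurable_EFinP/measurable_funTS.
        by apply: (measurableT_comp mg); exact: measurable_pair1.
      apply: ge0_le_integral; first exact: mSn.
      - by move=> z _; rewrite lee_fin powR_ge0.
      - exact: (mw _ (mfp n)).
      - exact: (mw _ mfp').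
      - by move=> z _; rewrite lee_fin; apply: powR_le => //; exact: ltW.
    apply: ge0_subset_integral; [exact: mSn|exact: mS| | |exact: SnS].
    - apply/measurable_EFinP/measurable_funTS.
      exact: (measurableT_comp (measurable_powR _)).
    - by move=> z _; rewrite lee_fin powR_ge0.
Unshelve. all: end_near.
Qed.

End moment.

(** * Comparison of integrals off null sets *)

Section null_sets.
Local Open Scope ereal_scope.
Context {R : realType} {dT : measure_display} {T : measurableType dT}.
Variable mu : {measure set T -> \bar R}.
Import HBNNSimple.

(** The integral of a nonnegative function is a supremum over simple functions below it, and cutting
    such a function off on [Z] keeps its integral. The form allows arbitrary functions, because
    iterated integrals such as that of the essential supremum of [g] are not known to have
    measurable integrands. *)
Lemma ge0_le_integral_null (D Z : set T) (f g : T -> \bar R) :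
  measurable Z -> mu Z = 0 ->
  (forall x, D x -> 0 <= f x) -> (forall x, D x -> 0 <= g x) ->
  (forall x, D x -> ~ Z x -> f x <= g x) ->
  \int[mu]_(x in D) f x <= \int[mu]_(x in D) g x.
Proof.
move=> mZ Z0 f0 g0 fg; rewrite !(integral_mkcond D).
rewrite !ge0_integralTE; [|exact: erestrict_ge0|exact: erestrict_ge0].
apply: ge_ereal_sup => _ [h hf <-].
pose h' := mul_nnsfun h (indic_nnsfun R (measurableC mZ)).
have h'E x : h' x = (h x * \1_(~` Z) x)%R by [].
apply: (@le_trans _ _ (sintegral mu h')); last first.
  apply: ereal_sup_ubound; exists h' => // x; rewrite h'E indicE.
  have [Zx|nZx] := pselect (Z x).
    by rewrite memNset ?mulr0; [apply: erestrict_ge0 => //|apply].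
  rewrite mem_set// mulr1; apply: (le_trans (hf x)); rewrite !patchE.
  by case: ifPn => // /set_mem Dx; exact: fg.
rewrite -!integralT_nnsfun le_eqVlt; apply/orP; left; apply/eqP.
apply: ge0_ae_eq_integral => //.
- exact/measurable_EFinP.
- exact/measurable_EFinP.
- by move=> x _; rewrite lee_fin.
- by move=> x _; rewrite lee_fin.
- exists Z; split => // x /= hx; apply: contrapT => nZx; apply: hx => _.
  by rewrite mindicE mem_set// mulr1.
Qed.

Lemma eq_integral_null (D Z : set T) (f g : T -> \bar R) :
  measurable Z -> mu Z = 0 -> (forall x, D x -> ~ Z x -> f x = g x) ->
  \int[mu]_(x in D) f x = \int[mu]_(x in D) g x.
Proof.
move=> mZ Z0 fg; rewrite integralE [RHS]integralE; congr (_ - _);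
  apply/eqP; rewrite eq_le; apply/andP; split;
  apply: (ge0_le_integral_null mZ Z0) => // x Dx nZx;
  by rewrite ?funeposE ?funenegE (fg _ Dx nZx).
Qed.

End null_sets.

Lemma measurable_box {R : realType} n (x : 'rV[R]_n) (e : R) :
  measurable [set y : 'rV[R]_n | forall i, (`|x 0 i - y 0 i| < e)%R].
Proof.
rewrite (_ : [set y | _] = \bigcap_(i in [set: 'I_n])
    [set y : 'rV[R]_n | (`|x 0 i - y 0 i| < e)%R]); last first.
  by apply/seteqP; split => [y h i _|y h i]; [exact: h|exact: h].
apply: fin_bigcap_measurable => // i _.
have mf : measurable_fun setT (fun y : 'rV[R]_n => `|x 0 i - y 0 i|%R).
  apply: measurableT_comp; first exact: normr_measurable.
  by apply: measurable_funB; [exact: measurable_cst|exact: measurable_coord].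
have := mf measurableT _ (measurable_itv `]-oo, e[).
by rewrite setTI; congr measurable; apply/seteqP; split => y /=; rewrite in_itv.
Qed.

(** * Rounding to rational points *)

Section rational_points.
Context {R : realType} {d : nat}.
Local Notation V := 'rV[R]_d.

Definition rat_point (k : nat) : V :=
  if unpickle k is Some q then map_mx ratr (q : 'rV[rat]_d) else 0.

Let near_rat_point (n : nat) (x : V) :
  exists k, [forall i, `|x 0 i - rat_point k 0 i| < n.+1%:R^-1].
Proof.
have e0 : 0 < n.+1%:R^-1 :> R by rewrite invr_gt0.
have /choice[q qP] (i : 'I_d) : exists q : rat, `|x 0 i - ratr q| < n.+1%:R^-1.
  have : x 0 i < x 0 i + n.+1%:R^-1 by rewrite ltrDl.
  move=> /rat_in_itvoo[q]; rewrite in_itv/= => /andP[q1 q2]; exists q.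
  by rewrite ltr0_norm ?subr_lt0// opprB ltrBlDl.
exists (pickle (\row_i q i)); apply/forallP => i.
by rewrite /rat_point pickleK !mxE.
Qed.

(** Taking the least index makes the rounding a measurable function of [x] with countably many
    values. *)
Definition round_index n (x : V) := ex_minn (near_rat_point n x).
Definition round_point n (x : V) : V := rat_point (round_index n x).

Lemma round_pointP n (x : V) i : `|x 0 i - round_point n x 0 i| < n.+1%:R^-1.
Proof.
by rewrite /round_point /round_index; case: ex_minnP => k /forallP + _; exact.
Qed.

Lemma cvg_round_point x : round_point n x @[n --> \oo] --> x.
Proof.
apply/cvg_ballP => e e0; near=> n; split=> // i j; rewrite ord1.
apply: (lt_trans (round_pointP n x j)).
by near: n; exact: near_infty_natSinv_lt (PosNum e0).
Unshelve. all: end_near. Qed.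

Lemma measurable_round_index n k : measurable [set x | round_index n x = k].
Proof.
pose C j := [set x : V | [forall i, `|x 0 i - rat_point j 0 i| < n.+1%:R^-1]].
have mC j : measurable (C j).
  rewrite (_ : C j = [set x : V | forall i, `|rat_point j 0 i - x 0 i| < n.+1%:R^-1]).
    exact: measurable_box.
  apply/seteqP; split => x /=.
    by move/forallP => h i; rewrite distrC.
  by move=> h; apply/forallP => i; rewrite distrC.
rewrite (_ : [set _ | _] = C k `\` \bigcup_(j in `I_k) C j).
  by apply: measurableD; [exact: mC|apply: bigcup_measurable => j _; exact: mC].
apply/seteqP; split => x /=; rewrite /round_index; case: ex_minnP => m mP mmin.
  move=> <-; split => // -[j /= jm jC].
  by have := mmin _ jC; rewrite leqNgt jm.
move=> [kC hk]; apply/eqP; rewrite eqn_leq mmin//= leqNgt; apply/negP => mk.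
by apply: hk; exists m; [exact: mk|exact: mP].
Qed.

(* A function of Caratheodory type is the pointwise limit of its values at    *)
(* rounded arguments.                                                         *)
Lemma measurable_caratheodory {dA} {A : measurableType dA} (f : A -> V -> R) :
  (forall y, measurable_fun setT (f ^~ y)) -> (forall a, continuous (f a)) ->
  measurable_fun setT (fun q : A * V => f q.1 q.2).
Proof.
move=> mf cf; apply: (measurable_fun_cvg
    (h := fun n (q : A * V) => f q.1 (round_point n q.2))) => //.
  move=> n _ Y mY; rewrite setTI (_ : _ @^-1` _ = \bigcup_k
      ((f ^~ (rat_point k) @^-1` Y) `*` [set x | round_index n x = k])).
    apply: bigcup_measurable => k _; apply: measurableX.
      by have := mf (rat_point k) measurableT Y mY; rewrite setTI.
    exact: measurable_round_index.
  apply/seteqP; split => [[a x] /= h|[a x] [k _ [/= h hk]]].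
    by exists (round_index n x).
  by rewrite /round_point hk.
move=> [a x] _ /=.
have cx : round_point n x @[n --> \oo] --> x by exact: cvg_round_point.
exact: (cvg_comp (fun n => round_point n x) (f a) cx (cf a x)).
Qed.

Lemma continuous_measurable_rV (f : V -> R) :
  continuous f -> measurable_fun setT f.
Proof.
move=> cf.
have h : measurable_fun setT (fun q : unit * V => f q.2).
  by apply: (@measurable_caratheodory _ _ (fun=> f)) => // y; exact: measurable_cst.
exact: (measurableT_comp h (measurable_pair1 tt)).
Qed.

End rational_points.

(** * Euclidean norm and Lebesgue measure *)

Section euclidean_norm.
Context {R : realType} {d : nat}.
Implicit Types x y : 'rV[R]_d.

Lemma enorm_ge0 x : 0 <= enorm x. Proof. exact: sqrtr_ge0. Qed.

Lemma enorm0 : enorm (0 : 'rV[R]_d) = 0.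
Proof. by rewrite /enorm big1 ?sqrtr0// => i _; rewrite mxE expr0n. Qed.

Lemma enorm_eq0 x : enorm x = 0 -> x = 0.
Proof.
move/eqP; rewrite sqrtr_eq0 => h; apply/rowP => i; rewrite mxE.
have s0 (j : 'I_d) : true -> 0 <= x 0 j ^+ 2 by rewrite sqr_ge0.
have /eqP : \sum_(i < d) x 0 i ^+ 2 = 0 by apply/eqP; rewrite eq_le h sumr_ge0.
by rewrite psumr_eq0// => /allP/(_ i (mem_index_enum _))/=; rewrite sqrf_eq0 => /eqP.
Qed.

Lemma enorm_gt0 x : x != 0 -> 0 < enorm x.
Proof. by move=> x0; rewrite lt0r enorm_ge0 andbT; apply: contra_neq x0 => /enorm_eq0. Qed.

Lemma continuous_enorm : continuous (@enorm R d).
Proof.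
have h (x : 'rV[R]_d) :
    (\sum_(i < d) y 0 i ^+ 2) @[y --> x] --> \sum_(i < d) x 0 i ^+ 2.
  apply: (@cvg_big _ _ +%R 0 xpredT _ _ (nbhs x)); first exact: add_continuous.
  move=> i _; rewrite expr2; under eq_fun do rewrite expr2.
  by apply: cvgM; exact: coord_continuous.
by move=> x; exact: (cvg_comp _ _ (h x) (@sqrt_continuous R _)).
Qed.

(** Each coordinate satisfies [(x-y)^2 <= 2 x^2 + 2 y^2], and these sum to at most [(2c)^2]. *)
Lemma enorm_sub_le c x y : 0 < c -> enorm x < c -> enorm y < c ->
  enorm (x - y) <= 2 * c.
Proof.
move=> c0 xc yc; rewrite -[2 * c]gtr0_norm ?mulr_gt0// -sqrtr_sqr.
have sq z : enorm z < c -> \sum_(i < d) z 0 i ^+ 2 <= c ^+ 2.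
  move=> zc; rewrite -(@sqr_sqrtr _ (\sum_(i < d) z 0 i ^+ 2)); last first.
    by apply: sumr_ge0 => i _; exact: sqr_ge0.
  by rewrite ler_sqr ?nnegrE ?sqrtr_ge0 ?(ltW c0)// ltW.
apply: ler_wsqrtr; apply: (@le_trans _ _
    (\sum_(i < d) (2 * x 0 i ^+ 2 + 2 * y 0 i ^+ 2))).
  apply: ler_sum => i _; rewrite !mxE -subr_ge0.
  rewrite (_ : _ - _ = (x 0 i + y 0 i) ^+ 2) ?sqr_ge0//; ring.
rewrite big_split/= -!mulr_sumr; have := sq _ xc; have := sq _ yc; lra.
Qed.

Lemma measurable_enorm : measurable_fun setT (@enorm R d).
Proof.
apply: (measurableT_comp (continuous_measurable_fun (@sqrt_continuous R))).
apply: measurable_sum => i; apply: measurable_funX; exact: measurable_coord.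
Qed.

End euclidean_norm.

Lemma product_measure_preserving {R : realType} d1 d2 (T1 : measurableType d1)
    (T2 : measurableType d2) (m1 : {sigma_finite_measure set T1 -> \bar R})
    (m2 : {sigma_finite_measure set T2 -> \bar R}) (r1 : T1 -> T1) (r2 : T2 -> T2)
    (X : set (T1 * T2)) :
  measurable_fun setT r1 -> measurable_fun setT r2 ->
  (forall A, measurable A -> m1 (r1 @^-1` A) = m1 A) ->
  (forall A, measurable A -> m2 (r2 @^-1` A) = m2 A) -> measurable X ->
  (m1 \x m2)%E ((fun q => (r1 q.1, r2 q.2)) @^-1` X) = (m1 \x m2)%E X.
Proof.
move=> mr1 mr2 h1 h2 mX.
have mpsi : measurable_fun setT (fun q : T1 * T2 => (r1 q.1, r2 q.2)).
  apply/measurable_fun_pairP; split => /=.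
    exact: (measurableT_comp mr1 measurable_fst).
  exact: (measurableT_comp mr2 measurable_snd).
pose m := measure_function_pushforward__canonical__measure_function_Measure
  (m1 \x m2)%E mpsi.
have mE A B : measurable A -> measurable B -> m (A `*` B) = (m1 A * m2 B)%E.
  move=> mA mB; rewrite /m/= /pushforward.
  rewrite (_ : _ @^-1` _ = (r1 @^-1` A) `*` (r2 @^-1` B))//.
  rewrite product_measure1E.
  - by congr (_ * _)%E; [exact: h1|exact: h2].
  - by rewrite -[X in measurable X]setTI; exact: mr1.
  - by rewrite -[X in measurable X]setTI; exact: mr2.
exact: (esym (product_measure_unique mE mX)).
Qed.

Section lebesgue_rV_theory.
Context {R : realType}.
Local Open Scope ereal_scope.

Lemma lebesgue_measure_reflect (a : R) (A : set R) : measurable A ->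
  lebesgue_measure ((fun x => (a - x)%R) @^-1` A) = lebesgue_measure A.
Proof.
move=> mA.
have mr : measurable_fun setT (fun x : measurableTypeR R => (a - x)%R : measurableTypeR R).
  by apply: measurable_funB => //; exact: measurable_cst.
pose m := measure_function_pushforward__canonical__measure_function_Measure (@lebesgue_measure R) mr.
apply: esym; apply: (@lebesgue_measure_unique R m) => // X [[u v] _ <-] /=.
rewrite /m/= /pushforward.
rewrite (_ : _ @^-1` _ = `[(a - v)%R, (a - u)%R[%classic); last first.
  by apply/seteqP; split => x /=; rewrite !in_itv/= => /andP[h1 h2]; apply/andP; split; lra.
rewrite !lebesgue_measure_itv/= !lte_fin ltrD2l ltrN2.
by case: ifPn => // _; rewrite -!EFinB; congr EFin; ring.
Qed.

Lemma measurable_reflect n (x : 'rV[R]_n) : measurable_fun setT (fun y : 'rV[R]_n => (x - y)%R).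
Proof.
apply: measurable_fun_rV => i; under eq_fun do rewrite !mxE.
by apply: measurable_funB => //; exact: measurable_coord.
Qed.

(** By induction on the dimension: through [rV_cons] the reflection is a product of a reflection of
    [R] and one of the remaining coordinates. *)
Lemma lebesgue_rV_reflect n (x : 'rV[R]_n) (A : set 'rV[R]_n) : measurable A ->
  lebesgue_rV n ((fun y => (x - y)%R) @^-1` A) = lebesgue_rV n A.
Proof.
elim: n => [|n ih] in x A *.
  move=> _; congr (lebesgue_rV 0 _); apply/seteqP; split => y /=;
    by rewrite [(x - y)%R](_ : _ = y)//; apply/rowP => -[].
move=> mA.
pose x' : 'rV[R]_n := (\row_j x 0 (lift ord0 j))%R.
pose psi (q : R * 'rV[R]_n) := (x 0 ord0 - q.1, x' - q.2)%R.
have mcA : measurable (@rV_cons R n @^-1` A).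
  by rewrite -[X in measurable X]setTI; exact: measurable_rV_cons.
rewrite /= /lebesgue_rVS /pushforward.
rewrite (_ : _ @^-1` _ = psi @^-1` (@rV_cons R n @^-1` A)); last first.
  have E q : (x - rV_cons q)%R = rV_cons (psi q).
    apply/rowP => i; rewrite [LHS]mxE [X in (_ + X)%R]mxE.
    case: (unliftP ord0 i) => [k ->|->]; last by rewrite !rV_cons0.
    by rewrite !rV_consS /psi/= !mxE.
  by apply/seteqP; split => q /=; rewrite E.
have mr : measurable_fun setT (fun r : measurableTypeR R => (x 0 ord0 - r)%R : measurableTypeR R).
  by apply: measurable_funB => //; exact: measurable_cst.
have h := @product_measure_preserving R _ _ (measurableTypeR R) _
  (@lebesgue_measure R) (lebesgue_rV n) _ _ (@rV_cons R n @^-1` A) mr (measurable_reflect x')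
  (lebesgue_measure_reflect (x 0%R ord0)) (ih x').
exact: (h mcA).
Qed.

Lemma lebesgue_rV_box n (x : 'rV[R]_n) (e : R) : (0 < e)%R ->
  0 < lebesgue_rV n [set y : 'rV[R]_n | forall i, (`|x 0 i - y 0 i| < e)%R].
Proof.
move=> e0; elim: n => [|n ih] in x *.
  by rewrite /= diracE mem_set ?lte_fin// => -[].
pose x' : 'rV[R]_n := (\row_j x 0 (lift ord0 j))%R.
rewrite /= /lebesgue_rVS /pushforward.
rewrite (_ : @rV_cons R n @^-1` _ = `](x 0%R ord0 - e)%R, (x 0%R ord0 + e)%R[%classic `*`
    [set y : 'rV[R]_n | forall i, (`|x' 0 i - y 0 i| < e)%R]); last first.
  apply/seteqP; split => [[r y] /= h|[r y] /= [h1 h2] i].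
    split => /=.
      by have := h ord0; rewrite rV_cons0/= in_itv/= ltr_distlC.
    by move=> i; have := h (lift ord0 i); rewrite rV_consS mxE.
  case: (unliftP ord0 i) => [k ->|->]; last first.
    by rewrite rV_cons0/=; move: h1; rewrite in_itv/= ltr_distlC.
  by rewrite rV_consS/=; have := h2 k; rewrite mxE.
rewrite product_measure1E//; last exact: measurable_box.
apply: mule_gt0; last exact: ih.
have : 0 < lebesgue_measure `](x 0%R ord0 - e)%R, (x 0%R ord0 + e)%R[%classic.
  rewrite lebesgue_measure_itv/= lte_fin ifT; last by lra.
  by rewrite -EFinB lte_fin; lra.
exact.
Qed.

(** A violation at one point persists on a box, which has positive measure and so is not contained
    in [Z]. *)
Lemma le_continuous_ae n (f : 'rV[R]_n -> R) (b : \bar R) (Z : set 'rV[R]_n) :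
  continuous f -> measurable Z -> lebesgue_rV n Z = 0 ->
  (forall y, ~ Z y -> (f y)%:E <= b) -> forall y, (f y)%:E <= b.
Proof.
move=> cf mZ Z0 fb y; rewrite leNgt; apply/negP => bf.
have /nbhs_ballP[e /= e0 eU] : \forall y' \near y, b < (f y')%:E.
  case: b {fb} bf => [b| |]//=.
    rewrite lte_fin => bf.
    by near=> y'; rewrite lte_fin; near: y'; exact: (cvgr_gt _ (cf y)).
  by move=> _; near=> y'; rewrite ltNyr.
have := lebesgue_rV_box y e0; rewrite ltNge => /negP; apply.
rewrite -Z0; apply: le_measure; rewrite ?inE//; first exact: measurable_box.
move=> y' /= h; apply: contrapT => nZ.
have : b < (f y')%:E by apply: eU; split => // i j; rewrite ord1; exact: h.
by rewrite ltNge fb.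
Unshelve. all: end_near. Qed.

End lebesgue_rV_theory.

(** * Convolution with the heat kernel *)

Lemma Rintegral_dominated_cvg {R : realType} {dT} {T : measurableType dT}
    (mu : {measure set T -> \bar R}) (D : set T) (f_ : nat -> T -> R) (f g : T -> R) :
  measurable D -> (forall n, measurable_fun D (f_ n)) -> measurable_fun D f ->
  (forall x, D x -> f_ n x @[n --> \oo] --> f x) -> mu.-integrable D (EFin \o g) ->
  (forall n x, D x -> `|f_ n x| <= g x) ->
  \int[mu]_(x in D) f_ n x @[n --> \oo] --> \int[mu]_(x in D) f x.
Proof.
move=> mD mf_ mf ff ig fg.
have [|||||fi _ h] := @dominated_convergence _ _ _ mu D mD
    (fun n x => (f_ n x)%:E) (EFin \o f) (EFin \o g).
- by move=> n; exact/measurable_EFinP.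
- exact/measurable_EFinP.
- by apply: aeW => x Dx; apply: cvg_EFin; [near=> n|exact: ff].
- exact: ig.
- by apply: aeW => x n Dx; rewrite lee_fin; exact: fg.
apply: fine_cvg; rewrite /Rintegral fineK//; exact: integrable_fin_num.
Unshelve. all: end_near. Qed.

Lemma measurable_integral_section {R : realType} d1 d2 (T1 : measurableType d1)
    (T2 : measurableType d2) (m : {sigma_finite_measure set T2 -> \bar R})
    (f : T1 * T2 -> \bar R) : measurable_fun setT f ->
  measurable_fun setT (fun x => \int[m]_y f (x, y))%E.
Proof.
move=> mf; rewrite (_ : (fun x => _) =
    (fun x => fubini_F m (f^\+) x - fubini_F m (f^\-) x)%E); last first.
  apply/funext => x; rewrite integralE; congr (_ - _)%E;
    by apply: eq_integral => y _; rewrite ?funeposE ?funenegE.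
apply: emeasurable_funB; apply: measurable_fun_fubini_tonelli_F => //.
  exact: measurable_funepos.
exact: measurable_funeneg.
Qed.

Section scheffe.
Context {R : realType} {dT : measure_display} {T : measurableType dT}.
Variable mu : {measure set T -> \bar R}.

Lemma density_integrable (k : T -> R) : measurable_fun setT k ->
  (forall x, 0 <= k x) -> (\int[mu]_x (k x)%:E = 1)%E ->
  mu.-integrable setT (EFin \o k).
Proof.
move=> mk k0 k1; apply/integrableP; split; first exact/measurable_EFinP.
under eq_integral do rewrite /= ger0_norm//.
by rewrite k1 ltry.
Qed.

Lemma density_bounded_integrable (k b : T -> R) (G : R) :
  measurable_fun setT k -> (forall x, 0 <= k x) ->
  (\int[mu]_x (k x)%:E = 1)%E -> measurable_fun setT b -> (forall x, `|b x| <= G) ->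
  mu.-integrable setT (EFin \o (fun x => k x * b x)).
Proof.
move=> mk k0 k1 mb bG; apply: (@le_integrable _ _ _ _ setT _ _ (fun x => G%:E * (k x)%:E)%E) => //.
- exact/measurable_EFinP/measurable_funM.
- move=> x _; rewrite lee_fin !normrM (ger0_norm (k0 x)) mulrC ler_wpM2r//.
  by rewrite (le_trans (bG x))// ler_norm.
- by apply: integrableZl => //; exact: density_integrable.
Qed.

Lemma density_Rintegral_le (k b : T -> R) (G : R) :
  measurable_fun setT k -> (forall x, 0 <= k x) ->
  (\int[mu]_x (k x)%:E = 1)%E -> measurable_fun setT b -> (forall x, `|b x| <= G) ->
  `|\int[mu]_x (k x * b x)| <= G.
Proof.
move=> mk k0 k1 mb bG.
have ik := density_integrable mk k0 k1.
have ikb := density_bounded_integrable mk k0 k1 mb bG.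
apply: (le_trans (le_normr_Rintegral _ ikb)) => //.
apply: (@le_trans _ _ (\int[mu]_x (G * k x))).
  apply: le_Rintegral => //.
  - have := integrable_norm ikb; congr (_.-integrable _ _).
  - exact: (integrableZl measurableT G ik).
  - by move=> x _; rewrite normrM ger0_norm// mulrC ler_wpM2r.
by rewrite RintegralZl// [X in _ * X]/Rintegral k1 mulr1.
Qed.

(** Since [|k - k_n| = k + k_n - 2 min(k_n, k)] and both masses are 1, the distance in mean is
    [2 - 2 int min(k_n, k)]. The minimum is dominated by [k], so dominated convergence applies
    although nothing dominates the [k_n] themselves. *)
Lemma scheffe (k : T -> R) (k_ : nat -> T -> R) (b : T -> R) (G : R) :
  measurable_fun setT k -> (forall x, 0 <= k x) -> (\int[mu]_x (k x)%:E = 1)%E ->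
  (forall n, measurable_fun setT (k_ n)) -> (forall n x, 0 <= k_ n x) ->
  (forall n, \int[mu]_x (k_ n x)%:E = 1)%E ->
  (forall x, k_ n x @[n --> \oo] --> k x) ->
  measurable_fun setT b -> (forall x, `|b x| <= G) ->
  \int[mu]_x (k_ n x * b x) @[n --> \oo] --> \int[mu]_x (k x * b x).
Proof.
move=> mk k0 k1 mk_ k_0 k_1 kk mb bG.
have ik := density_integrable mk k0 k1.
have ik_ n := density_integrable (mk_ n) (k_0 n) (k_1 n).
have ikb := density_bounded_integrable mk k0 k1 mb bG.
have ik_b n := density_bounded_integrable (mk_ n) (k_0 n) (k_1 n) mb bG.
pose m n x := Num.min (k_ n x) (k x).
have mm n : measurable_fun setT (m n) by exact: measurable_minr.
have m0 n x : 0 <= m n x by rewrite le_min k_0 k0.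
have im n : mu.-integrable setT (EFin \o m n).
  apply: (le_integrable _ _ _ ik) => //; first exact/measurable_EFinP.
  by move=> x _; rewrite lee_fin !ger0_norm// ge_min lexx orbT.
have cm : \int[mu]_x (m n x) @[n --> \oo] --> (1 : R).
  rewrite (_ : 1 = \int[mu]_x k x); last by rewrite /Rintegral k1.
  apply: (Rintegral_dominated_cvg (g := k)) => //.
    move=> x _; apply/cvgrPdist_lt => e e0; move/cvgrPdist_lt : (kk x) => /(_ e e0).
    by apply: filterS => n; rewrite /m; case: (leP (k_ n x) (k x)) => // _ _; rewrite subrr normr0.
  by move=> n x _; rewrite ger0_norm// ge_min lexx orbT.
have bd n : `|\int[mu]_x (k x * b x) - \int[mu]_x (k_ n x * b x)| <=
    G * (2 - 2 * \int[mu]_x (m n x)).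
  have G0 : 0 <= G by exact: le_trans (bG point).
  rewrite -RintegralB//.
  have idf : mu.-integrable setT (EFin \o (fun x => k x * b x - k_ n x * b x)).
    by have := integrableB measurableT ikb (ik_b n).
  have isum : mu.-integrable setT (EFin \o (fun x => k x + k_ n x)).
    exact: (integrableD measurableT ik (ik_ n)).
  have i2m : mu.-integrable setT (EFin \o (fun x => 2 * m n x)).
    exact: (integrableZl measurableT 2 (im n)).
  have iall : mu.-integrable setT (EFin \o (fun x => k x + k_ n x - 2 * m n x)).
    exact: (integrableB measurableT isum i2m).
  have ib : mu.-integrable setT (EFin \o (fun x => G * (k x + k_ n x - 2 * m n x))).
    exact: (integrableZl measurableT G iall).
  apply: (le_trans (le_normr_Rintegral _ idf)) => //.
  apply: (@le_trans _ _ (\int[mu]_x (G * (k x + k_ n x - 2 * m n x)))).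
    apply: le_Rintegral => //; first by have := integrable_norm idf.
    move=> x _; rewrite -mulrBl normrM mulrC ler_pM//.
    rewrite /m; case: (leP (k_ n x) (k x)) => h.
      by rewrite ger0_norm ?subr_ge0//; lra.
    by rewrite ltr0_norm ?subr_lt0//; lra.
  rewrite RintegralZl// RintegralB//.
  rewrite RintegralD// RintegralZl//.
  have -> : \int[mu]_x k x = 1 by rewrite /Rintegral k1.
  by have -> : \int[mu]_x k_ n x = 1 by rewrite /Rintegral k_1.
apply/cvgrPdist_le => e e0; near=> n; apply: (le_trans (bd n)).
have : `|1 - \int[mu]_x (m n x)| <= e / (2 * (`|G| + 1)).
  near: n; move/cvgrPdist_le : cm; apply; rewrite divr_gt0// mulr_gt0//.
have GG := ler_norm G; have G1 : 0 < 2 * (`|G| + 1) by rewrite mulr_gt0// ltr_wpDl.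
rewrite ler_pdivlMr// => h.
have h1 := ler_norm (1 - \int[mu]_x (m n x)).
have : G * (2 - 2 * \int[mu]_x (m n x)) <= `|1 - \int[mu]_x (m n x)| * (2 * (`|G| + 1)).
  have : G * (1 - \int[mu]_x (m n x)) <= (`|G| + 1) * `|1 - \int[mu]_x (m n x)|.
    apply: (le_trans (ler_norm _)); rewrite normrM ler_wpM2r//; lra.
  nra.
by move=> /le_trans; apply.
Unshelve. all: end_near. Qed.

End scheffe.

Section heat_convolution.
Context {R : realType} {d : nat}.
Local Notation V := 'rV[R]_d.

Lemma integral_reflect (H : V -> \bar R) (x : V) : measurable_fun setT H ->
  (\int[lebesgue_rV d]_y H (x - y)%R = \int[lebesgue_rV d]_y H y)%E.
Proof.
have pos (F : V -> \bar R) : measurable_fun setT F -> (forall y, 0 <= F y)%E ->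
    (\int[lebesgue_rV d]_y F (x - y)%R = \int[lebesgue_rV d]_y F y)%E.
  move=> mF F0; rewrite -[LHS](@ge0_integral_pushforward _ _ _ _ R
    _ (measurable_reflect x) (lebesgue_rV d) setT F)//.
  apply: eq_measure_integral => [|mr A mA _]; first exact: measurable_reflect.
  by rewrite /= /pushforward; exact: lebesgue_rV_reflect.
move=> mH; rewrite integralE [RHS]integralE.
rewrite -(pos _ (measurable_funepos mH))//.
rewrite -(pos _ (measurable_funeneg mH))//.
by congr (_ - _)%E; apply: eq_integral => y _; rewrite ?funeposE ?funenegE.
Qed.

Let cvg2 {T} (F : set_system T) {FF : Filter F} (s_ : T -> R) (y_ : T -> V) (s : R) (y : V) :
  s_ t @[t --> F] --> s -> y_ t @[t --> F] --> y -> (s_ t, y_ t) @[t --> F] --> (s, y).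
Proof. by move=> cs cy; exact: (cvg_pair cs cy). Qed.

Lemma continuous_reflect (f : V -> R) (x : V) :
  continuous f -> continuous (fun z : V => f (x - z)).
Proof.
move=> cf z; have h : (x - z') @[z' --> z] --> x - z.
  by apply: (@cvgB _ _ _ (nbhs z)); [exact: (cvg_cst x)|exact: cvg_id].
exact: (cvg_comp (fun z' : V => x - z') f h (cf (x - z))).
Qed.

Variables (alpha : R) (K : R -> V -> R).
Hypothesis hK : is_heat_kernel alpha K.

Lemma continuous_heat_kernel s : 0 < s -> continuous (K s).
Proof.
move=> s0 x; have h := @heat_kernel_continuous _ _ _ _ hK s x s0.
exact: (cvg_comp (fun y => (s, y)) (fun q => K q.1 q.2)
  (cvg2 (F := nbhs x) (cvg_cst s) cvg_id) h).
Qed.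

Lemma measurable_heat_kernel s : 0 < s -> measurable_fun setT (K s).
Proof. by move=> s0; apply: continuous_measurable_rV; exact: continuous_heat_kernel. Qed.

(** With [x] moved from the kernel to [f], bounds on differences of [f] pass to the convolution. *)
Lemma heat_convE (s : R) (f : V -> R) (x : V) : 0 < s -> continuous f ->
  heat_conv K s f x = \int[lebesgue_rV d]_z (K s z * f (x - z)).
Proof.
move=> s0 cf; rewrite /heat_conv gt_eqF// /Rintegral; congr fine.
have mf : measurable_fun setT (fun z : V => f (x - z)).
  exact: (measurableT_comp (continuous_measurable_rV cf) (measurable_reflect x)).
rewrite -(integral_reflect (H := fun z => (K s z * f (x - z))%:E) x).
  by apply: eq_integral => y _; rewrite subKr.
by apply/measurable_EFinP/measurable_funM => //; exact: measurable_heat_kernel.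
Qed.

Let mshift (f : V -> R) x : continuous f -> measurable_fun setT (fun z : V => f (x - z)).
Proof.
by move=> cf; exact: (measurableT_comp (continuous_measurable_rV cf) (measurable_reflect x)).
Qed.

Lemma heat_conv_le (s : R) (f : V -> R) (x : V) (G : R) : 0 <= s -> continuous f ->
  (forall y, `|f y| <= G) -> `|heat_conv K s f x| <= G.
Proof.
rewrite le_eqVlt => /predU1P[<-|s0] cf fG; first by rewrite /heat_conv eqxx.
rewrite heat_convE//; apply: density_Rintegral_le => //.
- exact: measurable_heat_kernel.
- by move=> z; exact: (heat_kernel_ge0 hK).
- exact: (heat_kernel_mass hK).
- exact: mshift.
Qed.

Lemma heat_conv_modulus (s : R) (f : V -> R) (x y : V) (G C : R) :
  0 <= s -> continuous f -> (forall y, `|f y| <= G) ->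
  (forall z, `|f (x - z) - f (y - z)| <= C) ->
  `|heat_conv K s f x - heat_conv K s f y| <= C.
Proof.
rewrite le_eqVlt => /predU1P[<-|s0] cf fG fC.
  by rewrite /heat_conv eqxx; have := fC 0; rewrite !subr0.
have mK := measurable_heat_kernel s0.
have K0 z : 0 <= K s z by exact: (heat_kernel_ge0 hK).
have K1 := heat_kernel_mass hK s0.
rewrite !heat_convE// -RintegralB//; last 2 first.
- exact: (density_bounded_integrable mK K0 K1 (mshift x cf) (fun z => fG _)).
- exact: (density_bounded_integrable mK K0 K1 (mshift y cf) (fun z => fG _)).
under eq_Rintegral do rewrite -mulrBr.
apply: density_Rintegral_le => //.
by apply: measurable_funB; exact: mshift.
Qed.

(** At [s = 0] this is the initial condition of the kernel, tested with the bounded continuous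
    function [f (x - z)] of [z]. At [s > 0] it is Scheffe's lemma, the kernel being continuous in
    time with mass 1. *)
Lemma heat_conv_cvg_right (s : R) (s_ : nat -> R) (f : V -> R) (x : V) (G : R) :
  0 <= s -> (forall n, s < s_ n) -> s_ n @[n --> \oo] --> s ->
  continuous f -> (forall y, `|f y| <= G) ->
  heat_conv K (s_ n) f x @[n --> \oo] --> heat_conv K s f x.
Proof.
move=> s0 ss_ cs cf fG; have s_0 n : 0 < s_ n by exact: le_lt_trans (ss_ n).
rewrite (_ : (fun n => _) = (fun n => \int[lebesgue_rV d]_z (K (s_ n) z * f (x - z))));
  last by apply/funext => n; rewrite heat_convE.
move: s0; rewrite le_eqVlt => /predU1P[s0|s0].
  rewrite (_ : heat_conv K s f x = f (x - 0)); last by rewrite -s0 /heat_conv eqxx subr0.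
  have cfx : continuous (fun z : V => f (x - z)).
    exact: continuous_reflect.
  have bfx : exists M : R, forall z, `|f (x - z)| <= M by exists G.
  have := heat_kernel_initial hK cfx bfx => /cvg_at_rightP; apply.
  by split=> [n|]; rewrite ?s_0// [X in _ --> X]s0.
rewrite heat_convE//; apply: (scheffe (G := G)) => //.
- exact: measurable_heat_kernel.
- by move=> z; exact: (heat_kernel_ge0 hK).
- exact: (heat_kernel_mass hK).
- by move=> n; exact: measurable_heat_kernel.
- by move=> n z; exact: (heat_kernel_ge0 hK).
- by move=> n; exact: (heat_kernel_mass hK).
- move=> z; have h := @heat_kernel_continuous _ _ _ _ hK s z s0.
  exact: (cvg_comp (fun n => (s_ n, z)) (fun q => K q.1 q.2) (cvg2 cs (cvg_cst z)) h).
- exact: mshift.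
Qed.

(** Setting the kernel to 0 at nonpositive times makes the integrand [I] measurable in [a] and
    continuous in [z], hence jointly measurable. Time 0, where the convolution is evaluation at [x],
    is treated apart. *)
Lemma measurable_heat_conv dA (A : measurableType dA) (D : set A) (s : A -> R)
    (b : A -> V -> R) (x : V) :
  measurable D -> (forall a, D a -> 0 <= s a) -> measurable_fun setT s ->
  (forall y, measurable_fun setT (b ^~ y)) -> (forall a, continuous (b a)) ->
  measurable_fun D (fun a => heat_conv K (s a) (b a) x).
Proof.
move=> mD s0 ms mb cb.
pose I (q : A * V) := (if 0 < s q.1 then K (s q.1) q.2 else 0) * b q.1 (x - q.2).
have mI : measurable_fun setT I.
  apply: (@measurable_caratheodory _ _ _ _ (fun a z =>
    (if 0 < s a then K (s a) z else 0) * b a (x - z))).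
    move=> z; apply: measurable_funM; last exact: mb.
    suff mKz : measurable_fun setT (fun r : R => if 0 < r then K r z else 0).
      exact: (measurableT_comp mKz ms).
    rewrite (_ : (fun r => _) = (K ^~ z) \_ `]0, +oo[%classic).
      apply/(measurable_restrictT _ (measurable_itv _)).
      apply: open_continuous_measurable_fun => //.
      move=> r /set_mem/=; rewrite in_itv/= andbT => r0.
      have h := @heat_kernel_continuous _ _ _ _ hK r z r0.
      exact: (cvg_comp (fun r => (r, z)) (fun q => K q.1 q.2)
        (cvg2 (F := nbhs r) cvg_id (cvg_cst z)) h).
    apply/funext => r; rewrite patchE; case: ifPn => r0.
      by rewrite mem_set//= in_itv/= andbT.
    by rewrite memNset//= in_itv/= andbT; exact/negP.
  move=> a z; apply: (@cvgM _ _ (nbhs z)); last exact: (continuous_reflect (cb a)).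
  case: (ltP 0 (s a)) => sa; first exact: (continuous_heat_kernel sa).
  exact: (cvg_cst (0 : R)).
have mRI : measurable_fun setT (fun a => \int[lebesgue_rV d]_z I (a, z)).
  apply: (measurableT_comp (@fine_measurable _ _ measurableT)).
  by apply: (@measurable_integral_section _ _ _ _ _ (lebesgue_rV d) (EFin \o I)); exact/measurable_EFinP.
apply: (@eq_measurable_fun _ _ _ _ D (fun a => if s a == 0 then b a x else
    \int[lebesgue_rV d]_z I (a, z))).
  move=> a /set_mem Da; case: ifPn => sa; first by rewrite /heat_conv sa.
  have sa0 : 0 < s a by rewrite lt0r sa s0.
  by rewrite heat_convE//; apply: eq_Rintegral => z _; rewrite /I/= sa0.
apply: measurable_funTS; apply: measurable_fun_ifT => //.
apply: measurable_fun_eqr => //; exact: measurable_cst.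
Qed.

End heat_convolution.

Lemma integral_xsection {R : realType} d1 d2 (T1 : measurableType d1)
    (T2 : measurableType d2) (mu : {measure set T2 -> \bar R}) (D : set T2)
    (f : T1 * T2 -> \bar R) (x : T1) :
  (\int[mu]_(y in D) f (x, y) = \int[mu]_y (f \_ (setT `*` D)) (x, y))%E.
Proof.
rewrite integral_mkcond; apply: eq_integral => y _; rewrite !patchE.
congr (if _ then _ else _).
by apply/idP/idP => [/set_mem yD|/set_mem [_ yD]]; exact: mem_set.
Qed.

(** * Integrals of convolutions over time and marks *)

Section convolution_integral.
Context {R : realType} {d : nat}.
Local Notation V := 'rV[R]_d.
Variables (alpha : R) (K : R -> V -> R).
Hypothesis hK : is_heat_kernel alpha K.
Variables (m : {measure set (R * V) -> \bar R}) (E : set V) (mE : measurable E).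
Variables (b : R * V -> V -> R) (G H : R * V -> R) (omega : R -> R).
Hypotheses (mb : forall y, measurable_fun setT (b ^~ y)).
Hypotheses (cb : forall z, continuous (b z)) (bG : forall z y, `|b z y| <= G z).
Hypothesis bH : forall z x y, `|b z x - b z y| <= omega (enorm (x - y)) * H z.
Hypotheses (G0 : forall z, 0 <= G z) (H0 : forall z, 0 <= H z).
Hypotheses (mG : measurable_fun setT G) (mH : measurable_fun setT H).

Local Notation S t := (`]0%R, t] `*` E).

Let mS (t : R) : measurable (S t). Proof. exact: measurableX. Qed.

Hypothesis finG : forall t : R, (\int[m]_(z in S t) (G z)%:E < +oo)%E.
Hypothesis finH : forall t : R, (\int[m]_(z in S t) (H z)%:E < +oo)%E.

Let iG (t : R) : m.-integrable (S t) (EFin \o G).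
Proof.
apply/integrableP; split; first by apply/measurable_EFinP/measurable_funTS.
by under eq_integral do rewrite /= ger0_norm//; exact: finG.
Qed.

Let iH (t : R) : m.-integrable (S t) (EFin \o H).
Proof.
apply/integrableP; split; first by apply/measurable_EFinP/measurable_funTS.
by under eq_integral do rewrite /= ger0_norm//; exact: finH.
Qed.

Let St (t : R) (z : R * V) : S t z -> 0 <= t - z.1.
Proof. by move=> [/=]; rewrite in_itv/= subr_ge0 => /andP[]. Qed.

Lemma measurable_heat_section (t : R) (x : V) :
  measurable_fun (S t) (fun z => heat_conv K (t - z.1) (b z) x).
Proof.
apply: (measurable_heat_conv hK (b := b) x (mS t) (@St t)) => //.
by apply: measurable_funB; [exact: measurable_cst|exact: measurable_fst].
Qed.

Lemma integrable_heat_section (t : R) (x : V) :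
  m.-integrable (S t) (EFin \o (fun z => heat_conv K (t - z.1) (b z) x)).
Proof.
apply: (le_integrable (mS t) _ _ (iG t)).
  by apply/measurable_EFinP; exact: measurable_heat_section.
move=> z /St z0; rewrite lee_fin [leRHS]ger0_norm//.
exact: (heat_conv_le hK x z0 (@cb z) (@bG z)).
Qed.

Definition conv_integral (t : R) (x : V) := \int[m]_(z in S t) heat_conv K (t - z.1) (b z) x.

Lemma conv_integral_modulus (t : R) (x y : V) :
  `|conv_integral t x - conv_integral t y| <=
  omega (enorm (x - y)) * fine (\int[m]_(z in S t) (H z)%:E).
Proof.
rewrite /conv_integral -RintegralB//; [|exact: integrable_heat_section|exact: integrable_heat_section].
have id : m.-integrable (S t) (EFin \o (fun z =>
    heat_conv K (t - z.1) (b z) x - heat_conv K (t - z.1) (b z) y)).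
  exact: (integrableB (mS t) (integrable_heat_section t x) (integrable_heat_section t y)).
have iw : m.-integrable (S t) (EFin \o (fun z => omega (enorm (x - y)) * H z)).
  exact: (integrableZl (mS t) _ (iH t)).
apply: (le_trans (le_normr_Rintegral (mS t) id)).
apply: (@le_trans _ _ (\int[m]_(z in S t) (omega (enorm (x - y)) * H z))).
  apply: le_Rintegral => //; first by have := integrable_norm id.
  move=> z /St z0; apply: (heat_conv_modulus hK z0 (@cb z) (@bG z)) => z'.
  rewrite (_ : x - y = (x - z') - (y - z')) ?bH//.
  by rewrite opprB addrA subrK.
by rewrite RintegralZl.
Qed.

(** All integrals are taken over the fixed strip up to [t + 1], where [G] dominates. A point with
    time at most [t] stays in every strip [S (t_ n)], and a later one eventually leaves. From the
    left, a point at time exactly [t] would be missed. *)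
Lemma conv_integral_cvg_right (t : R) (t_ : nat -> R) x : 0 <= t ->
  (forall n, t < t_ n <= t + 1) -> t_ n @[n --> \oo] --> t ->
  conv_integral (t_ n) x @[n --> \oo] --> conv_integral t x.
Proof.
move=> t0 tt ct.
have restr s : s <= t + 1 -> conv_integral s x = \int[m]_(z in S (t + 1))
    ((fun z => heat_conv K (s - z.1) (b z) x) \_ (S s)) z.
  move=> st; rewrite /conv_integral Rintegral_mkcond [RHS]Rintegral_mkcond.
  apply: eq_Rintegral => z _; rewrite !patchE; case: ifPn => [/set_mem [/= + Ez]|_].
    rewrite in_itv/= => /andP[z0 zs]; rewrite mem_set//=; split => //=.
    by rewrite in_itv/= z0 (le_trans zs).
  by case: ifP.
have mrestr s : measurable_fun (S (t + 1))
    ((fun z => heat_conv K (s - z.1) (b z) x) \_ (S s)).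
  apply: measurable_funTS; apply/(measurable_restrictT _ (mS s)).
  exact: measurable_heat_section.
rewrite (restr t) ?lerDl//.
rewrite (_ : (fun n => conv_integral (t_ n) x) = (fun n => \int[m]_(z in S (t + 1))
    ((fun z => heat_conv K (t_ n - z.1) (b z) x) \_ (S (t_ n))) z)); last first.
  by apply/funext => n; apply: restr; have /andP[] := tt n.
apply: (Rintegral_dominated_cvg (g := G)) => //.
  move=> z Sz; rewrite patchE; case: ifPn => [/set_mem|].
    move=> [/=]; rewrite in_itv/= => /andP[z0 zt] Ez.
    rewrite (_ : (fun n => _) = (fun n => heat_conv K (t_ n - z.1) (b z) x)); last first.
      apply/funext => n; rewrite patchE mem_set//; split => //=.
      by rewrite in_itv/= z0 (le_trans zt)// ltW//; have /andP[] := tt n.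
    apply: (heat_conv_cvg_right hK (G := G z)) => //; first by rewrite subr_ge0.
    - by move=> n; rewrite ltrD2r; have /andP[] := tt n.
    - by apply: cvgB => //; exact: cvg_cst.
  move=> zS; have zt : t < z.1.
    rewrite ltNge; apply/negP => zt; move/negP : zS; apply; apply: mem_set.
    case: Sz => /=; rewrite in_itv/= => /andP[z0 _] Ez.
    by split => //=; rewrite in_itv/= z0.
  apply: cvg_near_cst.
  have : \forall n \near \oo, t_ n < z.1 by exact: (cvgr_lt _ ct).
  apply: filterS => n tn; rewrite patchE memNset// => -[/=].
  by rewrite in_itv/= => /andP[_]; rewrite leNgt tn.
move=> n z Sz; rewrite patchE; case: ifPn => [/set_mem/St z0|_]; last by rewrite normr0.
exact: (heat_conv_le hK x z0 (@cb z) (@bG z)).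
Qed.

End convolution_integral.

(** * Measurability of the supremum over times and points *)

Section sup_modulus_measurable.
Context {R : realType} {d : nat} {dO : measure_display} {Omega : measurableType dO}.
Local Notation V := 'rV[R]_d.
Variables (phi : R -> R) (p beta T c1 : R) (ut : R -> V -> Omega -> R).
Hypotheses (p0 : 0 < p) (beta0 : 0 < beta).
Hypothesis phi_gt0 : forall r : R, 0 < r -> 0 < phi r.
Hypothesis phi0 : phi 0 = 0.
Hypothesis cphi : forall r : R, 0 < r -> {for r, continuous phi}.
Hypothesis mut : forall t x, 0 <= t -> measurable_fun setT (ut t x).
Hypothesis cut : forall w t, 0 <= t -> continuous (fun x => ut t x w).
Hypothesis rut : forall w t (t_ : nat -> R) x, 0 <= t ->
  (forall n, t < t_ n <= t + 1) -> t_ n @[n --> \oo] --> t ->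
  ut (t_ n) x w @[n --> \oo] --> ut t x w.

Let ratio w t (x y : V) := `|ut t x w - ut t y w| `^ p / phi (enorm (x - y)) `^ (beta * p).

Let phi_ge0 r : 0 <= r -> 0 <= phi r.
Proof. by rewrite le_eqVlt => /predU1P[<-|/phi_gt0/ltW//]; rewrite phi0. Qed.

Let lim_le (u : nat -> R) (l : R) (S : \bar R) : u n @[n --> \oo] --> l ->
  (\forall n \near \oo, ((u n)%:E <= S)%E) -> (l%:E <= S)%E.
Proof.
move=> ul uS; have h : (u n)%:E @[n --> \oo] --> l%:E.
  by apply: cvg_EFin => //; near=> n.
rewrite -(cvg_lim _ h)//; apply: lime_le => //; apply/cvg_ex; exists l%:E; exact: h.
Unshelve. all: end_near. Qed.

Let cvg_ratio_space w t x y : 0 <= t -> x <> y ->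
  ratio w t (round_point n x) (round_point n y) @[n --> \oo] --> ratio w t x y.
Proof.
move=> t0 xy.
have cx : round_point n x @[n --> \oo] --> x by exact: cvg_round_point.
have cy : round_point n y @[n --> \oo] --> y by exact: cvg_round_point.
have e0 : 0 < enorm (x - y) by apply: enorm_gt0; rewrite subr_eq0; exact/eqP.
have ce : enorm (round_point n x - round_point n y) @[n --> \oo] --> enorm (x - y).
  exact: (cvg_comp (fun n => round_point n x - round_point n y) _ (cvgB cx cy)
    (@continuous_enorm R d (x - y))).
rewrite /ratio; apply: cvgM.
  apply: cvg_powR => //; apply: cvg_norm; apply: cvgB.
    exact: (cvg_comp (fun n => round_point n x) (fun x => ut t x w) cx (@cut w t t0 x)).
  exact: (cvg_comp (fun n => round_point n y) (fun x => ut t x w) cy (@cut w t t0 y)).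
apply: cvgV; first by rewrite gt_eqF// powR_gt0// phi_gt0.
apply: cvg_powR; first exact: mulr_gt0.
- by move=> n; apply: phi_ge0; exact: enorm_ge0.
- by apply: phi_ge0; exact: enorm_ge0.
- exact: (cvg_comp _ phi ce (cphi e0)).
Qed.

Let cvg_ratio_time w t (t_ : nat -> R) x y : 0 <= t ->
  (forall n, t < t_ n <= t + 1) -> t_ n @[n --> \oo] --> t ->
  ratio w (t_ n) x y @[n --> \oo] --> ratio w t x y.
Proof.
move=> t0 tt ct; rewrite /ratio; apply: cvgM; last exact: cvg_cst.
by apply: cvg_powR => //; apply: cvg_norm; apply: cvgB; exact: rut.
Qed.

(** Index 0 is reserved for [T], which cannot be approached from the right inside [[0, T]]; the
    other indices enumerate the rational times. *)
Let time k : R := if k is k'.+1 then (if unpickle k' is Some q then ratr (q : rat) else 0) else T.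

Let good (q : nat * nat * nat) := [&& 0 <= time q.1.1 <= T,
  enorm (rat_point q.1.2 : V) < c1, enorm (rat_point q.2 : V) < c1 &
  rat_point q.1.2 != rat_point q.2 :> V].

(** Indices coding no admissible triple get the value [-oo], neutral for the supremum. *)
Let F k w : \bar R := if unpickle k is Some q then
  (if good q then (ratio w (time q.1.1) (rat_point q.1.2) (rat_point q.2))%:E else -oo%E)
  else -oo%E.

Let mF k : measurable_fun setT (F k).
Proof.
rewrite /F; case: (unpickle k) => [q|]; last exact: measurable_cst.
case: (boolP (good q)) => [/and4P[/andP[t0 _] _ _ _]|_]; last exact: measurable_cst.
apply/measurable_EFinP; apply: measurable_funM; last exact: measurable_cst.
apply: (measurableT_comp (measurable_powR _)); apply: measurableT_comp => //.
by apply: measurable_funB; exact: mut.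
Qed.

Let F_le w t x y S : (forall k, (F k w <= S)%E) -> 0 <= t -> t <= T ->
  (exists k, t = time k) -> enorm x < c1 -> enorm y < c1 -> x <> y ->
  ((ratio w t x y)%:E <= S)%E.
Proof.
move=> FS t0 tT [k tk] xc yc xy.
have cx : round_point n x @[n --> \oo] --> x by exact: cvg_round_point.
have cy : round_point n y @[n --> \oo] --> y by exact: cvg_round_point.
have cex := cvg_comp (fun n => round_point n x) _ cx (@continuous_enorm R d x).
have cey := cvg_comp (fun n => round_point n y) _ cy (@continuous_enorm R d y).
have cexy : enorm (round_point n x - round_point n y) @[n --> \oo] --> enorm (x - y).
  exact: (cvg_comp (fun n => round_point n x - round_point n y) _ (cvgB cx cy)
    (@continuous_enorm R d (x - y))).
have e0 : 0 < enorm (x - y) by apply: enorm_gt0; rewrite subr_eq0; exact/eqP.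
apply: (lim_le (@cvg_ratio_space w t x y t0 xy)).
have h1 : \forall n \near \oo, enorm (round_point n x) < c1 by exact: (cvgr_lt _ cex).
have h2 : \forall n \near \oo, enorm (round_point n y) < c1 by exact: (cvgr_lt _ cey).
have h3 : \forall n \near \oo, 0 < enorm (round_point n x - round_point n y).
  exact: (cvgr_gt _ cexy).
apply: filterS3 h1 h2 h3 => n nx ny nxy.
have := FS (pickle (k, round_index n x, round_index n y)).
rewrite /F pickleK /good/= -tk t0 tT/= -!/(round_point n _) nx ny.
suff -> : round_point n x != round_point n y by [].
by apply: contraTneq nxy => ->; rewrite subrr enorm0 ltxx.
Qed.

(** A quotient at a time [t < T] is a limit of quotients at rational times decreasing to it, and
    each of these is a limit of quotients at rounded points. The strict conditions on the points
    hold eventually after rounding. *)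
Let sup_modulusE w : sup_modulus phi p beta T c1 ut w = esups (F ^~ w) 0%N.
Proof.
apply/eqP; rewrite eq_le; apply/andP; split.
  have FS k : (F k w <= esups (F ^~ w) 0%N)%E by apply: ereal_sup_ubound; exists k.
  apply: ge_ereal_sup => s [t /= + <-]; rewrite in_itv/= => /andP[t0 tT].
  apply: ge_ereal_sup => _ [[x y] [/= xc yc xy] <-].
  move: (tT); rewrite le_eqVlt => /predU1P[tTe|ltT].
    by apply: (F_le FS t0 tT) => //; exists 0%N.
  have /choice[q qP] (n : nat) : exists q : rat,
      t < ratr q < Num.min (t + n.+1%:R^-1) T.
    have : t < Num.min (t + n.+1%:R^-1) T by rewrite lt_min ltT ltrDl invr_gt0 ltr0n.
    by move=> /rat_in_itvoo[q]; rewrite in_itv/= => ?; exists q.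
  have ct : ratr (q n) @[n --> \oo] --> t.
    apply/cvgrPdist_lt => e e0; near=> n.
    have /andP[q1] := qP n; rewrite lt_min => /andP[q2 _].
    rewrite ltr0_norm ?subr_lt0// opprB ltrBlDl; apply: (lt_trans q2).
    by rewrite ltrD2l; near: n; exact: near_infty_natSinv_lt (PosNum e0).
  apply: (lim_le (@cvg_ratio_time w t (fun n => ratr (q n)) x y t0 _ ct)).
    move=> n; have /andP[-> ] := qP n; rewrite lt_min => /andP[q2 _] /=.
    by rewrite (le_trans (ltW q2))// lerD2l invf_le1 ?ltr0n// ler1n.
  near=> n; have /andP[q1] := qP n; rewrite lt_min => /andP[_ q2].
  apply: (F_le FS) => //; [exact: le_trans (ltW q1)|exact: ltW|].
  by exists (pickle (q n)).+1; rewrite /= pickleK.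
apply: ge_ereal_sup => _ [k _ <-]; rewrite /F.
case: (unpickle k) => [q|]; last exact: leNye.
case: ifPn => [/and4P[/andP[t0 tT] xc yc /eqP xy]|_]; last exact: leNye.
apply: (@le_trans _ _ (ereal_sup [set (ratio w (time q.1.1) q'.1 q'.2)%:E
    | q' in [set q' : V * V | [/\ eball c1 q'.1, eball c1 q'.2 & q'.1 <> q'.2]]])).
  by apply: ereal_sup_ubound; exists (rat_point q.1.2, rat_point q.2).
by apply: ereal_sup_ubound; exists (time q.1.1) => //=; rewrite in_itv/= t0.
Unshelve. all: end_near. Qed.

Lemma measurable_sup_modulus : measurable_fun setT (sup_modulus phi p beta T c1 ut).
Proof.
rewrite (_ : sup_modulus _ _ _ _ _ _ = (fun w => esups (F ^~ w) 0%N)); last first.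
  by apply/funext => w; exact: sup_modulusE.
by apply: measurable_fun_esups => n; exact: mF.
Qed.

End sup_modulus_measurable.

(** * Continuous versions *)

(** The norm of [g] bounds it almost everywhere only; continuity turns this into a bound at every
    point for a function equal to [g] almost everywhere. *)
Lemma ess_sup_ge_continuous {R : realType} (d : nat) (f : 'rV[R]_d -> R)
    (g : 'rV[R]_d -> R) (Z : set 'rV[R]_d) :
  continuous f -> measurable Z -> lebesgue_rV d Z = 0%E ->
  (forall y, ~ Z y -> f y = g y) ->
  forall y, (`|f y|%:E <= 'N[lebesgue_rV d]_+oo[EFin \o g])%E.
Proof.
move=> cf mZ Z0 fg.
have posT : (0 < lebesgue_rV d [set: 'rV[R]_d])%E.
  apply: (lt_le_trans (lebesgue_rV_box (0 : 'rV[R]_d) ltr01)).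
  by apply: le_measure; rewrite ?inE//; exact: measurable_box.
(* The norm of order [+oo] is the essential supremum only when the whole space has positive
   measure. *)
rewrite unlock posT.
have [Z' [mZ' Z'0 hZ']] := null_of_ae (ess_sup_inf.ess_sup_ge (lebesgue_rV d)
  (abse \o (EFin \o g))).
apply: (le_continuous_ae (Z := Z `|` Z')).
- by move=> y; exact: (cvg_norm (cf y)).
- exact: measurableU.
- exact: measureU_eq0.
- by move=> y nZ; rewrite fg => [|Zy]; [apply: hZ' => Zy|]; apply: nZ; [right|left].
Qed.

Lemma continuous_of_modulus {R : realType} {d : nat} (omega : R -> R)
    (f : 'rV[R]_d -> R) (L : R) : omega 0 = 0 -> (forall r, 0 < r -> 0 < omega r) ->
  (forall e, 0 < e -> exists2 r, 0 < r & forall s, 0 < s -> s < r -> omega s < e) ->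
  0 <= L -> (forall x y, `|f x - f y| <= omega (enorm (x - y)) * L) -> continuous f.
Proof.
move=> omega0 omega_gt0 omega_small L0 hf.
suff h y : f x @[x --> y] --> f y by exact: h.
apply: ((@cvgrPdist_lt _ _ _ (nbhs y) _ f (f y)).2) => e e0.
have e1 : 0 < e / (L + 1) by rewrite divr_gt0// ltr_wpDl.
have [r r0 hr] := omega_small _ e1.
have yy : y - x @[x --> y] --> y - y.
  by apply: (@cvgB _ _ _ (nbhs y)); [exact: (cvg_cst y)|exact: cvg_id].
have ny : enorm (y - x) @[x --> y] --> (0 : R).
  rewrite -(@enorm0 R d) -(subrr y).
  exact: (cvg_comp (fun x => y - x) _ yy (@continuous_enorm R d (y - y))).
have := (@cvgrPdist_lt _ _ _ (nbhs y) _ (fun x => enorm (y - x)) 0).1 ny r r0.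
move=> /(_ (nbhs_filter y)); apply: (@filterS _ (nbhs y)) => x.
rewrite sub0r normrN ger0_norm ?enorm_ge0// => hd.
apply: (le_lt_trans (hf y x)).
have [e00|e00] := eqVneq (enorm (y - x)) 0; first by rewrite e00 omega0 mul0r.
have n0 : 0 < enorm (y - x) by rewrite lt0r e00 enorm_ge0.
have := hr _ n0 hd; rewrite ltr_pdivlMr ?ltr_wpDl//.
by apply: le_lt_trans; rewrite ler_wpM2l ?lerDl// ltW// omega_gt0.
Qed.

(** * Extension from the rational points *)

Section rational_extension.
Context {R : realType} {d : nat} {dZ : measure_display} {Z : measurableType dZ}.
Local Notation V := 'rV[R]_d.
Variables (f : Z -> V -> R) (omega : R -> R).
Hypothesis mf : forall y, measurable_fun setT (f ^~ y).
Hypotheses (omega0 : omega 0 = 0) (omega_gt0 : forall r, 0 < r -> 0 < omega r).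
Hypothesis comega : forall r, 0 < r -> {for r, continuous omega}.
Hypothesis omega_small : forall e, 0 < e ->
  exists2 r, 0 < r & forall s, 0 < s -> s < r -> omega s < e.

(** The best constant in the modulus [omega] over pairs of rational points. As a countable supremum
    it is measurable for the same sigma-algebra as [f]. A pair of equal points contributes [0 / 0],
    which is 0. *)
Definition oscillation (z : Z) : \bar R := esups (fun k =>
  if (unpickle k : option (nat * nat)) is Some ij then
    (`|f z (rat_point ij.1) - f z (rat_point ij.2)|
     / omega (enorm (rat_point ij.1 - rat_point ij.2 : V)))%:E
  else 0%E) 0%N.

Let A : set Z := [set z | (oscillation z < +oo)%E].

(** The indicator makes the sequence converge for every [z]: it is constantly 0 where the
    oscillation is infinite. *)
Definition extension (z : Z) (y : V) : R :=
  lim ((fun n => \1_A z * f z (round_point n y)) @ \oo).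

Definition extension_bound (z : Z) : \bar R :=
  esups (fun k => `|extension z (rat_point k)|%:E) 0%N.

Let omega_ge0 r : 0 <= r -> 0 <= omega r.
Proof. by rewrite le_eqVlt => /predU1P[<-|/omega_gt0/ltW//]; rewrite omega0. Qed.

Lemma oscillation_ge0 z : (0 <= oscillation z)%E.
Proof.
apply: (@le_trans _ _ ((`|f z (rat_point 0) - f z (rat_point 0)|
     / omega (enorm (rat_point 0 - rat_point 0 : V)))%:E)).
  by rewrite lee_fin divr_ge0// omega_ge0// enorm_ge0.
by apply: ereal_sup_ubound; exists (pickle (0%N, 0%N)) => //; rewrite pickleK.
Qed.

Lemma measurable_oscillation : measurable_fun setT oscillation.
Proof.
apply: measurable_fun_esups => k; case: (unpickle k) => [ij|]; last exact: measurable_cst.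
apply/measurable_EFinP; apply: measurable_funM; last exact: measurable_cst.
by apply: measurableT_comp => //; exact: measurable_funB.
Qed.

Let mA : measurable A.
Proof.
have := emeasurable_fun_infty_o measurableT measurable_oscillation +oo%E.
by rewrite setTI.
Qed.

Lemma oscillation_le z (h : R) : 0 <= h ->
  (forall i j, `|f z (rat_point i) - f z (rat_point j)| <=
     omega (enorm (rat_point i - rat_point j : V)) * h) ->
  (oscillation z <= h%:E)%E.
Proof.
move=> h0 hf; apply: ge_ereal_sup => _ [k _ <-].
case: (unpickle k) => [[i j]|]; last by rewrite lee_fin.
rewrite lee_fin/=; have [e0|e0] := eqVneq (enorm (rat_point i - rat_point j : V)) 0.
  by rewrite e0 omega0 invr0 mulr0.
by rewrite ler_pdivrMr ?omega_gt0 ?lt0r ?e0 ?enorm_ge0// mulrC.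
Qed.

Lemma le_oscillation z i j : (oscillation z < +oo)%E ->
  `|f z (rat_point i) - f z (rat_point j)| <=
  omega (enorm (rat_point i - rat_point j : V)) * fine (oscillation z).
Proof.
move=> oz; have [e0|e0] := eqVneq (enorm (rat_point i - rat_point j : V)) 0.
  by rewrite e0 omega0 mul0r (subr0_eq (enorm_eq0 e0)) subrr normr0.
rewrite mulrC -ler_pdivrMr ?omega_gt0 ?lt0r ?e0 ?enorm_ge0//.
rewrite -lee_fin fineK ?ge0_fin_numE ?oscillation_ge0//.
by apply: ereal_sup_ubound; exists (pickle (i, j)) => //; rewrite pickleK.
Qed.

(** The rounded points get arbitrarily close to one another, so the values form a Cauchy sequence
    because [omega] is small near 0. *)
Let cvg_extension0 z y : (oscillation z < +oo)%E -> cvgn (fun n => f z (round_point n y)).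
Proof.
move=> oz; set H := fine (oscillation z).
have H0 : 0 <= H by rewrite fine_ge0// oscillation_ge0.
apply/cauchy_cvgP; apply: cauchy_exP => e e0.
have e1 : 0 < e / (H + 1) by rewrite divr_gt0// ltr_wpDl.
have [r r0 hr] := omega_small e1.
have cy : round_point n y @[n --> \oo] --> y by exact: cvg_round_point.
have c1 : round_point q.1 y @[q --> (\oo, \oo)] --> y.
  exact: (cvg_comp (fun q : nat * nat => q.1) (fun n => round_point n y) cvg_fst cy).
have c2 : round_point q.2 y @[q --> (\oo, \oo)] --> y.
  exact: (cvg_comp (fun q : nat * nat => q.2) (fun n => round_point n y) cvg_snd cy).
have : enorm (round_point q.1 y - round_point q.2 y) @[q --> (\oo, \oo)] --> (0 : R).
  rewrite -(@enorm0 R d) -(subrr y).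
  exact: (cvg_comp (fun q : nat * nat => round_point q.1 y - round_point q.2 y) _
    (cvgB c1 c2) (@continuous_enorm R d (y - y))).
move=> /cvgrPdist_lt/(_ r r0)[[B1 B2] /= [[N1 _ hB1] [N2 _ hB2]] hB].
exists (f z (round_point (maxn N1 N2) y)).
exists (maxn N1 N2) => // n /= hn; rewrite /ball/=.
have hd : enorm (round_point (maxn N1 N2) y - round_point n y) < r.
  have := hB (maxn N1 N2, n); rewrite /= sub0r normrN ger0_norm ?enorm_ge0//; apply.
  split; [apply: hB1|apply: hB2] => /=; rewrite ?leq_maxl//.
  by apply: leq_trans hn; rewrite leq_maxr.
apply: (le_lt_trans (le_oscillation (round_index _ y) (round_index n y) oz)).
rewrite -!/(round_point _ _) -/H.
have [e00|e00] := eqVneq (enorm (round_point (maxn N1 N2) y - round_point n y)) 0.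
  by rewrite e00 omega0 mul0r.
have := hr _ _ hd; rewrite lt0r e00 enorm_ge0/= ltr_pdivlMr ?ltr_wpDl// => /(_ isT).
by apply: le_lt_trans; rewrite ler_wpM2l ?lerDl// omega_ge0// enorm_ge0.
Qed.

Let indA z : (\1_A z : R) = ((oscillation z < +oo)%E)%:R.
Proof.
rewrite indicE; congr (_%:R); congr nat_of_bool.
by apply/idP/idP => [/set_mem//|h]; exact: mem_set.
Qed.

Lemma cvg_extension z y :
  \1_A z * f z (round_point n y) @[n --> \oo] --> extension z y.
Proof.
rewrite /extension; have [oz|oz] := boolP (oscillation z < +oo)%E; last first.
  suff : cvgn (fun n => \1_A z * f z (round_point n y)) by [].
  rewrite indA (negbTE oz); under eq_fun do rewrite mul0r; exact: is_cvg_cst.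
suff : cvgn (fun n => \1_A z * f z (round_point n y)) by [].
apply: is_cvgMr; exact: cvg_extension0.
Qed.

Lemma extension_out z y : ~ (oscillation z < +oo)%E -> extension z y = 0.
Proof.
move=> /negP oz; rewrite /extension indA (negbTE oz); under eq_fun do rewrite mul0r.
exact: lim_cst.
Qed.

Lemma extension_modulus z x y : (oscillation z < +oo)%E ->
  `|extension z x - extension z y| <= omega (enorm (x - y)) * fine (oscillation z).
Proof.
move=> oz; have [->|xy] := eqVneq x y; first by rewrite !subrr normr0 enorm0 omega0 mul0r.
have e0 : 0 < enorm (x - y) by apply: enorm_gt0; rewrite subr_eq0.
have cx : round_point n x @[n --> \oo] --> x by exact: cvg_round_point.
have cy : round_point n y @[n --> \oo] --> y by exact: cvg_round_point.
have ce : enorm (round_point n x - round_point n y) @[n --> \oo] --> enorm (x - y).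
  exact: (cvg_comp (fun n => round_point n x - round_point n y) _ (cvgB cx cy)
    (@continuous_enorm R d (x - y))).
have h1 : `|\1_A z * f z (round_point n x) - \1_A z * f z (round_point n y)|
    @[n --> \oo] --> `|extension z x - extension z y|.
  exact: (cvg_norm (cvgB (@cvg_extension z x) (@cvg_extension z y))).
have h2 : omega (enorm (round_point n x - round_point n y)) * fine (oscillation z)
    @[n --> \oo] --> omega (enorm (x - y)) * fine (oscillation z).
  by apply: cvgMl; exact: (cvg_comp _ omega ce (comega e0)).
apply: (ler_cvg_to h1 h2); apply: nearW => n /=.
by rewrite indA oz !mul1r; exact: le_oscillation.
Qed.

Lemma continuous_extension z : continuous (extension z).
Proof.
have [oz|oz] := pselect (oscillation z < +oo)%E; last first.
  rewrite (_ : extension z = cst 0); first exact: cst_continuous.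
  by apply/funext => x; rewrite extension_out.
apply: (continuous_of_modulus omega0 omega_gt0 omega_small (L := fine (oscillation z))).
  by rewrite fine_ge0// oscillation_ge0.
by move=> x y; exact: extension_modulus.
Qed.

Lemma measurable_extension y : measurable_fun setT (extension ^~ y).
Proof.
apply: (measurable_fun_cvg (h := fun n z => \1_A z * f z (round_point n y))).
  by move=> n; apply: measurable_funM; [exact: measurable_indic|exact: mf].
by move=> z _; exact: cvg_extension.
Qed.

Lemma extension_bound_ge0 z : (0 <= extension_bound z)%E.
Proof.
apply: (@le_trans _ _ `|extension z (rat_point 0)|%:E); first by rewrite lee_fin.
by apply: ereal_sup_ubound; exists 0%N.
Qed.

Lemma measurable_extension_bound : measurable_fun setT extension_bound.
Proof.
apply: measurable_fun_esups => k; apply/measurable_EFinP.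
by apply: measurableT_comp => //; exact: measurable_extension.
Qed.

Lemma extension_bound_le z (M : \bar R) :
  (forall y, `|extension z y|%:E <= M)%E -> (extension_bound z <= M)%E.
Proof. by move=> hM; apply: ge_ereal_sup => _ [k _ <-]; exact: hM. Qed.

Lemma le_extension_bound z y : (extension_bound z < +oo)%E ->
  `|extension z y| <= fine (extension_bound z).
Proof.
move=> bz; have cy : round_point n y @[n --> \oo] --> y by exact: cvg_round_point.
have h : `|extension z (round_point n y)| @[n --> \oo] --> `|extension z y|.
  exact: (cvg_norm (cvg_comp (fun n => round_point n y) (extension z) cy
    (@continuous_extension z y))).
apply: (ler_cvg_to h (cvg_cst _)); apply: nearW => n /=.
rewrite -lee_fin fineK ?ge0_fin_numE ?extension_bound_ge0//.
by apply: ereal_sup_ubound; exists (round_index n y).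
Qed.

(** Only the pairs formed by [y] and a rational point enter. They are countably many, so for a fixed
    [y] the premise can be met off one null set. *)
Lemma extensionE z y (h : R) : (oscillation z < +oo)%E ->
  (forall k, `|f z y - f z (rat_point k)| <= omega (enorm (y - rat_point k)) * h) ->
  extension z y = f z y.
Proof.
move=> oz hy; apply/cvg_lim => //.
under eq_fun do rewrite indA oz mul1r.
have h0 : 0 < `|h| + 1 by rewrite ltr_wpDl.
apply/cvgrPdist_lt => e e0.
have e1 : 0 < e / (`|h| + 1) by rewrite divr_gt0.
have [r r0 hr] := omega_small e1.
have cy : round_point n y @[n --> \oo] --> y by exact: cvg_round_point.
have : enorm (y - round_point n y) @[n --> \oo] --> (0 : R).
  rewrite -(@enorm0 R d) -(subrr y).
  exact: (cvg_comp (fun n => y - round_point n y) _ (cvgB (cvg_cst y) cy)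
    (@continuous_enorm R d (y - y))).
move=> /cvgrPdist_lt/(_ r r0); apply: filterS => n.
rewrite sub0r normrN ger0_norm ?enorm_ge0// => hd.
apply: (le_lt_trans (hy _)); rewrite -/(round_point n y).
have [e00|e00] := eqVneq (enorm (y - round_point n y)) 0; first by rewrite e00 omega0 mul0r.
have := hr _ _ hd; rewrite lt0r e00 enorm_ge0/= ltr_pdivlMr// => /(_ isT).
apply: le_lt_trans; rewrite ler_wpM2l ?omega_ge0 ?enorm_ge0//.
by rewrite (le_trans (ler_norm _))// lerDl.
Qed.

Let Gd : set Z := [set z | (oscillation z < +oo)%E /\ (extension_bound z < +oo)%E].

Let mGd : measurable Gd.
Proof.
rewrite (_ : Gd = A `&` [set z | (extension_bound z < +oo)%E])//.
apply: measurableI => //.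
have := emeasurable_fun_infty_o measurableT measurable_extension_bound +oo%E.
by rewrite setTI.
Qed.

(** The value 0 where the modulus constant or the bound is infinite makes continuity, the modulus
    and the bound hold for every [z] with real constants. *)
Definition smooth_version (z : Z) (y : V) : R := \1_Gd z * extension z y.
Definition version_modulus (z : Z) : R := \1_Gd z * fine (oscillation z).
Definition version_bound (z : Z) : R := \1_Gd z * fine (extension_bound z).

Lemma version_modulus_ge0 z : 0 <= version_modulus z.
Proof. by rewrite mulr_ge0// fine_ge0// oscillation_ge0. Qed.

Lemma version_bound_ge0 z : 0 <= version_bound z.
Proof. by rewrite mulr_ge0// fine_ge0// extension_bound_ge0. Qed.

Lemma version_modulus_le z : ((version_modulus z)%:E <= oscillation z)%E.
Proof.
rewrite /version_modulus indicE; have [/set_mem[oz _]|_] := boolP (z \in Gd).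
  by rewrite mul1r fineK// ge0_fin_numE ?oscillation_ge0.
by rewrite mul0r oscillation_ge0.
Qed.

Lemma version_bound_le z : ((version_bound z)%:E <= extension_bound z)%E.
Proof.
rewrite /version_bound indicE; have [/set_mem[_ oz]|_] := boolP (z \in Gd).
  by rewrite mul1r fineK// ge0_fin_numE ?extension_bound_ge0.
by rewrite mul0r extension_bound_ge0.
Qed.

Lemma measurable_version_modulus : measurable_fun setT version_modulus.
Proof.
apply: measurable_funM; first exact: measurable_indic.
by apply: (measurableT_comp (@fine_measurable _ _ measurableT)); exact: measurable_oscillation.
Qed.

Lemma measurable_version_bound : measurable_fun setT version_bound.
Proof.
apply: measurable_funM; first exact: measurable_indic.
by apply: (measurableT_comp (@fine_measurable _ _ measurableT)); exact: measurable_extension_bound.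
Qed.

Lemma measurable_smooth_version y : measurable_fun setT (smooth_version ^~ y).
Proof. by apply: measurable_funM; [exact: measurable_indic|exact: measurable_extension]. Qed.

Lemma continuous_smooth_version z : continuous (smooth_version z).
Proof. by move=> y; apply: (@cvgMr _ _ (nbhs y)); exact: (@continuous_extension z y). Qed.

Lemma smooth_version_le z y : `|smooth_version z y| <= version_bound z.
Proof.
rewrite /smooth_version /version_bound indicE; have [/set_mem[_ oz]|_] := boolP (z \in Gd).
  by rewrite !mul1r; exact: le_extension_bound.
by rewrite !mul0r normr0.
Qed.

Lemma smooth_version_modulus z x y :
  `|smooth_version z x - smooth_version z y| <= omega (enorm (x - y)) * version_modulus z.
Proof.
have [oz|noz] := pselect (Gd z).
  have i1 : \1_Gd z = 1 :> R by rewrite indicE mem_set.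
  by rewrite /smooth_version /version_modulus i1 !mul1r; case: oz => oz _; exact: extension_modulus.
have i0 : \1_Gd z = 0 :> R by rewrite indicE memNset.
by rewrite /smooth_version /version_modulus i0 !mul0r mulr0 subr0 normr0.
Qed.

Lemma smooth_versionE z y : (oscillation z < +oo)%E -> (extension_bound z < +oo)%E ->
  smooth_version z y = extension z y.
Proof. by move=> oz bz; rewrite /smooth_version indicE mem_set// mul1r. Qed.

End rational_extension.

(** * Null sets and integrals for the intensity *)

Section levy_exhaustion.
Context {R : realType} {d : nat}.
Local Notation V := 'rV[R]_d.
Variables (c : R) (nu : {measure set V -> \bar R}).

Definition levy_piece (n : nat) : set V :=
  [set v | punctured_ball c v /\ n.+1%:R^-1 <= enorm v].

Let enorm_preimage (Y : set R) : measurable Y -> measurable (@enorm R d @^-1` Y).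
Proof. by move=> mY; rewrite -[X in measurable X]setTI; exact: measurable_enorm. Qed.

Lemma punctured_ballE : punctured_ball c = @enorm R d @^-1` `]0, c[%classic.
Proof.
apply/seteqP; split => v /=; rewrite in_itv/=.
  by move=> [vc v0]; rewrite [X in _ && X]vc andbT; apply: enorm_gt0; exact/eqP.
move=> /andP[v0 vc]; split => // v00.
by move: v0; rewrite v00 enorm0 ltxx.
Qed.

Lemma measurable_punctured_ball : measurable (punctured_ball c : set V).
Proof. by rewrite punctured_ballE; exact: enorm_preimage. Qed.

Lemma measurable_levy_piece n : measurable (levy_piece n).
Proof.
rewrite (_ : levy_piece n = punctured_ball c `&` (@enorm R d @^-1` `[n.+1%:R^-1, +oo[%classic)).
  by apply: measurableI; [exact: measurable_punctured_ball|exact: enorm_preimage].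
by apply/seteqP; split => v [v1 v2]; split => //; move: v2; rewrite /= in_itv/= andbT.
Qed.

Lemma nondecreasing_levy_piece : nondecreasing_seq levy_piece.
Proof.
move=> m n mn; apply/subsetPset => v [Ev mv]; split => //; apply: le_trans mv.
by rewrite lef_pV2 ?posrE ?ltr0n// ler_nat.
Qed.

Lemma bigcup_levy_piece : punctured_ball c = \bigcup_n levy_piece n.
Proof.
apply/seteqP; split => [v Ev|v [n _ []]//].
have v0 : 0 < enorm v.
  by move: (Ev); rewrite punctured_ballE /= in_itv/= => /andP[].
exists (Num.truncn (enorm v)^-1) => //; split => //.
rewrite -[leRHS]invrK lef_pV2 ?posrE ?ltr0n ?invr_gt0//.
exact/ltW/truncnS_gt.
Qed.

(** Markov's inequality: on the piece the integrand of the Levy condition is at least [e > 0]. *)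
Lemma levy_piece_fin n : levy_measure (punctured_ball c) nu -> (nu (levy_piece n) < +oo)%E.
Proof.
move=> hnu; pose e : R := Num.min 1 (n.+1%:R^-1 ^+ 2).
have e0 : 0 < e by rewrite lt_min ltr01 exprn_gt0 ?invr_gt0 ?ltr0n.
have mmin : measurable_fun setT (fun v : V => Num.min 1 (enorm v ^+ 2)).
  apply: measurable_minr; first exact: measurable_cst.
  by apply: measurable_funX; exact: measurable_enorm.
have min0 v : 0 <= Num.min 1 (enorm v ^+ 2) :> R by rewrite le_min ler01 sqr_ge0.
have h : (e%:E * nu (levy_piece n) <= \int[nu]_(v in punctured_ball c) (Num.min 1 (enorm v ^+ 2))%:E)%E.
  rewrite -integral_cst; last exact: measurable_levy_piece.
  apply: (@le_trans _ _ (\int[nu]_(v in levy_piece n) (Num.min 1 (enorm v ^+ 2))%:E)%E).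
    apply: ge0_le_integral; first exact: measurable_levy_piece.
    - by move=> v _; rewrite lee_fin ltW.
    - exact: measurable_cst.
    - by apply/measurable_EFinP/measurable_funTS.
    - move=> v [_ vn]; rewrite lee_fin /e le_min ge_min lexx/= ge_min; apply/orP; right.
      by rewrite ler_sqr ?nnegrE ?invr_ge0 ?ler0n ?enorm_ge0.
  apply: ge0_subset_integral; [exact: measurable_levy_piece|exact: measurable_punctured_ball| | |].
  - by apply/measurable_EFinP/measurable_funTS.
  - by move=> v _; rewrite lee_fin.
  - by move=> v [].
rewrite ltey; apply/eqP => nuoo; move: (le_lt_trans h hnu).
by rewrite nuoo gt0_muley ?lte_fin// ltxx.
Qed.

End levy_exhaustion.

Lemma ae_imply {R : realType} dT (T : measurableType dT) (mu : {measure set T -> \bar R})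
    (X Y : T -> Prop) : {ae mu, forall x, X x} -> (forall x, X x -> Y x) ->
  {ae mu, forall x, Y x}.
Proof. by move=> hX XY; move: hX; apply: filterS => x /XY. Qed.

Section null_sections.
Local Open Scope ereal_scope.
Context d1 d2 (T1 : measurableType d1) (T2 : measurableType d2) (R : realType).
Variables (m1 : {sigma_finite_measure set T1 -> \bar R}).
Variables (m2 : {sigma_finite_measure set T2 -> \bar R}).
Variables (A : set (T1 * T2)) (mA : measurable A).

Lemma integral_eq0_ae (g : T1 -> \bar R) : measurable_fun setT g -> (forall x, 0 <= g x) ->
  \int[m1]_x g x = 0 -> m1 [set x | g x != 0] = 0.
Proof.
move=> mg g0 ig.
have : ae_eq m1 setT g (cst 0).
  apply/(ae_eq_integral_abs m1 measurableT mg).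
  by under eq_integral do rewrite gee0_abs//.
move=> /null_of_ae[Z [mZ Z0 hZ]].
have ms : measurable [set x | g x != 0].
  have := mg measurableT _ (measurableC (emeasurable_set1 0)).
  by rewrite setTI; congr measurable; apply/seteqP; split => x /= /eqP.
apply/eqP; rewrite eq_le measure_ge0 andbT; apply: (@le_trans _ _ (m1 Z)); last by rewrite Z0.
apply: le_measure; rewrite ?inE//.
by move=> x /= gx; apply: contrapT => nZ; move/eqP : gx; apply; exact: (hZ x nZ).
Qed.

Lemma null_xsection : (m1 \x m2) A = 0 -> m1 [set x | m2 (xsection A x) != 0] = 0.
Proof.
move=> A0; apply: integral_eq0_ae => //; first exact: measurable_fun_xsection.
Qed.

Lemma measurable_bad_xsection : measurable [set x | m2 (xsection A x) != 0].
Proof.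
have := measurable_fun_xsection m2 mA measurableT (measurableC (emeasurable_set1 0)).
by rewrite setTI; congr measurable; apply/seteqP; split => x /= /eqP.
Qed.

Lemma null_ysections : (forall y, m1 (ysection A y) = 0) -> (m1 \x m2) A = 0.
Proof.
move=> A0; rewrite (product_measure_unique (m' := m1 \x^ m2) _ mA).
  by rewrite /product_measure2; apply: integral0_eq => y _; exact: A0.
by move=> C D mC mD; exact: product_measure2E.
Qed.

End null_sections.

Section intensity_integrals.
Local Open Scope ereal_scope.
Context {R : realType} {d : nat} {dO : measure_display} {Omega : measurableType dO}.
Local Notation V := 'rV[R]_d.
Variables (nu : {measure set V -> \bar R}) (E : set V) (B : (set V)^nat).
Hypotheses (mE : measurable E) (mB : forall n, measurable (B n)).
Hypotheses (ndB : nondecreasing_seq B) (EB : E = \bigcup_n B n).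
Hypothesis nuB : forall n, nu (B n) < +oo.

Local Notation Q := (intensity mE mB EB nuB).
Local Notation mark := (mark_measure mE mB EB nuB).
Local Notation S t := (`]0%R, t] `*` E).

Lemma integral_mark (f : V -> \bar R) : measurable_fun setT f ->
  \int[mark]_v f v = \int[nu]_(v in E) f v.
Proof.
have pos (g : V -> \bar R) : measurable_fun setT g -> (forall v, 0 <= g v) ->
    \int[mark]_v g v = \int[nu]_(v in E) g v.
  by move=> mg g0; rewrite -[in RHS](setTI E) -(ge0_integral_mrestr nu mE measurableT mg).
move=> mf; rewrite integralE [RHS]integralE; congr (_ - _); apply: pos => //.
  exact: measurable_funepos.
exact: measurable_funeneg.
Qed.

Let time_strip (t : R) : `]0%R, t]%classic `&` `]0%R, +oo[%classic = `]0%R, t]%classic.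
Proof. by apply/setIidl => r /=; rewrite !in_itv/= andbT => /andP[]. Qed.

Lemma integral_time_strip (t : R) (f : R -> \bar R) : measurable_fun setT f ->
  \int[time_measure]_(r in `]0%R, t]) f r = \int[@lebesgue_measure R]_(r in `]0%R, t]) f r.
Proof.
have pos (g : R -> \bar R) : measurable_fun setT g -> (forall v, 0 <= g v) ->
    \int[time_measure]_(r in `]0%R, t]) g r = \int[@lebesgue_measure R]_(r in `]0%R, t]) g r.
  move=> mg g0; rewrite ge0_integral_time_measure//; last exact: measurable_funTS.
  by rewrite time_strip.
move=> mf; rewrite integralE [RHS]integralE; congr (_ - _); apply: pos => //.
  exact: measurable_funepos.
exact: measurable_funeneg.
Qed.

Let mS (t : R) : measurable (S t). Proof. exact: measurableX. Qed.

Let msec (f : R * V -> \bar R) r : measurable_fun setT f -> measurable_fun setT (fun v => f (r, v)).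
Proof. by move=> mf; apply: (measurableT_comp mf); exact: measurable_pair1. Qed.

Lemma measurable_mark_integral (f : R * V -> \bar R) : measurable_fun setT f ->
  measurable_fun setT (fun r => \int[nu]_(v in E) f (r, v)).
Proof.
move=> mf; rewrite (_ : (fun r => _) = (fun r => \int[mark]_v f (r, v))).
  exact: (measurable_integral_section mark mf).
by apply/funext => r; rewrite integral_mark//; exact: msec.
Qed.

Lemma ge0_integral_intensity (f : R * V -> \bar R) (t : R) : measurable_fun setT f ->
  (forall z, 0 <= f z) -> \int[Q]_(z in S t) f z =
  \int[time_measure]_(r in `]0%R, t]) \int[nu]_(v in E) f (r, v).
Proof.
move=> mf f0; rewrite integral_mkcond.
have mfS : measurable_fun setT (f \_ (S t)).
  by apply/(measurable_restrictT _ (mS t))/measurable_funTS.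
have fS0 z : 0 <= (f \_ (S t)) z by apply: erestrict_ge0.
rewrite [LHS](fubini_tonelli1 (m1 := time_measure) (m2 := mark) _ mfS fS0).
rewrite [RHS]integral_mkcond; apply: eq_integral => r _.
rewrite /fubini_F integral_mark; last exact: msec.
rewrite patchE; case: ifPn => [/set_mem rt|rt].
  apply: eq_integral => v /set_mem Ev; rewrite patchE mem_set//.
rewrite (eq_integral (fun=> 0)) ?integral0// => v _; rewrite patchE memNset// => -[/= rt' _].
by move/negP : rt; apply; exact: mem_set.
Qed.

Lemma ge0_integral_intensityE (f : R * V -> \bar R) (t : R) : measurable_fun setT f ->
  (forall z, 0 <= f z) -> \int[Q]_(z in S t) f z =
  \int[@lebesgue_measure R]_(r in `]0%R, t]) \int[nu]_(v in E) f (r, v).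
Proof.
move=> mf f0; rewrite ge0_integral_intensity//.
apply: (@integral_time_strip t (fun r => \int[nu]_(v in E) f (r, v))).
exact: measurable_mark_integral.
Qed.

Lemma Rintegral_intensity (f : R * V -> R) (t : R) : measurable_fun setT f ->
  Q.-integrable (S t) (EFin \o f) -> (\int[Q]_(z in S t) f z =
  \int[@lebesgue_measure R]_(r in `]0%R, t]) \int[nu]_(v in E) f (r, v))%R.
Proof.
move=> mf intf.
have mfE : measurable_fun setT (EFin \o f) by exact/measurable_EFinP.
have mfp := measurable_funepos mfE; have mfn := measurable_funeneg mfE.
pose Ip r := \int[nu]_(v in E) ((EFin \o f)^\+ (r, v)).
pose In r := \int[nu]_(v in E) ((EFin \o f)^\- (r, v)).
have mIp : measurable_fun setT Ip := measurable_mark_integral mfp.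
have mIn : measurable_fun setT In := measurable_mark_integral mfn.
have Ip0 r : 0 <= Ip r by apply: integral_ge0.
have In0 r : 0 <= In r by apply: integral_ge0.
have eIp : \int[Q]_(z in S t) (EFin \o f)^\+ z = \int[time_measure]_(r in `]0%R, t]) Ip r.
  by apply: ge0_integral_intensity.
have eIn : \int[Q]_(z in S t) (EFin \o f)^\- z = \int[time_measure]_(r in `]0%R, t]) In r.
  by apply: ge0_integral_intensity.
have iIp : time_measure.-integrable `]0%R, t] Ip.
  apply/integrableP; split; first exact: measurable_funTS.
  under eq_integral do rewrite gee0_abs//.
  rewrite -eIp; have /integrableP[_] := integrable_funepos (mS t) intf.
  by under eq_integral do rewrite gee0_abs//.
have iIn : time_measure.-integrable `]0%R, t] In.
  apply/integrableP; split; first exact: measurable_funTS.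
  under eq_integral do rewrite gee0_abs//.
  rewrite -eIn; have /integrableP[_] := integrable_funeneg (mS t) intf.
  by under eq_integral do rewrite gee0_abs//.
have inner r : \int[nu]_(v in E) (f (r, v))%:E = Ip r - In r.
  rewrite integralE /Ip /In; congr (_ - _);
    by apply: eq_integral => v _; rewrite ?funeposE ?funenegE.
rewrite /Rintegral; congr fine; rewrite integralE eIp eIn -integralB//.
rewrite -integral_time_strip; last first.
  apply/measurable_EFinP; apply: (measurableT_comp (@fine_measurable _ _ measurableT)).
  under eq_fun do rewrite inner.
  exact: emeasurable_funB.
(* The inner integrals may be infinite for a null set of times, where [fine] would not commute with
   the difference. *)
have [Z1 [mZ1 Z10 hZ1]] := null_of_ae (integrable_ae (measurable_itv _) iIp).
have [Z2 [mZ2 Z20 hZ2]] := null_of_ae (integrable_ae (measurable_itv _) iIn).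
apply: (eq_integral_null (Z := Z1 `|` Z2)); [exact: measurableU|exact: measureU_eq0|].
move=> r rt nZ /=; rewrite inner fineK// fin_numB.
by rewrite hZ1 ?hZ2// => Zr; apply: nZ; [right|left].
Qed.

Variable P : probability Omega R.
Local Notation PQ := (prod_sigma_finite P Q).

(** Nested almost-everywhere statements become one null set for the product measure, to which
    Fubini's theorem and compensation apply. *)
Lemma ae_wtv_null (A : set (Omega * (R * V))) : measurable A ->
  ae_wtv P E nu (fun w t v => ~ A (w, (t, v))) -> PQ A = 0.
Proof.
move=> mA /null_of_ae[Z [mZ Z0 hZ]].
apply/eqP; rewrite eq_le measure_ge0 andbT.
rewrite -[leRHS](integral0 P setT); apply: (ge0_le_integral_null mZ Z0) => // w _ nZ /=.
have /null_of_ae[Z1 [mZ1 Z10 hZ1]] := hZ w nZ.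
rewrite -[leRHS](integral0 (@time_measure R) setT).
(* Nothing is known at negative times, so they are added to the exceptional set; [time_measure] does
   not charge them. *)
have mZ1' : measurable (Z1 `|` `]-oo, 0%R]%classic : set R) by exact: measurableU.
apply: (ge0_le_integral_null mZ1') => //.
  apply: measureU_eq0 => //.
    apply/eqP; rewrite eq_le measure_ge0 andbT -Z10.
    by apply: (@le_measure _ _ _ (@lebesgue_measure R)); rewrite ?inE//; exact: measurableI.
  have e : `]-oo, 0%R]%classic `&` `]0%R, +oo[%classic = set0 :> set R.
    by apply/seteqP; split => // r [/=]; rewrite !in_itv/= andbT => r0; rewrite ltNge r0.
  rewrite -[LHS]/(@lebesgue_measure R (`]-oo, 0%R]%classic `&` `]0%R, +oo[%classic)) e.
  exact: measure0.
move=> r _ nr /=.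
have r0 : (0 <= r)%R.
  rewrite leNgt; apply/negP => r0; apply: nr; right => /=.
  by rewrite in_itv/= ltW.
have nr1 : ~ Z1 r by move=> ?; apply: nr; left.
have /null_of_ae[Z2 [mZ2 Z20 hZ2]] := hZ1 r nr1 r0.
have msec2 : measurable (xsection (xsection A w) r) by do 2 apply: measurable_xsection.
rewrite -Z20; apply: le_measure; rewrite ?inE//; first exact: measurableI.
move=> v [/xsectionP/xsectionP Av Ev]; apply: contrapT => nZ2.
exact: hZ2 nZ2 Ev Av.
Qed.

Lemma null_intensity (A : set (Omega * (R * V))) : measurable A -> PQ A = 0 ->
  {ae P, forall w, Q (xsection A w) = 0}.
Proof.
move=> mA A0; apply: (ae_of_null (Z := [set w | Q (xsection A w) != 0])).
- exact: measurable_bad_xsection.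
- exact: null_xsection.
- by move=> w /= /negP; rewrite negbK => /eqP.
Qed.

Lemma ae_wtv_mono (X Y : Omega -> R -> V -> Prop) :
  (forall w t v, (0 <= t)%R -> E v -> X w t v -> Y w t v) ->
  ae_wtv P E nu X -> ae_wtv P E nu Y.
Proof.
move=> XY hX; apply: (ae_imply hX) => w hw; apply: (ae_imply hw) => t ht t0.
by apply: (ae_imply (ht t0)) => v hv Ev; apply: XY => //; exact: hv.
Qed.

Lemma ae_wtv_all (X : nat -> Omega -> R -> V -> Prop) :
  (forall k, ae_wtv P E nu (X k)) -> ae_wtv P E nu (fun w t v => forall k, X k w t v).
Proof.
move=> /ae_foralln hX; apply: (ae_imply hX) => w /ae_foralln hw.
apply: (ae_imply hw) => t ht t0.
by apply: (ae_imply (ae_foralln (fun k => ht k t0))) => v hv Ev k; exact: hv.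
Qed.

Lemma ae_wtv_and (X Y : Omega -> R -> V -> Prop) :
  ae_wtv P E nu X -> ae_wtv P E nu Y -> ae_wtv P E nu (fun w t v => X w t v /\ Y w t v).
Proof.
move=> hX hY; have := ae_wtv_all (X := fun k => if k is 0%N then X else Y).
by move=> /(_ (fun k => if k is 0%N then hX else hY)); apply: ae_wtv_mono => w t v _ _ h;
  split; [exact: (h 0%N)|exact: (h 1%N)].
Qed.

End intensity_integrals.

Lemma ge0_le_integral_sub {R : realType} dT (T : measurableType dT)
    (mu : {measure set T -> \bar R}) (D D' Z : set T) (f g : T -> \bar R) :
  measurable Z -> mu Z = 0%E -> D `<=` D' ->
  (forall x, D x -> 0 <= f x)%E -> (forall x, D' x -> 0 <= g x)%E ->
  (forall x, D x -> ~ Z x -> f x <= g x)%E ->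
  (\int[mu]_(x in D) f x <= \int[mu]_(x in D') g x)%E.
Proof.
move=> mZ Z0 DD f0 g0 fg; rewrite integral_mkcond [leRHS]integral_mkcond.
apply: (ge0_le_integral_null mZ Z0).
- by move=> x _; exact: erestrict_ge0.
- by move=> x _; exact: erestrict_ge0.
- move=> x _ nZ; rewrite !patchE; case: ifPn => [/set_mem Dx|_].
    by rewrite mem_set; [exact: fg|exact: DD].
  by case: ifPn => // /set_mem; exact: g0.
Qed.

(** * From the intensity to the jump measure *)

Section predictable_transfer.
Local Open Scope ereal_scope.
Context {R : realType} {d : nat} {dO : measure_display} {Omega : measurableType dO}.
Variables (P : probability Omega R) (F : R -> set (set Omega)).
Hypothesis hF : right_continuous_filtration F.
Local Notation V := 'rV[R]_d.
Variables (E : set V) (nu : {measure set V -> \bar R}).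
Variable N : R.-ker Omega ~> (R * V)%type.
Hypothesis hN : poisson_random_measure P E nu F N.
Variable B : (set V)^nat.
Hypotheses (mE : measurable E) (mB : forall n, measurable (B n)).
Hypotheses (ndB : nondecreasing_seq B) (EB : E = \bigcup_n B n).
Hypothesis nuB : forall n, nu (B n) < +oo.

Local Notation M := (jump_measure N B mE).
Local Notation Q := (intensity mE mB EB nuB).
Local Notation PZ := (g_sigma_algebraType (predictable_class P F E B)).
Local Notation PQ := (prod_sigma_finite P Q).
Local Notation S t := (`]0%R, t] `*` E).
Local Notation D3 := (setT `*` jump_domain E : set (Omega * (R * V))).

Lemma predictable_full (A : set (Omega * (R * V))) : measurable (A : set PZ) -> measurable A.
Proof.
move=> mA; have mi : measurable_fun [set: PZ] (id : PZ -> PZ) by exact: measurable_id.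
by have := predictable_measurable_fun mE mi measurableT mA; rewrite setTI.
Qed.

Lemma measurable_predictable_domain : measurable (D3 : set PZ).
Proof.
rewrite -[D3]setCK; apply: measurableC; apply: sub_sigma_algebra; right.
by [].
Qed.

(** The two notions of predictability differ by the order of the variables, undone by [th], and by
    the marks. A rectangle with marks anywhere in [E] is a countable union of rectangles with marks
    in the sets [B n]. *)
Lemma predictable_measurable (g' : Omega -> R -> V -> V -> R) : predictable F E g' ->
  measurable_fun [set: PZ * V]
    ((fun q : PZ * V => g' q.1.1 q.1.2.1 q.1.2.2 q.2) \_ (D3 `*` setT)).
Proof.
move=> hp.
have mD : measurable (D3 `*` setT : set (PZ * V)).
  by apply: measurableX => //; exact: measurable_predictable_domain.
apply/(measurable_restrictT _ mD) => _ Y mY.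
pose th (q : PZ * V) := (((q.1.1, q.1.2.1), q.1.2.2), q.2).
have dom : th @^-1` (predictable_domain E) = D3 `*` setT.
  by apply/seteqP; split => [[[w [t v]] x] [[[_ /= ?] /= ?] _]|[[w [t v]] x] [[_ [/= ? ?]] _]].
have key : <<s predictable_domain E, predictable_rectangle F E >> `<=`
    [set A | measurable (th @^-1` A)].
  apply: smallest_sub.
    split => /=.
    - by rewrite preimage_set0; exact: measurable0.
    - move=> A mA; rewrite (_ : _ @^-1` _ = (D3 `*` setT) `\` (th @^-1` A)).
        exact: measurableD.
      by rewrite -dom.
    - by move=> A mA; rewrite preimage_bigcup; exact: bigcup_measurable.
  move=> _ [A0 [s [t [B' [C [[s0 FA mB' B'E mC] ->]]]]]] /=.
  rewrite (_ : _ @^-1` _ = \bigcup_n ((A0 `*` (`]s, t] `*` (B' `&` B n))) `*` C)).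
    apply: bigcup_measurable => n _; apply: measurableX => //.
    apply: (predictable_rect _ s0 _ (measurableI _ _ mB' (mB n)) (@subIsetr _ _ _)).
    exact: (sub_augmentation P hF s0 FA).
  apply/seteqP; split => [[[w [r v]] x] [[[/= wA rt] vB] xC]|
      [[w [r v]] x] [n _ [[/= wA [/= rt [vB _]]] xC]]].
    have : E v by exact: B'E.
    by rewrite EB => -[n _ Bv]; exists n.
  by split.
have := key _ (hp Y mY); rewrite /= preimage_setI dom.
by congr measurable.
Qed.

Lemma null_jump (A : set (Omega * (R * V))) : measurable (A : set PZ) -> PQ A = 0 ->
  {ae P, forall w, M w (xsection A w) = 0}.
Proof.
move=> mA A0; have mA' := predictable_full mA.
have ind (mu : {measure set (R * V) -> \bar R}) w :
    \int[mu]_z (\1_A (w, z))%:E = mu (xsection A w).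
  rewrite -[xsection A w in RHS]setIT -(integral_indic mu measurableT); last first.
    exact: measurable_xsection.
  apply: eq_integral => z _; rewrite !indicE; congr ((_ : bool)%:R%:E).
  by apply/idP/idP => [wA|/set_mem/xsectionP/mem_set//]; apply/mem_set/xsectionP/set_mem.
have mf : measurable_fun [set: PZ] (fun z => (\1_A z)%:E : \bar R).
  by apply/measurable_EFinP; exact: measurable_indic.
have f0 z : 0 <= (\1_A z)%:E :> \bar R by rewrite lee_fin.
have := compensation hF hN mE mB ndB EB nuB f0 mf.
rewrite (eq_integral _ _ (fun w _ => ind Q w)) (eq_integral _ _ (fun w _ => ind (M w) w)).
rewrite [RHS](_ : _ = PQ A)// A0 => h.
have mM : measurable_fun setT (fun w => M w (xsection A w)).
  rewrite -[X in measurable_fun _ X](_ : (fun w => \int[M w]_z (\1_A (w, z))%:E) = _); last first.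
    by apply/funext => w; exact: ind.
  apply: (measurable_jump_integral N mE mB ndB EB f0).
  exact: (predictable_measurable_fun mE mf).
have hz := integral_eq0_ae mM (fun w => measure_ge0 _ _) h.
apply: (ae_of_null _ hz).
- have := mM measurableT _ (measurableC (emeasurable_set1 0)).
  by rewrite setTI; congr measurable; apply/seteqP; split => w /= /eqP.
- by move=> w /= /negP; rewrite negbK => /eqP.
Qed.

Lemma measurable_jump_integral_signed (f : Omega * (R * V) -> \bar R) :
  measurable_fun setT f -> measurable_fun setT (fun w => \int[M w]_z f (w, z)).
Proof.
move=> mf; rewrite (_ : (fun w => _) =
    (fun w => \int[M w]_z (f^\+ (w, z)) - \int[M w]_z (f^\- (w, z)))); last first.
  apply/funext => w; rewrite integralE; congr (_ - _);
    by apply: eq_integral => z _; rewrite ?funeposE ?funenegE.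
apply: emeasurable_funB; apply: (measurable_jump_integral N mE mB ndB EB) => //.
  exact: measurable_funepos.
exact: measurable_funeneg.
Qed.

Lemma measurable_strip_integrals (f : Omega * (R * V) -> \bar R) (t : R) :
  measurable_fun (setT `*` S t) f ->
  measurable_fun setT (fun w => \int[M w]_(z in S t) f (w, z)) /\
  measurable_fun setT (fun w => \int[Q]_(z in S t) f (w, z)).
Proof.
move=> mf; have mD : measurable (setT `*` S t : set (Omega * (R * V))).
  by apply: measurableX => //; exact: measurableX.
have mfD : measurable_fun setT (f \_ (setT `*` S t)).
  by apply/(measurable_restrictT _ mD).
split; under eq_fun do rewrite integral_xsection.
  exact: measurable_jump_integral_signed.
exact: (measurable_integral_section Q mfD).
Qed.

(** [n] is not supposed measurable, so Fubini's theorem is applied to [f1], which is [f] set to 0 on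
    the null set; the comparison with [n] is made inside the iterated integral. *)
Lemma strip_le (f : Omega * (R * V) -> \bar R) (A : set (Omega * (R * V)))
    (n : Omega -> R -> V -> \bar R) : measurable_fun setT f -> (forall z, 0 <= f z) ->
  measurable A -> PQ A = 0 -> (forall w t v, (0 <= t)%R -> E v -> 0 <= n w t v) ->
  (forall w t v, (0 < t)%R -> E v -> ~ A (w, (t, v)) -> f (w, (t, v)) <= n w t v) ->
  {ae P, forall w, forall T : R, \int[Q]_(z in S T) f (w, z) <=
    \int[@lebesgue_measure R]_(t in `[0%R, T]) \int[nu]_(v in E) n w t v}.
Proof.
move=> mf f0 mA A0 n0 fn.
apply: (ae_imply (null_intensity mA A0)) => w Aw T.
pose f1 (z : R * V) := if (w, z) \in A then 0 else f (w, z).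
have mxA : measurable (xsection A w) by exact: measurable_xsection.
have f10 z : 0 <= f1 z by rewrite /f1; case: ifP.
have mf1 : measurable_fun setT f1.
  rewrite (_ : f1 = (fun z => f (w, z)) \_ (~` xsection A w)).
    apply/(measurable_restrictT _ (measurableC mxA)); apply: measurable_funTS.
    by apply: (measurableT_comp mf); exact: measurable_pair1.
  apply/funext => z; rewrite /f1 patchE; case: ifPn => [wA|nA].
    by rewrite memNset//=; apply; apply/xsectionP/set_mem.
  by rewrite mem_set//= => /xsectionP/mem_set; exact/negP.
apply: (@le_trans _ _ (\int[Q]_(z in S T) f1 z)).
  apply: (ge0_le_integral_null mxA Aw) => // z _ nA.
  by rewrite /f1 memNset// => wA; apply: nA; exact/xsectionP.
rewrite ge0_integral_intensityE//.
apply: (ge0_le_integral_sub (Z := set0)) => //.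
- by move=> t /=; rewrite !in_itv/= => /andP[/ltW-> ->].
- by move=> t _; exact: integral_ge0.
- by move=> t /=; rewrite in_itv/= => /andP[t0 _]; apply: integral_ge0 => v Ev; exact: n0.
- move=> t /=; rewrite in_itv/= => /andP[t0 _] _.
  apply: (ge0_le_integral_sub (Z := set0)) => //.
  + by move=> v Ev; apply: n0 => //; exact: ltW.
  + move=> v Ev _; rewrite /f1; case: ifPn => [_|nA]; first by apply: n0 => //; exact: ltW.
    by apply: fn => // /mem_set; exact/negP.
Qed.

(** By compensation both integrals have the same finite mean. The strips grow with [T], so integer
    values of [T] suffice and one null event serves all [T]. *)
Lemma strip_finite (f : Omega * (R * V) -> R) : (forall z, (0 <= f z)%R) ->
  measurable_fun [set: PZ] f ->
  (forall T : R, (0 < T)%R -> \int[P]_w \int[Q]_(z in S T) (f (w, z))%:E < +oo) ->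
  {ae P, forall w, forall T : R, \int[M w]_(z in S T) (f (w, z))%:E < +oo /\
    \int[Q]_(z in S T) (f (w, z))%:E < +oo}.
Proof.
move=> f0 mf hfin.
have mf' := predictable_measurable_fun mE mf.
have fE0 (mu : {measure set (R * V) -> \bar R}) w T : 0 <= \int[mu]_(z in S T) (f (w, z))%:E.
  by apply: integral_ge0 => z _; rewrite lee_fin.
have mI T : measurable_fun setT (fun w => \int[M w]_(z in S T) (f (w, z))%:E) /\
    measurable_fun setT (fun w => \int[Q]_(z in S T) (f (w, z))%:E).
  apply: (@measurable_strip_integrals (EFin \o f)).
  exact/measurable_EFinP/measurable_funTS.
have fin (X : Omega -> \bar R) : measurable_fun setT X -> (forall w, 0 <= X w) ->
    \int[P]_w X w < +oo -> {ae P, forall w, X w < +oo}.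
  move=> mX X0 hX; have iX : P.-integrable setT X.
    by apply/integrableP; split => //; under eq_integral do rewrite gee0_abs//.
  apply: (ae_imply (integrable_ae measurableT iX)) => w /(_ I).
  by rewrite ge0_fin_numE.
have step (k : nat) : {ae P, forall w, \int[M w]_(z in S k.+1%:R) (f (w, z))%:E < +oo /\
    \int[Q]_(z in S k.+1%:R) (f (w, z))%:E < +oo}.
  have [mI1 mI2] := mI k.+1%:R.
  have k0 : (0 < k.+1%:R :> R)%R by rewrite ltr0n.
  have h1 := fin _ mI2 (fun w => fE0 Q w _) (hfin _ k0).
  have h2 : {ae P, forall w, \int[M w]_(z in S k.+1%:R) (f (w, z))%:E < +oo}.
    apply: fin => //.
    by rewrite (compensation_strip hF hN mE mB ndB EB nuB k.+1%:R f0 mf); exact: hfin.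
  have [Z1 [mZ1 Z10 hZ1]] := null_of_ae h1; have [Z2 [mZ2 Z20 hZ2]] := null_of_ae h2.
  apply: (ae_of_null (Z := Z1 `|` Z2)); [exact: measurableU|exact: measureU_eq0|].
  by move=> w nZ; split; [apply: hZ2|apply: hZ1] => Zw; apply: nZ; [right|left].
apply: (ae_imply (ae_foralln step)) => w hw T.
have [h1 h2] := hw (Num.truncn `|T|).
have ST : S T `<=` S (Num.truncn `|T|).+1%:R.
  move=> [t v] [/=]; rewrite !in_itv/= => /andP[t0 tT] Ev; split => //=.
  rewrite t0 (le_trans tT)// (le_trans (ler_norm T))//.
  exact/ltW/truncnS_gt.
have mw : measurable_fun setT (fun z => (f (w, z))%:E).
  by apply/measurable_EFinP; apply: (measurableT_comp mf'); exact: measurable_pair1.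
split; [apply: le_lt_trans h1|apply: le_lt_trans h2];
  (apply: ge0_subset_integral => //; [exact: measurableX|exact: measurableX|
   exact: measurable_funTS|by move=> z _; rewrite lee_fin]).
Qed.

End predictable_transfer.

Lemma cvg_powR_gt0 {R : realType} (f : R -> R) (a b r : R) :
  0 < r -> 0 < a -> f x @[x --> b] --> a -> f x `^ r @[x --> b] --> a `^ r.
Proof.
move=> r0 a0 fa.
have h : `|f x| @[x --> b] --> a by rewrite -(gtr0_norm a0); exact: cvg_norm.
have h2 := @cvg_powR R R (nbhs b) (nbhs_filter b) (fun x => `|f x|) a r r0
  (fun x => normr_ge0 (f x)) (ltW a0) h.
apply: cvg_trans h2; apply: near_eq_cvg.
have := @cvgr_gt R R (nbhs b) (nbhs_filter b) f a fa 0 a0; apply: (@filterS _ (nbhs b)) => x fx.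
by rewrite gtr0_norm.
Qed.

(** * The modulus of continuity built from [phi] *)

Section modulus.
Context {R : realType} (d : nat) (hd : (0 < d)%N) (p : R) (hp : 1 <= p) (phi : R -> R).
Hypothesis hphi_mono : forall r s : R, 0 < r -> r <= s -> phi r <= phi s.
Hypothesis hphi_ge0 : forall r : R, 0 < r -> 0 <= phi r.
Hypothesis hphi_cont : forall r : R, 0 < r -> {for r, continuous phi}.
Hypothesis hphi_lim : phi r @[r --> 0^'+] --> 0.

Definition space_modulus (r : R) : R := r `^ (d%:R / p) * phi r `^ p^-1.

(** A zero of [phi] at some [2^-n] would make the quotient 0, below [lambda^-1]. Hence [phi] is
    positive at arbitrarily small points, and by monotonicity everywhere. *)
Lemma modulus_function_gt0 (lambda : R) : 1 <= lambda ->
  (\forall n \near \oo, lambda^-1 <= phi (2 ^- n) / phi (2 ^- n.+1) /\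
     phi (2 ^- n) / phi (2 ^- n.+1) <= lambda) ->
  forall r, 0 < r -> 0 < phi r.
Proof.
move=> l1 hdbl r r0.
have pos n : 0 < 2 ^- n :> R by rewrite invr_gt0 exprn_gt0.
have : \forall n \near \oo, 2 ^- n < r.
  have := near_infty_natSinv_expn_lt (PosNum r0).
  by apply: filterS => n /=; rewrite div1r.
move=> hr; have [n [[hn _] nr]] : exists n, (lambda^-1 <= phi (2 ^- n) / phi (2 ^- n.+1) /\
     phi (2 ^- n) / phi (2 ^- n.+1) <= lambda) /\ 2 ^- n < r.
  have [N _ hN] := filterI hdbl hr.
  by exists N; apply: (hN N) => /=.
apply: lt_le_trans (hphi_mono (pos n) (ltW nr)).
rewrite lt0r hphi_ge0// andbT; apply/eqP => phi0.
move: hn; rewrite phi0 mul0r leNgt => /negP; apply.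
by rewrite invr_gt0 (lt_le_trans ltr01).
Qed.

Hypothesis phi_gt0 : forall r, 0 < r -> 0 < phi r.

Let p0 : 0 < p. Proof. exact: lt_le_trans hp. Qed.
Let dp0 : 0 < d%:R / p. Proof. by rewrite divr_gt0// ltr0n. Qed.

Lemma space_modulus0 : space_modulus 0 = 0.
Proof. by rewrite /space_modulus powR0 ?mul0r// gt_eqF. Qed.

Lemma space_modulus_gt0 r : 0 < r -> 0 < space_modulus r.
Proof. by move=> r0; rewrite mulr_gt0// powR_gt0// phi_gt0. Qed.

Lemma continuous_space_modulus r : 0 < r -> {for r, continuous space_modulus}.
Proof.
move=> r0; apply: (@cvgM _ _ (nbhs r)).
  by apply: cvg_powR_gt0 => //; exact: cvg_id.
by apply: cvg_powR_gt0; [rewrite invr_gt0|exact: phi_gt0|exact: hphi_cont].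
Qed.

Lemma space_modulus_small e : 0 < e ->
  exists2 r, 0 < r & forall s, 0 < s -> s < r -> space_modulus s < e.
Proof.
move=> e0; have ep : 0 < e `^ p by rewrite powR_gt0.
have : \forall s \near 0^'+, phi s < e `^ p by exact: (cvgr_lt _ hphi_lim _ ep).
rewrite near_withinE => /nbhs_ballP[r /= r0 hr].
exists (Num.min r 1); first by rewrite lt_min r0 ltr01.
move=> s s0; rewrite lt_min => /andP[sr s1].
have ps : phi s < e `^ p by apply: hr => //; rewrite /ball/= sub0r normrN gtr0_norm.
have pe : phi s `^ p^-1 < e.
  have -> : e = (e `^ p) `^ p^-1 by rewrite -powRrM divff ?lt0r_neq0// powRr1// ltW.
  by apply: gt0_ltr_powR; rewrite ?invr_gt0// nnegrE ?powR_ge0// ltW// phi_gt0.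
apply: le_lt_trans pe; rewrite /space_modulus ler_piMl ?powR_ge0//.
by have := powR_le (ltW dp0) (ltW s0) (ltW s1); rewrite powR1.
Qed.

Lemma space_modulus_ratio (beta r r1 z : R) : beta < p^-1 -> 0 < r -> r <= r1 -> 0 <= z ->
  (space_modulus r * z) `^ p / phi r `^ (beta * p) <=
  r1 `^ d%:R * phi r1 `^ (1 - beta * p) * z `^ p.
Proof.
move=> bp r0 rr z0; have pr := phi_gt0 r0.
have bp1 : 0 <= 1 - beta * p by rewrite subr_ge0 -ler_pdivlMr// div1r ltW.
rewrite /space_modulus powRM ?mulr_ge0 ?powR_ge0// powRM ?powR_ge0//.
rewrite -!powRrM divfK ?gt_eqF// mulVf ?gt_eqF// powRr1 ?(ltW pr)//.
rewrite mulrAC ler_wpM2r ?powR_ge0// -mulrA.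
apply: ler_pM; rewrite ?powR_ge0 ?mulr_ge0 ?invr_ge0 ?powR_ge0 ?(ltW pr)//.
  by apply: powR_le => //; exact: ltW.
rewrite (_ : phi r / phi r `^ (beta * p) = phi r `^ (1 - beta * p)).
  by apply: powR_le; [|exact: ltW|exact: hphi_mono].
rewrite powRB ?powRr1 ?(ltW pr)//.
by rewrite (lt0r_neq0 pr) implybT.
Qed.

End modulus.

Lemma measurable_neq_set {R : realType} dT (T : measurableType dT) (u v : T -> R) :
  measurable_fun setT u -> measurable_fun setT v -> measurable [set x | u x != v x].
Proof.
move=> mu mv; have := measurable_funB mu mv measurableT (measurableC (measurable_set1 (0 : R))).
rewrite setTI; congr measurable; apply/seteqP; split => x /=.
  by move=> h; apply/eqP => uv; apply: h; rewrite uv subrr.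
by move=> /eqP uv h; apply: uv; apply/eqP; rewrite -subr_eq0; exact/eqP.
Qed.

(** * The continuous predictable version of the integrand *)

Section predictable_data.
Context {R : realType} {d : nat} {dO : measure_display} {Omega : measurableType dO}.
Local Notation V := 'rV[R]_d.
Variables (P : probability Omega R) (F : R -> set (set Omega)).
Hypothesis hF : right_continuous_filtration F.
Variables (c : R) (nu : {measure set V -> \bar R}).
Local Notation E := (punctured_ball c : set V).
Variable B : (set V)^nat.
Hypotheses (mE : measurable E) (mB : forall n, measurable (B n)).
Hypotheses (ndB : nondecreasing_seq B) (EB : E = \bigcup_n B n).
Hypothesis nuB : forall n, (nu (B n) < +oo)%E.

Local Notation Q := (intensity mE mB EB nuB).
Local Notation PZ := (g_sigma_algebraType (predictable_class P F E B)).
Local Notation PQ := (prod_sigma_finite P Q).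
Local Notation S t := (`]0%R, t] `*` E).
Local Notation D3 := (setT `*` jump_domain E : set (Omega * (R * V))).
Local Notation FZ := (Omega * (R * V))%type.

Variables (omega : R -> R).
Hypotheses (omega0 : omega 0 = 0) (omega_gt0 : forall r, 0 < r -> 0 < omega r).
Hypothesis comega : forall r, 0 < r -> {for r, continuous omega}.
Hypothesis omega_small : forall e, 0 < e ->
  exists2 r, 0 < r & forall s, 0 < s -> s < r -> omega s < e.

Variables (g g' : Omega -> R -> V -> V -> R) (h : Omega -> R -> V -> R).
Hypothesis hp : predictable F E g'.
Hypothesis hver : forall x, ae_wtv P E nu (fun w t v => g' w t v x = g w t v x).
Hypothesis mg : measurable_fun
  ([set: Omega] `*` `[(0 : R), +oo[%classic `*` E `*` [set: V])
  (fun q => g q.1.1.1 q.1.1.2 q.1.2 q.2).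
Hypothesis mh : measurable_fun ([set: Omega] `*` `[(0 : R), +oo[%classic `*` E)
  (fun q => h q.1.1 q.1.2 q.2).
Hypothesis h_ge0 : forall w (t : R) v, 0 <= t -> E v -> 0 <= h w t v.
Hypothesis hgh : forall x y : V, ae_wtv P E nu (fun w t v =>
  `|g w t v x - g w t v y| <= h w t v * omega (enorm (x - y))).

Definition predictable_data (z : PZ) (y : V) : R :=
  ((fun q : PZ * V => g' q.1.1 q.1.2.1 q.1.2.2 q.2) \_ (D3 `*` setT)) (z, y).

Local Notation f := predictable_data.
Local Notation osc := (oscillation f omega).
Local Notation ext := (extension f omega).
Local Notation b := (smooth_version f omega).

Let mfj : measurable_fun [set: PZ * V] (fun q => f q.1 q.2).
Proof.
rewrite (_ : (fun q => _) = (fun q : PZ * V => g' q.1.1 q.1.2.1 q.1.2.2 q.2) \_ (D3 `*` setT)).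
  exact: (predictable_measurable hF mB EB hp).
by apply/funext => -[z y].
Qed.

Lemma measurable_predictable_data y : measurable_fun [set: PZ] (f ^~ y).
Proof. exact: (measurableT_comp mfj (measurable_pair2 y)). Qed.

Lemma predictable_data_in z y : D3 z -> f z y = g' z.1 z.2.1 z.2.2 y.
Proof. by move=> Dz; rewrite /f patchE mem_set. Qed.

Lemma predictable_data_out z y : ~ D3 z -> f z y = 0.
Proof. by move=> Dz; rewrite /f patchE memNset// => -[]. Qed.

Let ht (z : FZ) : R := ((fun z : FZ => h z.1 z.2.1 z.2.2) \_ D3) z.
Let gt (q : FZ * V) : R := ((fun q : FZ * V => g q.1.1 q.1.2.1 q.1.2.2 q.2) \_ (D3 `*` setT)) q.

Let mD3 : measurable D3.
Proof. by apply: measurableX => //; exact: (@measurable_jump_domain R _ _ _ mE). Qed.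

Let mdom1 : measurable ([set: Omega] `*` `[(0 : R), +oo[%classic `*` E).
Proof. by apply: measurableX => //; exact: measurableX. Qed.

Let mht : measurable_fun setT ht.
Proof.
apply/(measurable_restrictT _ mD3).
apply: (measurable_comp (f := fun q : Omega * R * V => h q.1.1 q.1.2 q.2)
  (g := fun z : FZ => ((z.1, z.2.1), z.2.2)) mdom1) => //.
  move=> _ [[w [t v]] [_ [/= t0 Ev]] <-]; split => //=; split => //=.
  by move: t0; rewrite !in_itv/= !andbT => /ltW.
apply: measurable_funTS; apply/measurable_fun_pairP; split => /=.
  apply/measurable_fun_pairP; split => /=; first exact: measurable_fst.
  exact: (measurableT_comp measurable_fst measurable_snd).
exact: (measurableT_comp measurable_snd measurable_snd).
Qed.

Let mgt : measurable_fun setT gt.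
Proof.
apply/(measurable_restrictT _ (measurableX mD3 measurableT)).
apply: (measurable_comp (f := fun q : Omega * R * V * V => g q.1.1.1 q.1.1.2 q.1.2 q.2)
  (g := fun q : FZ * V => (((q.1.1, q.1.2.1), q.1.2.2), q.2)) (measurableX mdom1 measurableT)) => //.
  move=> _ [[[w [t v]] x] [[_ [/= t0 Ev]] _] <-]; split => //=; split => //=; split => //=.
  by move: t0; rewrite !in_itv/= !andbT => /ltW.
apply: measurable_funTS; apply/measurable_fun_pairP; split => /=; last exact: measurable_snd.
apply/measurable_fun_pairP; split => /=.
  apply/measurable_fun_pairP; split => /=.
    exact: (measurableT_comp measurable_fst measurable_fst).
  exact: (measurableT_comp (measurableT_comp measurable_fst measurable_snd) measurable_fst).
exact: (measurableT_comp (measurableT_comp measurable_snd measurable_snd) measurable_fst).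
Qed.

Let ht0 z : 0 <= ht z.
Proof.
rewrite /ht patchE; case: ifPn => // /set_mem[_ [/= t0 Ev]]; apply: h_ge0 => //.
by move: t0; rewrite in_itv/= andbT => /ltW.
Qed.

Let omega_ge0 r : 0 <= r -> 0 <= omega r.
Proof. by rewrite le_eqVlt => /predU1P[<-|/omega_gt0/ltW//]; rewrite omega0. Qed.

Let data_modulus x y : ae_wtv P E nu (fun w t v =>
  `|f (w, (t, v)) x - f (w, (t, v)) y| <= omega (enorm (x - y)) * ht (w, (t, v))).
Proof.
apply: ae_wtv_mono (ae_wtv_and (hgh x y) (ae_wtv_and (hver x) (hver y))).
move=> w t v t0 Ev [h1 [h2 h3]].
have [Dz|nDz] := pselect (D3 (w, (t, v))).
  by rewrite !predictable_data_in//= h2 h3 /ht patchE mem_set// mulrC.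
by rewrite !predictable_data_out// subrr normr0 mulr_ge0// omega_ge0// enorm_ge0.
Qed.

(** All pairs of rational points and all pairs of the fixed [y] with a rational point satisfy the
    modulus bound with the same exceptional set, since they are countably many. *)
Let ae_all : forall y, ae_wtv P E nu (fun w t v =>
  (osc (w, (t, v)) <= (ht (w, (t, v)))%:E)%E /\ ext (w, (t, v)) y = f (w, (t, v)) y).
Proof.
move=> y.
have h1 : ae_wtv P E nu (fun w t v => forall k : nat, forall i j, unpickle k = Some (i, j) ->
    `|f (w, (t, v)) (rat_point i) - f (w, (t, v)) (rat_point j)| <=
    omega (enorm (rat_point i - rat_point j : V)) * ht (w, (t, v))).
  apply: ae_wtv_all => k; case ek : (unpickle k) => [[i j]|].
    apply: ae_wtv_mono (data_modulus (rat_point i) (rat_point j)) => w t v _ _ hij i' j'.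
    by move=> [<- <-].
  by apply: ae_wtv_mono (data_modulus y y) => w t v _ _ _ i' j'.
have h2 : ae_wtv P E nu (fun w t v => forall k : nat,
    `|f (w, (t, v)) y - f (w, (t, v)) (rat_point k)| <=
    omega (enorm (y - rat_point k)) * ht (w, (t, v))).
  by apply: ae_wtv_all => k; exact: data_modulus.
apply: ae_wtv_mono (ae_wtv_and h1 h2) => w t v _ _ [h3 h4].
have oz : (osc (w, (t, v)) <= (ht (w, (t, v)))%:E)%E.
  apply: oscillation_le => // i j; apply: (h3 (pickle (i, j))).
  by rewrite pickleK.
split => //; apply: (extensionE omega0 omega_gt0 omega_small _ h4).
exact: le_lt_trans oz (ltry _).
Qed.

Let full d1 (T1 : measurableType d1) (k : FZ -> T1) :
  measurable_fun [set: PZ] (k : PZ -> T1) -> measurable_fun setT k.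
Proof. exact: (predictable_measurable_fun mE). Qed.

Let mosc := full (measurable_oscillation omega measurable_predictable_data).
Let mext y := full (measurable_extension measurable_predictable_data omega0 omega_gt0 omega_small y).

Let A1 : set FZ := [set z | (osc z <= (ht z)%:E)%E = false].

Let mA1 : measurable A1.
Proof.
have mht' : measurable_fun setT (fun z => (ht z)%:E) by exact/measurable_EFinP.
have mB' := emeasurable_funB mosc mht'.
have := emeasurable_fun_o_infty measurableT mB' 0%E.
rewrite setTI; congr measurable; apply/seteqP; split => z /=.
  by move=> h1; apply/negbTE; rewrite -ltNge -sube_gt0.
by move=> /negbT; rewrite -ltNge -sube_gt0.
Qed.

Lemma oscillation_null : PQ A1 = 0.
Proof.
apply: (ae_wtv_null (E := E)) => //; apply: ae_wtv_mono (ae_all 0) => w t v _ _ [h1 _].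
by rewrite /A1/= h1.
Qed.

Let A2 : set (FZ * V) := [set q | ext q.1 q.2 != gt q].

Let mA2 : measurable A2.
Proof.
have mextj : measurable_fun [set: FZ * V] (fun q => ext q.1 q.2).
  apply: (@measurable_caratheodory R d _ FZ (fun z y => ext z y)); first exact: mext.
  by move=> z; exact: (continuous_extension omega0 omega_gt0 comega omega_small).
by apply: measurable_neq_set.
Qed.

Let A2' : set FZ := [set z | (lebesgue_rV d (xsection A2 z) != 0)%E].

Let mA2' : measurable A2'. Proof. exact: measurable_bad_xsection. Qed.

(** For each fixed [y] the extension equals [g] almost everywhere; exchanging the order of
    integration, for almost every [z] it equals [g] at almost every [y]. This is what the essential
    supremum of [g] can control. *)
Let A2'_null : PQ A2' = 0.
Proof.
apply: null_xsection => //; apply: null_ysections => // y.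
apply: (ae_wtv_null (E := E)) => //; first exact: measurable_ysection.
apply: ae_wtv_mono (ae_wtv_and (ae_all y) (hver y)) => w t v _ _ [[_ h1] h2].
move=> /ysectionP; rewrite /A2/= h1 => /eqP; apply.
have [Dz|nDz] := pselect (D3 (w, (t, v))).
  by rewrite predictable_data_in//= h2 /gt patchE mem_set.
by rewrite predictable_data_out// /gt patchE memNset// => -[].
Qed.

Lemma extension_bound_strip : {ae P, forall w, forall T : R,
  (\int[Q]_(z in S T) extension_bound f omega (w, z) <=
   \int[@lebesgue_measure R]_(t in `[0%R, T]) \int[nu]_(v in E)
     'N[lebesgue_rV d]_+oo[EFin \o g w t v])%E}.
Proof.
apply: (strip_le _ _ mA2' A2'_null).
- by apply: full; exact: (measurable_extension_bound measurable_predictable_data omega0 omega_gt0 omega_small).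
- by move=> z; exact: extension_bound_ge0.
- by move=> w t v _ _; exact: Lnorm_ge0.
- move=> w t v t0 Ev nA; apply: extension_bound_le.
  apply: (@ess_sup_ge_continuous _ _ (ext (w, (t, v))) (g w t v) (xsection A2 (w, (t, v)))).
  + exact: (continuous_extension omega0 omega_gt0 comega omega_small).
  + exact: measurable_xsection.
  + by apply/eqP; apply: contrapT => /negP; exact: nA.
  + move=> y ny; have : ~ A2 ((w, (t, v)), y) by move=> ?; apply: ny; exact/xsectionP.
    move=> /negP; rewrite negbK => /eqP ->; rewrite /gt patchE mem_set//.
    by split => //; split => //=; split => //=; rewrite in_itv/= t0.
Qed.

Let ht_in w (t : R) v : 0 < t -> E v -> ht (w, (t, v)) = h w t v.
Proof.
move=> t0 Ev; rewrite /ht patchE mem_set//; split => //; split => //=.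
by rewrite in_itv/= t0.
Qed.

Lemma version_modulus_strip (r : R) : 0 <= r -> {ae P, forall w, forall T : R,
  (\int[Q]_(z in S T) (version_modulus f omega (w, z) `^ r)%:E <=
   \int[@lebesgue_measure R]_(t in `[0%R, T]) \int[nu]_(v in E) (`|h w t v| `^ r)%:E)%E}.
Proof.
move=> r0; apply: (strip_le (f := fun z => (version_modulus f omega z `^ r)%:E) _ _ mA1 oscillation_null).
- apply/measurable_EFinP; apply: (measurableT_comp (measurable_powR _)); apply: full.
  exact: (measurable_version_modulus measurable_predictable_data omega0 omega_gt0 omega_small).
- by move=> z; rewrite lee_fin powR_ge0.
- by move=> w t v _ _; rewrite lee_fin powR_ge0.
- move=> w t v t0 Ev nA; rewrite lee_fin; apply: powR_le => //.
    exact: (version_modulus_ge0 f omega0 omega_gt0).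
  rewrite -lee_fin; apply: (le_trans (version_modulus_le f omega0 omega_gt0 _)).
  apply: (@le_trans _ _ (ht (w, (t, v)))%:E).
    by apply: contrapT => /negP/negbTE; exact: nA.
  by rewrite ht_in// lee_fin ler_norm.
Qed.

Hypothesis extension_bound_fin : forall T : R, 0 < T ->
  (\int[P]_w \int[Q]_(z in S T) extension_bound f omega (w, z) < +oo)%E.

Let A4 : set FZ := [set z | (extension_bound f omega z = +oo)%E].

Let meb := full (measurable_extension_bound measurable_predictable_data omega0 omega_gt0 omega_small).

Let eb0 z := extension_bound_ge0 f omega z.

(** An integrable function is finite almost everywhere; integrability is available on each strip up
    to an integer time, and these cover [D3]. *)
Let A4_null : PQ (A4 `&` D3) = 0.
Proof.
pose T k : set FZ := setT `*` S (k.+1%:R : R).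
have mT k : measurable (T k) by apply: measurableX => //; exact: measurableX.
have step k : {ae PQ, forall z, T k z -> (extension_bound f omega z < +oo)%E}.
  have mr : measurable_fun setT (extension_bound f omega \_ (T k)).
    by apply/(measurable_restrictT _ (mT k)); exact: measurable_funTS.
  have r0 z : (0 <= (extension_bound f omega \_ (T k)) z)%E.
    by apply: erestrict_ge0 => z' _; exact: eb0.
  have ir : PQ.-integrable setT (extension_bound f omega \_ (T k)).
    apply/integrableP; split => //; under eq_integral do rewrite gee0_abs//.
    rewrite [X in (X < _)%E](fubini_tonelli1 (m1 := P) (m2 := Q) _ mr r0).
    rewrite (eq_integral (fun w => \int[Q]_(z in S (k.+1%:R : R)) extension_bound f omega (w, z))%E).
      by apply: extension_bound_fin; rewrite ltr0n.
    by move=> w _; rewrite /fubini_F [RHS]integral_xsection.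
  apply: (ae_imply (integrable_ae measurableT ir)) => z /(_ I) + Tz.
  by rewrite patchE mem_set// ge0_fin_numE.
have /choice[Z hZ] k := null_of_ae (step k).
have mZ k : measurable (Z k) by have [] := hZ k.
have Z0 k : PQ (Z k) = 0 by have [] := hZ k.
have mA4 : measurable A4.
  have := meb measurableT (emeasurable_set1 +oo%E).
  by rewrite setTI.
apply/eqP; rewrite eq_le measure_ge0 andbT -[leRHS](measure_bigcup0 (fun k => conj (mZ k) (Z0 k))).
apply: le_measure; rewrite ?inE.
- exact: measurableI.
- exact: bigcup_measurable.
- move=> [w [t v]] [A4z [_ [/= t0 Ev]]]; exists (Num.truncn t) => //.
  apply: contrapT => nZ; have [_ _ h3] := hZ (Num.truncn t).
  have := h3 _ nZ; rewrite [extension_bound _ _ _]A4z ltxx => h4.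
  have : T (Num.truncn t) (w, (t, v)); last by move=> /h4.
  split => //; split => //=; move: t0; rewrite !in_itv/= andbT => ->/=.
  exact/ltW/truncnS_gt.
Qed.

Let out_null : PQ (~` D3) = 0.
Proof.
apply: integral0_eq => w _ /=.
rewrite (_ : xsection (~` D3) w = ~` jump_domain E).
  exact: intensity_out.
apply/seteqP; split => z /=.
  by move=> /xsectionP/= hx Dz; apply: hx.
by move=> nD; apply/xsectionP => -[].
Qed.

Let mb_full y : measurable_fun [set: FZ] (b ^~ y).
Proof.
exact: (full (measurable_smooth_version measurable_predictable_data omega0 omega_gt0 omega_small y)).
Qed.

Lemma smooth_version_null y : PQ [set z | f z y != b z y] = 0.
Proof.
have mfy : measurable_fun [set: FZ] (f ^~ y) := full (measurable_predictable_data y).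
pose W : set FZ := A1 `|` [set z | ext z y != f z y].
have mW : measurable W by apply: measurableU => //; apply: measurable_neq_set.
have W0 : PQ W = 0.
  apply: (ae_wtv_null (E := E)) => //; apply: ae_wtv_mono (ae_all y) => w t v _ _ [h1 h2] [].
    by rewrite /A1/= h1.
  by rewrite /= h2 eqxx.
have mA4 : measurable A4.
  by have := meb measurableT (emeasurable_set1 +oo%E); rewrite setTI.
have U0 : PQ (W `|` ((A4 `&` D3) `|` ~` D3)) = 0.
  have mI : measurable (A4 `&` D3) by exact: measurableI.
  have mC : measurable (~` D3) by exact: measurableC.
  apply: measureU_eq0; [exact: mW|exact: measurableU|exact: W0|].
  by apply: measureU_eq0; [exact: mI|exact: mC|exact: A4_null|exact: out_null].
apply/eqP; rewrite eq_le measure_ge0 andbT -[leRHS]U0.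
apply: le_measure; rewrite ?inE.
- exact: measurable_neq_set.
- apply: measurableU => //.
  by apply: measurableU; [exact: measurableI|exact: measurableC].
move=> z /= fb; apply: contrapT => nU.
have Dz : D3 z by apply: contrapT => nD; apply: nU; right; right.
have oz : (osc z <= (ht z)%:E)%E.
  by apply: contrapT => /negP/negbTE h1; apply: nU; left; left.
have ez : ext z y = f z y.
  by apply/eqP; apply: contrapT => /negP h1; apply: nU; left; right.
have bz : (extension_bound f omega z < +oo)%E.
  by rewrite ltey; apply/eqP => h1; apply: nU; right; left.
move/eqP : fb; apply; rewrite smooth_versionE//.
exact: le_lt_trans oz (ltry _).
Qed.

(** At positive time lag the convolution sees [g'] only up to Lebesgue null sets, so equality at
    almost every [y] is enough. The exceptional set has to be predictable in order to be null for
    the jump measure. *)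
Lemma smooth_version_ae : exists A : set FZ, [/\ measurable (A : set PZ), PQ A = 0 &
  forall z, D3 z -> ~ A z -> exists Z : set V, [/\ measurable Z, lebesgue_rV d Z = 0%E &
    forall y, ~ Z y -> g' z.1 z.2.1 z.2.2 y = b z y]].
Proof.
(* [A3] is shown measurable twice: over [PZ], so that the exceptional set is predictable, and over
   the full product, where Fubini's theorem is applied. *)
pose A3 : set (PZ * V) := [set q | f q.1 q.2 != b q.1 q.2].
have cb z : continuous (b z).
  exact: (continuous_smooth_version omega0 omega_gt0 comega omega_small).
have mA3 : measurable A3.
  apply: measurable_neq_set => //.
  apply: (@measurable_caratheodory R d _ PZ (fun z y => b z y)) => // y.
  exact: (measurable_smooth_version measurable_predictable_data omega0 omega_gt0 omega_small y).
have idm : measurable_fun [set: FZ] (id : FZ -> PZ).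
  by apply: full; exact: measurable_id.
have mfjF : measurable_fun [set: FZ * V] (fun q => f q.1 q.2).
  have mp : measurable_fun [set: FZ * V] (fun q : FZ * V => ((q.1 : PZ), q.2)).
    apply/measurable_fun_pairP; split; last exact: measurable_snd.
    exact: (measurableT_comp idm measurable_fst).
  exact: (measurableT_comp mfj mp).
have mA3F : measurable (A3 : set (FZ * V)).
  apply: measurable_neq_set => //.
  by apply: (@measurable_caratheodory R d _ FZ (fun z y => b z y)).
exists [set z | (lebesgue_rV d (xsection A3 z) != 0)%E]; split.
- exact: measurable_bad_xsection.
- apply: (@null_xsection _ _ FZ V R PQ (lebesgue_rV d) A3 mA3F).
  apply: null_ysections; first exact: mA3F.
  move=> y; have -> : ysection A3 y = [set z | f z y != b z y].
    by apply/seteqP; split => z; [move=> /ysectionP|move=> h1; apply/ysectionP].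
  exact: smooth_version_null.
- move=> z Dz /= nA; exists (xsection A3 z); split.
  + exact: measurable_xsection.
  + by apply/eqP; apply: contrapT => /negP.
  + move=> y ny; rewrite -predictable_data_in//; apply/eqP; apply: contrapT => /negP h1.
    by apply: ny; apply/xsectionP.
Qed.

End predictable_data.

(** * The compensated field *)

Lemma powRD_double {R : realType} (p a b : R) : 0 <= p -> 0 <= a -> 0 <= b ->
  (a + b) `^ p <= 2 `^ p * (a `^ p + b `^ p).
Proof.
move=> p0 a0 b0; wlog ab : a b a0 b0 / a <= b.
  move=> ih; have /orP[ab|ba] := le_total a b; first exact: ih.
  by rewrite addrC (addrC (a `^ p)); exact: ih.
apply: (@le_trans _ _ ((2 * b) `^ p)).
  by apply: powR_le => //; [exact: addr_ge0|rewrite mulr_natl mulr2n lerD2r].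
by rewrite powRM// ler_wpM2l ?powR_ge0// lerDr powR_ge0.
Qed.

Section finite_integrals.
Local Open Scope ereal_scope.
Context {R : realType} dT (T : measurableType dT) (mu : {measure set T -> \bar R}).
Variables (D : set T) (X Y : T -> \bar R).

Lemma lte_integralD : measurable D -> measurable_fun D X -> measurable_fun D Y ->
  (forall x, 0 <= X x) -> (forall x, 0 <= Y x) ->
  \int[mu]_(x in D) X x < +oo -> \int[mu]_(x in D) Y x < +oo ->
  \int[mu]_(x in D) (X x + Y x) < +oo.
Proof. by move=> mD mX mY X0 Y0 hX hY; rewrite ge0_integralD//; exact: lte_add_pinfty. Qed.

Lemma lte_integralZ (k : R) : measurable D -> (0 <= k)%R -> measurable_fun D X ->
  (forall x, 0 <= X x) -> \int[mu]_(x in D) X x < +oo ->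
  \int[mu]_(x in D) (k%:E * X x) < +oo.
Proof.
move=> mD k0 mX X0 hX; rewrite ge0_integralZl ?lee_fin//.
by apply: lte_mul_pinfty; rewrite ?lee_fin.
Qed.

End finite_integrals.

Section finite_moment.
Local Open Scope ereal_scope.
Context {R : realType} dT (T : measurableType dT) (mu : {measure set T -> \bar R}).

Lemma lte_integral_powRD (f : T -> \bar R) (U W : T -> R) (C p : R) :
  (0 <= p)%R -> (0 <= C)%R -> measurable_fun setT U -> measurable_fun setT W ->
  (forall x, (0 <= U x)%R) -> (forall x, (0 <= W x)%R) ->
  measurable_fun setT f -> (forall x, 0 <= f x) ->
  (forall x, f x <= (C * (U x + W x) `^ p)%:E) ->
  \int[mu]_x (U x `^ p)%:E < +oo -> \int[mu]_x (W x `^ p)%:E < +oo ->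
  \int[mu]_x f x < +oo.
Proof.
move=> p0 C0 mU mW U0 W0 mf f0 fUW hU hW.
have mp (Z : T -> R) : measurable_fun setT Z -> measurable_fun setT (fun x => (Z x `^ p)%:E).
  by move=> mZ; apply/measurable_EFinP; exact: (measurableT_comp (measurable_powR _)).
have mD : measurable_fun setT (fun x => (U x `^ p)%:E + (W x `^ p)%:E).
  by apply: emeasurable_funD; exact: mp.
apply: (@le_lt_trans _ _ (\int[mu]_x ((C * 2 `^ p)%:E * ((U x `^ p)%:E + (W x `^ p)%:E)))).
  apply: ge0_le_integral => //; first exact: measurable_funeM.
  move=> x _; apply: (le_trans (fUW x)); rewrite -EFinD -EFinM lee_fin -mulrA.
  by apply: (ler_wpM2l C0); exact: powRD_double.
apply: lte_integralZ => //.
- by rewrite mulr_ge0// powR_ge0.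
- by move=> x; rewrite adde_ge0// lee_fin powR_ge0.
by apply: lte_integralD => //; [exact: mp|exact: mp|move=> x|move=> x]; rewrite lee_fin powR_ge0.
Qed.

End finite_moment.

Section compensated_field.
Context {R : realType} {d : nat} {dO : measure_display} {Omega : measurableType dO}.
Local Notation V := 'rV[R]_d.
Local Notation FZ := (Omega * (R * V))%type.
Variables (P : probability Omega R) (alpha : R) (K : R -> V -> R).
Hypothesis hK : is_heat_kernel alpha K.
Variables (E : set V) (mE : measurable E).
Variables (M : Omega -> {measure set (R * V) -> \bar R}) (Q : {measure set (R * V) -> \bar R}).
Local Notation S t := (`]0%R, t] `*` E).
Hypothesis measurable_integrals : forall (f : FZ -> \bar R) (t : R),
  measurable_fun (setT `*` S t) f ->
  measurable_fun setT (fun w => \int[M w]_(z in S t) f (w, z))%E /\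
  measurable_fun setT (fun w => \int[Q]_(z in S t) f (w, z))%E.
Variables (b : FZ -> V -> R) (G H : FZ -> R) (omega : R -> R).
Hypotheses (mb : forall y, measurable_fun setT (b ^~ y)).
Hypotheses (cb : forall z, continuous (b z)) (bG : forall z y, `|b z y| <= G z).
Hypothesis bH : forall z x y, `|b z x - b z y| <= omega (enorm (x - y)) * H z.
Hypotheses (G0 : forall z, 0 <= G z) (H0 : forall z, 0 <= H z).
Hypotheses (mG : measurable_fun setT G) (mH : measurable_fun setT H).
Hypotheses (omega0 : omega 0 = 0) (omega_gt0 : forall r, 0 < r -> 0 < omega r).
Hypothesis omega_small : forall e, 0 < e ->
  exists2 r, 0 < r & forall s, 0 < s -> s < r -> omega s < e.

Let mS (t : R) : measurable (S t). Proof. exact: measurableX. Qed.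

Let GH z := (G z + H z)%:E.

Definition finite_strips : set Omega := [set w | forall k : nat,
  (\int[M w]_(z in S k.+1%:R) (G (w, z) + H (w, z))%:E < +oo /\
   \int[Q]_(z in S k.+1%:R) (G (w, z) + H (w, z))%:E < +oo)%E].

Let mGH : measurable_fun setT GH.
Proof. by apply/measurable_EFinP; exact: measurable_funD. Qed.

Lemma measurable_finite_strips : measurable finite_strips.
Proof.
rewrite (_ : finite_strips = \bigcap_k
  ([set w | (\int[M w]_(z in S k.+1%:R) GH (w, z) < +oo)%E] `&`
   [set w | (\int[Q]_(z in S k.+1%:R) GH (w, z) < +oo)%E])); last first.
  by apply/seteqP; split => w hw k; [move=> _; exact: hw|exact: hw].
apply: bigcap_measurable => // k _.
have [m1 m2] := measurable_integrals (t := k.+1%:R) (measurable_funTS mGH).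
apply: measurableI.
  by have := emeasurable_fun_infty_o measurableT m1 +oo%E; rewrite setTI.
by have := emeasurable_fun_infty_o measurableT m2 +oo%E; rewrite setTI.
Qed.

Let sec (f : FZ -> R) w : measurable_fun setT f -> measurable_fun setT (fun z => f (w, z)).
Proof. by move=> mf; apply: (measurableT_comp mf); exact: measurable_pair1. Qed.

Let fin (m : {measure set (R * V) -> \bar R}) w (f : FZ -> R) : measurable_fun setT f ->
  (forall z, 0 <= f z) -> (forall z, f z <= G z + H z) ->
  (forall k : nat, \int[m]_(z in S k.+1%:R) (G (w, z) + H (w, z))%:E < +oo)%E ->
  forall t : R, (\int[m]_(z in S t) (f (w, z))%:E < +oo)%E.
Proof.
move=> mf f0 fGH hm t; apply: le_lt_trans (hm (Num.truncn `|t|)).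
apply: (@le_trans _ _ (\int[m]_(z in S (Num.truncn `|t|).+1%:R) (f (w, z))%:E)%E).
  apply: (@ge0_subset_integral _ _ _ m _ _ (mS _) (mS _) (fun z => (f (w, z))%:E)).
  - by apply/measurable_EFinP/measurable_funTS; exact: sec.
  - by move=> z _; rewrite lee_fin.
  move=> [s v] [/=]; rewrite !in_itv/= => /andP[s0 st] Ev; split => //=.
  rewrite s0 (le_trans st)// (le_trans (ler_norm t))//.
  exact/ltW/truncnS_gt.
apply: ge0_le_integral; first exact: mS.
- by move=> z _; rewrite lee_fin.
- by apply/measurable_EFinP/measurable_funTS; exact: sec.
- by apply: measurable_funTS; apply: (measurableT_comp mGH); exact: measurable_pair1.
- by move=> z _; rewrite lee_fin.
Qed.

Let GleGH z : G z <= G z + H z. Proof. by rewrite lerDl. Qed.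
Let HleGH z : H z <= G z + H z. Proof. by rewrite lerDr. Qed.

(** The value 0 off [finite_strips] makes the modulus and right-continuity hold for every sample,
    which the measurability of the supremum requires. *)
Definition compensated_field (t : R) (x : V) (w : Omega) : R :=
  ((fun w => conv_integral K (M w) E (fun z => b (w, z)) t x -
             conv_integral K Q E (fun z => b (w, z)) t x) \_ finite_strips) w.

Let J := compensated_field.

Lemma measurable_compensated_field t x : measurable_fun setT (J t x).
Proof.
apply/(measurable_restrictT _ measurable_finite_strips); apply: measurable_funTS.
have mh : measurable_fun (setT `*` S t)
    (fun q : FZ => heat_conv K (t - q.2.1) (b q) x).
  apply: (measurable_heat_conv hK (b := b) x _ (s := fun q : FZ => t - q.2.1)) => //.
  - by apply: measurableX => //; exact: mS.
  - by move=> [w [s v]] [_ [/=]]; rewrite in_itv/= subr_ge0 => /andP[].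
  - apply: measurable_funB; first exact: measurable_cst.
    exact: (measurableT_comp measurable_fst measurable_snd).
have [m1 m2] := measurable_integrals (proj2 (measurable_EFinP _ _) mh).
apply: measurable_funB.
  exact: (measurableT_comp (@fine_measurable _ _ measurableT) m1).
exact: (measurableT_comp (@fine_measurable _ _ measurableT) m2).
Qed.

Definition modulus_constant (t : R) (w : Omega) : R :=
  fine (\int[M w]_(z in S t) (H (w, z))%:E) + fine (\int[Q]_(z in S t) (H (w, z))%:E).

Let fine0 (m : {measure set (R * V) -> \bar R}) t w : 0 <= fine (\int[m]_(z in S t) (H (w, z))%:E).
Proof. by rewrite fine_ge0// integral_ge0// => z _; rewrite lee_fin. Qed.

Let omega_ge0 r : 0 <= r -> 0 <= omega r.
Proof. by rewrite le_eqVlt => /predU1P[<-|/omega_gt0/ltW//]; rewrite omega0. Qed.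

Let Jin t x w : finite_strips w -> J t x w = conv_integral K (M w) E (fun z => b (w, z)) t x -
             conv_integral K Q E (fun z => b (w, z)) t x.
Proof. by move=> gw; rewrite /J /compensated_field patchE mem_set. Qed.

Let Jout t x w : ~ finite_strips w -> J t x w = 0.
Proof. by move=> gw; rewrite /J /compensated_field patchE memNset. Qed.

Let wmb w y : measurable_fun setT (fun z => b (w, z) y).
Proof. exact: (sec (f := fun q => b q y)). Qed.

Lemma compensated_field_modulus t x y w :
  `|J t x w - J t y w| <= omega (enorm (x - y)) * modulus_constant t w.
Proof.
have [gw|ngw] := pselect (finite_strips w); last first.
  by rewrite !Jout// subrr normr0 mulr_ge0 ?omega_ge0 ?enorm_ge0// addr_ge0// fine0.
rewrite !Jin//; set a := conv_integral _ (M w) _ _ _ x; set a' := conv_integral _ Q _ _ _ x.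
set e := conv_integral _ (M w) _ _ _ y; set e' := conv_integral _ Q _ _ _ y.
rewrite (_ : a - a' - (e - e') = (a - e) - (a' - e')); last by ring.
rewrite /modulus_constant mulrDr (le_trans (ler_normB _ _))// lerD//.
  apply: (conv_integral_modulus hK mE (G := fun z => G (w, z)) (H := fun z => H (w, z))) => //.
  - exact: sec.
  - exact: sec.
  - by apply: fin => // k; have [] := gw k.
  - by apply: fin => // k; have [] := gw k.
apply: (conv_integral_modulus hK mE (G := fun z => G (w, z)) (H := fun z => H (w, z))) => //.
- exact: sec.
- exact: sec.
- by apply: fin => // k; have [] := gw k.
- by apply: fin => // k; have [] := gw k.
Qed.

Let modulus_constant_ge0 t w : 0 <= modulus_constant t w.
Proof. by rewrite addr_ge0// fine0. Qed.

Lemma continuous_compensated_field t w : continuous (fun x => J t x w).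
Proof.
exact: (continuous_of_modulus omega0 omega_gt0 omega_small (modulus_constant_ge0 t w)
  (fun x y => compensated_field_modulus t x y w)).
Qed.

Lemma compensated_field_cvg_right w t (t_ : nat -> R) x : 0 <= t ->
  (forall n, t < t_ n <= t + 1) -> t_ n @[n --> \oo] --> t ->
  J (t_ n) x w @[n --> \oo] --> J t x w.
Proof.
move=> t0 tt ct; have [gw|ngw] := pselect (finite_strips w); last first.
  rewrite Jout// (_ : (fun n => _) = cst 0); first exact: cvg_cst.
  by apply/funext => n; rewrite Jout.
rewrite Jin// (_ : (fun n => _) = (fun n =>
    conv_integral K (M w) E (fun z => b (w, z)) (t_ n) x -
    conv_integral K Q E (fun z => b (w, z)) (t_ n) x)); last first.
  by apply/funext => n; rewrite Jin.
apply: cvgB.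
  apply: (conv_integral_cvg_right hK mE (G := fun z => G (w, z))) => //; first exact: sec.
  by apply: fin => // k; have [] := gw k.
apply: (conv_integral_cvg_right hK mE (G := fun z => G (w, z))) => //; first exact: sec.
by apply: fin => // k; have [] := gw k.
Qed.

Variables (phi : R -> R) (p beta T c1 C : R).
Hypotheses (hd : (0 < d)%N) (p1 : 1 <= p) (beta0 : 0 < beta) (T0 : 0 < T) (c10 : 0 < c1).
Hypothesis phi_gt0 : forall r : R, 0 < r -> 0 < phi r.
Hypothesis phi0 : phi 0 = 0.
Hypothesis cphi : forall r : R, 0 < r -> {for r, continuous phi}.
Hypothesis C0 : 0 <= C.
Hypothesis omega_ratio : forall r z, 0 < r -> r <= 2 * c1 -> 0 <= z ->
  (omega r * z) `^ p / phi r `^ (beta * p) <= C * z `^ p.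

Let p0 : 0 < p. Proof. exact: lt_le_trans p1. Qed.

Let modulus_constant_le t w : finite_strips w -> t <= T ->
  modulus_constant t w <= modulus_constant T w.
Proof.
move=> gw tT.
have sub (m : {measure set (R * V) -> \bar R}) :
    (forall t : R, (\int[m]_(z in S t) (H (w, z))%:E < +oo)%E) ->
    fine (\int[m]_(z in S t) (H (w, z))%:E) <= fine (\int[m]_(z in S T) (H (w, z))%:E).
  move=> finm; have I0 s : (0 <= \int[m]_(z in S s) (H (w, z))%:E)%E.
    by apply: integral_ge0 => z _; rewrite lee_fin.
  apply: fine_le; rewrite ?ge0_fin_numE//.
  apply: (@ge0_subset_integral _ _ _ m _ _ (mS _) (mS _) (fun z => (H (w, z))%:E)).
  - by apply/measurable_EFinP/measurable_funTS; exact: sec.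
  - by move=> z _; rewrite lee_fin.
  - move=> [s v] [/=]; rewrite !in_itv/= => /andP[s0 st] Ev; split => //=.
    by rewrite s0 (le_trans st).
by apply: lerD; apply: sub; apply: fin => // k; have [] := gw k.
Qed.

Lemma sup_modulus_le w :
  (sup_modulus phi p beta T c1 J w <= (C * modulus_constant T w `^ p)%:E)%E.
Proof.
apply: ge_ereal_sup => s [t /= + <-]; rewrite in_itv/= => /andP[t0 tT].
apply: ge_ereal_sup => _ [[x y] [/= xc yc xy] <-]; rewrite lee_fin.
have [gw|ngw] := pselect (finite_strips w); last first.
  rewrite !Jout// subrr normr0 powR0 ?gt_eqF// mul0r.
  by rewrite mulr_ge0// powR_ge0.
have n0 : 0 < enorm (x - y) by apply: enorm_gt0; rewrite subr_eq0; exact/eqP.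
apply: (@le_trans _ _ ((omega (enorm (x - y)) * modulus_constant t w) `^ p /
    phi (enorm (x - y)) `^ (beta * p))).
  rewrite ler_wpM2r ?invr_ge0 ?powR_ge0//.
  by apply: powR_le; [exact: ltW|exact: normr_ge0|exact: compensated_field_modulus].
apply: (@le_trans _ _ (C * modulus_constant t w `^ p)).
  by apply: omega_ratio => //; exact: enorm_sub_le.
apply: (ler_wpM2l C0); apply: (powR_le (ltW p0) (modulus_constant_ge0 t w)).
exact: (modulus_constant_le gw tT).
Qed.

Let sup_modulus_ge0 w : (0 <= sup_modulus phi p beta T c1 J w)%E.
Proof.
(* Together with 0 this is a pair of distinct points of the ball; a supremum over no pair would be
   [-oo]. Its existence uses [0 < d]. *)
pose x : V := (c1 / 2) *: delta_mx 0 (Ordinal hd).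
have xE : enorm x = c1 / 2.
  rewrite /enorm (bigD1 (Ordinal hd))//= big1.
    by rewrite addr0 !mxE !eqxx mulr1 sqrtr_sqr gtr0_norm// divr_gt0.
  by move=> i iN; rewrite !mxE eqxx (negbTE iN) mulr0 expr0n.
apply: (@le_trans _ _ (`|J 0 x w - J 0 0 w| `^ p / phi (enorm (x - 0)) `^ (beta * p))%:E).
  by rewrite lee_fin mulr_ge0 ?powR_ge0// invr_ge0 powR_ge0.
apply: (@le_trans _ _ (ereal_sup [set (`|J 0 q.1 w - J 0 q.2 w| `^ p /
    phi (enorm (q.1 - q.2)) `^ (beta * p))%:E
    | q in [set q : V * V | [/\ eball c1 q.1, eball c1 q.2 & q.1 <> q.2]]])).
  apply: ereal_sup_ubound; exists (x, 0) => //; split => /=.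
  - by rewrite /eball/= xE ltr_pdivrMr// ltr_pMr// ltr1n.
  - by rewrite /eball/= enorm0.
  - move=> x0; have : 0 < enorm x by rewrite xE divr_gt0.
    by rewrite x0 enorm0 ltxx.
by apply: ereal_sup_ubound; exists 0 => //=; rewrite in_itv/= lexx ltW.
Qed.

Hypothesis momentM :
  (\int[P]_w (fine (\int[M w]_(z in S T) (H (w, z))%:E) `^ p)%:E < +oo)%E.
Hypothesis momentQ :
  (\int[P]_w (fine (\int[Q]_(z in S T) (H (w, z))%:E) `^ p)%:E < +oo)%E.

Lemma integrable_sup_modulus : P.-integrable setT (sup_modulus phi p beta T c1 J).
Proof.
have ms : measurable_fun setT (sup_modulus phi p beta T c1 J).
  apply: measurable_sup_modulus => //.
  - by move=> t x _; exact: measurable_compensated_field.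
  - by move=> w t _; exact: continuous_compensated_field.
  - by move=> w t t_ x; exact: compensated_field_cvg_right.
apply/integrableP; split => //; under eq_integral do rewrite gee0_abs//.
have mHE : measurable_fun (setT `*` S T) (EFin \o H).
  exact/measurable_EFinP/measurable_funTS.
have [m1 m2] := measurable_integrals mHE.
pose X w := fine (\int[M w]_(z in S T) (H (w, z))%:E).
pose Y w := fine (\int[Q]_(z in S T) (H (w, z))%:E).
have mX : measurable_fun setT X := measurableT_comp (@fine_measurable _ _ measurableT) m1.
have mY : measurable_fun setT Y := measurableT_comp (@fine_measurable _ _ measurableT) m2.
apply: (@lte_integral_powRD _ _ _ P _ X Y C p _ C0 mX mY).
- exact: ltW.
- by move=> w; exact: fine0.
- by move=> w; exact: fine0.
- exact: ms.
- exact: sup_modulus_ge0.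
- exact: sup_modulus_le.
- exact: momentM.
- exact: momentQ.
Qed.

End compensated_field.

Lemma eq_Rintegral_null {R : realType} dT (T : measurableType dT)
    (mu : {measure set T -> \bar R}) (D Z : set T) (f g : T -> R) :
  measurable Z -> mu Z = 0%E -> (forall x, D x -> ~ Z x -> f x = g x) ->
  \int[mu]_(x in D) f x = \int[mu]_(x in D) g x.
Proof.
move=> mZ Z0 fg; rewrite /Rintegral; congr fine.
by apply: (eq_integral_null mZ Z0) => x Dx nZ; rewrite fg.
Qed.

(** * Comparison with the mild solution *)

Section realization.
Context {R : realType} {d : nat} {dO : measure_display} {Omega : measurableType dO}.
Local Notation V := 'rV[R]_d.
Variables (P : probability Omega R) (F : R -> set (set Omega)).
Hypothesis hF : right_continuous_filtration F.
Variables (c : R) (nu : {measure set V -> \bar R}).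
Local Notation E := (punctured_ball c : set V).
Variable N : R.-ker Omega ~> (R * V)%type.
Hypothesis hN : poisson_random_measure P E nu F N.
Variable B : (set V)^nat.
Hypotheses (mE : measurable E) (mB : forall n, measurable (B n)).
Hypotheses (ndB : nondecreasing_seq B) (EB : E = \bigcup_n B n).
Hypothesis nuB : forall n, (nu (B n) < +oo)%E.
Variables (alpha : R) (K : R -> V -> R).
Hypothesis hK : is_heat_kernel alpha K.

Local Notation M := (jump_measure N B mE).
Local Notation Q := (intensity mE mB EB nuB).
Local Notation PZ := (g_sigma_algebraType (predictable_class P F E B)).
Local Notation PQ := (prod_sigma_finite P Q).
Local Notation S t := (`]0%R, t] `*` E).
Local Notation D3 := (setT `*` jump_domain E : set (Omega * (R * V))).
Local Notation FZ := (Omega * (R * V))%type.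

Variables (g' : Omega -> R -> V -> V -> R) (b : FZ -> V -> R) (G : FZ -> R) (A : set FZ).
Hypothesis mbP : forall y, measurable_fun [set: PZ] (b ^~ y).
Hypothesis cb : forall z, continuous (b z).
Hypotheses (bG : forall z y, `|b z y| <= G z) (G0 : forall z, 0 <= G z).
Hypothesis mG : measurable_fun setT G.
Variable f : FZ -> V -> R.
Hypothesis fg' : forall z y, D3 z -> f z y = g' z.1 z.2.1 z.2.2 y.
Hypothesis mf : forall y, measurable_fun [set: PZ] (f ^~ y).
Hypothesis fb : forall y, PQ [set z | f z y != b z y] = 0%E.
Hypotheses (mA : measurable (A : set PZ)) (A0 : PQ A = 0%E).
Hypothesis g'A : forall z, D3 z -> ~ A z -> exists Z : set V,
  [/\ measurable Z, lebesgue_rV d Z = 0%E & forall y, ~ Z y -> g' z.1 z.2.1 z.2.2 y = b z y].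

Let mS (t : R) : measurable (S t). Proof. exact: measurableX. Qed.

Let mb y : measurable_fun [set: FZ] (b ^~ y).
Proof. exact: (predictable_measurable_fun mE (@mbP y)). Qed.

(** The set [W] has two parts. Off [A], [g'] and [b] agree at almost every point, which decides the
    convolution at nonzero lag; at lag 0 it is the value at [x], so agreement at [x] itself is
    imposed too. [W] is predictable and null, hence almost surely null for both measures,
    simultaneously for all [t]. *)
Lemma compensated_integralE x : {ae P, forall w,
  (forall t, (\int[Q]_(z in S t) (G (w, z))%:E < +oo)%E) -> forall t : R,
  compensated_integral E nu N w t (fun r v => heat_conv K (t - r) (g' w r v) x) =
  conv_integral K (M w) E (fun z => b (w, z)) t x - conv_integral K Q E (fun z => b (w, z)) t x}.
Proof.
pose W : set FZ := A `|` [set z | f z x != b z x].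
have mW1 : measurable ([set z | f z x != b z x] : set PZ).
  by apply: measurable_neq_set; [exact: mf|exact: mbP].
have mWP : measurable (W : set PZ) by apply: measurableU; [exact: mA|exact: mW1].
have mW := predictable_full mE mWP.
have W0 : PQ W = 0%E.
  apply: measureU_eq0; [exact: (predictable_full mE mA)|exact: (predictable_full mE mW1)|
    exact: A0|exact: fb].
have hM := null_jump hF hN ndB mWP W0.
have hQ := null_intensity mW W0.
have hfs : {ae P, forall w, finite_samples N B w}.
  apply: (ae_of_null _ (finite_samples_full hN mB EB nuB)).
    by apply: measurableC; exact: measurable_finite_samples.
  by move=> w /contrapT.
have point w r v (t : R) : 0 < r -> E v -> ~ W (w, (r, v)) ->
    heat_conv K (t - r) (g' w r v) x = heat_conv K (t - r) (b (w, (r, v))) x.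
  move=> r0 Ev nW; have Dz : D3 (w, (r, v)).
    by split => //; split => //=; rewrite in_itv/= r0.
  rewrite /heat_conv; case: ifP => _.
    have := fg' x Dz; rewrite /= => <-.
    by apply/eqP; apply: contrapT => /negP h1; apply: nW; right.
  have nA : ~ A (w, (r, v)) by move=> ?; apply: nW; left.
  have [Z [mZ Z0 hZ]] := g'A Dz nA.
  apply: (eq_Rintegral_null mZ Z0) => y _ nZ.
  by rewrite -hZ.
apply: (ae_imply (filterI hM (filterI hQ hfs))) => w [Mw [Qw fs]] finG t.
have mxW : measurable (xsection W w) by exact: measurable_xsection.
have wmb y : measurable_fun setT (fun z => b (w, z) y).
  by apply: (measurableT_comp (mb y)); exact: measurable_pair1.
have mJ : measurable (jump_domain E : set (R * V)) by exact: measurableX.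
rewrite /compensated_integral; congr (_ - _).
  have Nw : N w (xsection W w `&` jump_domain E) = 0%E.
    by rewrite -(jump_measureE mE _ fs).
  rewrite (eq_Rintegral_null (mu := N w) (measurableI _ _ mxW mJ) Nw
     (g := fun z => heat_conv K (t - z.1) (b (w, z)) x)); last first.
    move=> [r v] [/=]; rewrite in_itv/= => /andP[r0 rt] Ev nW; rewrite point//.
    move=> Wz; apply: nW; split; first exact/xsectionP.
    by split => //=; rewrite in_itv/= r0.
  rewrite /conv_integral /Rintegral; congr fine; apply: eq_measure_integral => C mC CS; rewrite jump_measureE//.
  congr (N w _); apply/esym/setIidl => -[r v] /CS[/=].
  by rewrite in_itv/= => /andP[r0 _] Ev; split => //=; rewrite in_itv/= r0.
pose f2 : R * V -> R := (fun z => heat_conv K (t - z.1) (b (w, z)) x) \_ (S t).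
have mf2 : measurable_fun setT f2.
  apply/(measurable_restrictT _ (mS t)).
  exact: (measurable_heat_section hK mE (b := fun z => b (w, z)) wmb (fun z => @cb (w, z))).
have if2 : Q.-integrable (S t) (EFin \o f2).
  apply: (@eq_integrable _ _ _ Q _ (mS t) (EFin \o (fun z => heat_conv K (t - z.1) (b (w, z)) x))).
    by move=> z zS; rewrite /= /f2 patchE zS.
  apply: (integrable_heat_section hK mE (G := fun z => G (w, z))) => //.
  by apply: (measurableT_comp mG); exact: measurable_pair1.
have -> : conv_integral K Q E (fun z => b (w, z)) t x = \int[Q]_(z in S t) f2 z.
  by apply: eq_Rintegral => z zS; rewrite /f2 patchE zS.
rewrite (Rintegral_intensity mf2 if2).
(* The compensator is an iterated integral: off these exceptional times, the marks where [g'] and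
   [b] may differ form a null set for [nu]. *)
pose Zr := [set r | (mark_measure mE mB EB nuB (xsection (xsection W w) r) != 0)%E].
have mZr : measurable (Zr `&` `]0, +oo[%classic : set R).
  by apply: measurableI => //; exact: measurable_bad_xsection.
have Zr0 : @lebesgue_measure R (Zr `&` `]0, +oo[%classic) = 0%E.
  exact: (@null_xsection _ _ _ _ _ (@time_measure R) (mark_measure mE mB EB nuB) _ mxW Qw).
apply: (@eq_Rintegral_null R _ _ (@lebesgue_measure R) _ (Zr `&` `]0, +oo[%classic));
  [exact: mZr|exact: Zr0|].
move=> r /= + nZ; rewrite in_itv/= => /andP[r0 rt].
have Er0 : nu (xsection (xsection W w) r `&` E) = 0%E.
  apply/eqP; apply: contrapT => /negP h1; apply: nZ; split => //=.
  by rewrite in_itv/= r0.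
have msec : measurable (xsection (xsection W w) r `&` E).
  by apply: measurableI => //; exact: measurable_xsection.
apply: (eq_Rintegral_null msec Er0) => v Ev nW.
have nWz : ~ W (w, (r, v)).
  by move=> Wz; apply: nW; split => //; apply/xsectionP; exact/xsectionP.
rewrite point// /f2 patchE mem_set//; split => //=.
by rewrite in_itv/= r0.
Qed.

End realization.

(** * Realization and integrability of its modulus *)

Lemma le_poweR_1D {R : realType} (p : R) (x : \bar R) : 1 <= p -> (0 <= x)%E ->
  (x <= 1 + x `^ p)%E.
Proof.
move=> p1; case: x => [x| |] //=; last by rewrite gt_eqF ?(lt_le_trans ltr01)// leey.
rewrite !lee_fin => x0.
have [x1|x1] := leP x 1; first by rewrite (le_trans x1)// lerDl powR_ge0.
by rewrite (@le_trans _ _ (x `^ p)) ?lerDr// -[leLHS]powRr1// ler_powR// ltW.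
Qed.

Lemma fine_powR_le {R : realType} (p : R) (x : \bar R) : 1 <= p -> (0 <= x)%E ->
  ((fine x `^ p)%:E <= x `^ p)%E.
Proof.
move=> p1; case: x => [x| |] // _.
by rewrite poweRyr ?leey// gt_eqF// (lt_le_trans ltr01).
Qed.

Theorem theorem3p1 (R : realType) (d : nat) (hd : (0 < d)%N)
  (dO : measure_display) (Omega : measurableType dO) (P : probability Omega R)
  (hP : measure_is_complete P)
  (F : R -> set (set Omega)) (hF : right_continuous_filtration F)
  (c : R) (hc : 0 < c)
  (nu : {measure set 'rV[R]_d -> \bar R})
  (hnu : levy_measure (punctured_ball c) nu)
  (N : R.-ker Omega ~> (R * 'rV[R]_d)%type)
  (hN : poisson_random_measure P (punctured_ball c) nu F N)
  (alpha : R) (halpha0 : 0 < alpha) (halpha2 : alpha <= 2)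
  (K : R -> 'rV[R]_d -> R) (hK : is_heat_kernel alpha K)
  (g : Omega -> R -> 'rV[R]_d -> 'rV[R]_d -> R)
  (hg : in_L1_L1loc_L1_Loo P (punctured_ball c) nu g)
  (hgF : adapted P F (punctured_ball c) g)
  (p theta : R) (hp : 1 <= p) (htheta0 : 0 < theta) (hthetap : theta < p^-1)
  (phi : R -> R)
  (hphi_ge0 : forall r : R, 0 < r -> 0 <= phi r)
  (hphi_mono : forall r s : R, 0 < r -> r <= s -> phi r <= phi s)
  (hphi_cont : forall r : R, 0 < r -> {for r, continuous phi})
  (hphi_lim : phi r @[r --> 0^'+] --> 0)
  (hphi_0 : phi 0 = 0)
  (hphi_sum : (\sum_(0 <= i <oo) (phi (2 ^- i) `^ theta)%:E < +oo)%E)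
  (lambda : R) (hlambda : 1 <= lambda)
  (hphi_doubling : \forall n \near \oo,
     lambda^-1 <= phi (2 ^- n) / phi (2 ^- n.+1) /\
     phi (2 ^- n) / phi (2 ^- n.+1) <= lambda)
  (h : Omega -> R -> 'rV[R]_d -> R)
  (hh_ge0 : forall w (t : R) v, 0 <= t -> punctured_ball c v -> 0 <= h w t v)
  (hh : in_Lp_L1loc_Lploc P (punctured_ball c) nu p h)
  (hgh : forall x y : 'rV[R]_d, ae_wtv P (punctured_ball c) nu (fun w t v =>
     `|g w t v x - g w t v y| <=
     h w t v * enorm (x - y) `^ (d%:R / p) * phi (enorm (x - y)) `^ p^-1))
  (u : R -> 'rV[R]_d -> Omega -> R)
  (hu : is_mild_solution P F (punctured_ball c) nu N K g u) :
  exists ut : R -> 'rV[R]_d -> Omega -> R,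
    [/\ is_realization P u ut,
        continuous_in_space P ut &
        forall beta T c1 : R, 0 < beta -> beta <= p^-1 - theta ->
          0 < T -> 0 < c1 ->
          P.-integrable setT (sup_modulus phi p beta T c1 ut)].
Proof.
have [g' [hp' hver] hcomp] := hu; have [mg finN] := hg; have [mh hh1 hhp] := hh.
pose E : set 'rV[R]_d := punctured_ball c.
pose B := @levy_piece R d c.
have mE : measurable E by exact: measurable_punctured_ball.
have mB n : measurable (B n) by exact: measurable_levy_piece.
have ndB : nondecreasing_seq B by exact: nondecreasing_levy_piece.
have EB : E = \bigcup_n B n by exact: bigcup_levy_piece.
have nuB n : (nu (B n) < +oo)%E by exact: levy_piece_fin.
have p0 : 0 < p by exact: lt_le_trans hp.
have phi_gt0 : forall r, 0 < r -> 0 < phi r.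
  exact: (modulus_function_gt0 hphi_mono hphi_ge0 hlambda hphi_doubling).
pose omega := space_modulus d p phi.
have omega0 : omega 0 = 0 by exact: space_modulus0.
have omega_gt0 : forall r, 0 < r -> 0 < omega r by move=> r; exact: space_modulus_gt0.
have comega : forall r, 0 < r -> {for r, continuous omega}.
  by move=> r; exact: continuous_space_modulus.
have omega_small : forall e, 0 < e ->
    exists2 r, 0 < r & forall s, 0 < s -> s < r -> omega s < e.
  by move=> e; exact: space_modulus_small.
have hgh' : forall x y : 'rV[R]_d, ae_wtv P E nu (fun w t v =>
    `|g w t v x - g w t v y| <= h w t v * omega (enorm (x - y))).
  by move=> x y; apply: ae_wtv_mono (hgh x y) => w t v _ _; rewrite mulrA.
pose M w := jump_measure N B mE w.
pose Q : {measure set (R * 'rV[R]_d) -> \bar R} := intensity mE mB EB nuB.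
pose S t : set (R * 'rV[R]_d) := `]0%R, t] `*` E.
pose PZ := g_sigma_algebraType (predictable_class P F E B).
pose FZ := (Omega * (R * 'rV[R]_d))%type.
pose f : PZ -> 'rV[R]_d -> R := @predictable_data R d dO Omega P F c B g'.
have mf : forall y, measurable_fun [set: PZ] (f ^~ y).
  exact: (measurable_predictable_data hF mB EB hp').
have full d1 (T1 : measurableType d1) (k : FZ -> T1) :
    measurable_fun [set: PZ] (k : PZ -> T1) -> measurable_fun setT k.
  exact: (predictable_measurable_fun mE).
pose b : FZ -> 'rV[R]_d -> R := smooth_version f omega.
pose G : FZ -> R := version_bound f omega.
pose H : FZ -> R := version_modulus f omega.
have G0 z : 0 <= G z by exact: version_bound_ge0.
have H0 z : 0 <= H z by exact: version_modulus_ge0.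
have cb : forall z, continuous (b z).
  by move=> z; exact: (continuous_smooth_version omega0 omega_gt0 comega omega_small).
have bG : forall z y, `|b z y| <= G z.
  by move=> z y; exact: (smooth_version_le f omega0 omega_gt0 comega omega_small).
have bH : forall z x y, `|b z x - b z y| <= omega (enorm (x - y)) * H z.
  by move=> z x y; exact: (smooth_version_modulus f omega0 omega_gt0 comega omega_small).
have mbP : forall y, measurable_fun [set: PZ] (b ^~ y).
  by move=> y; exact: (measurable_smooth_version mf omega0 omega_gt0 omega_small).
have mGP : measurable_fun [set: PZ] G.
  exact: (measurable_version_bound mf omega0 omega_gt0 omega_small).
have mHP : measurable_fun [set: PZ] H.
  exact: (measurable_version_modulus mf omega0 omega_gt0 omega_small).
have mb : forall y, measurable_fun [set: FZ] (b ^~ y) by move=> y; exact: (full _ _ _ (mbP y)).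
have mG : measurable_fun [set: FZ] G := full _ _ _ mGP.
have mH : measurable_fun [set: FZ] H := full _ _ _ mHP.
have mI : forall (k : FZ -> \bar R) (t : R), measurable_fun (setT `*` S t) k ->
    measurable_fun setT (fun w => \int[M w]_(z in S t) k (w, z))%E /\
    measurable_fun setT (fun w => \int[Q]_(z in S t) k (w, z))%E.
  by move=> k t; exact: (measurable_strip_integrals N mE mB ndB EB nuB).
have I0 (m : {measure set (R * 'rV[R]_d) -> \bar R}) (k : FZ -> R) w t :
    (forall z, 0 <= k z) -> (0 <= \int[m]_(z in S t) (k (w, z))%:E)%E.
  by move=> k0; apply: integral_ge0 => z _; rewrite lee_fin.
have finB (T : R) : 0 < T ->
    (\int[P]_w \int[Q]_(z in S T) extension_bound f omega (w, z) < +oo)%E.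
  move=> T0; have := extension_bound_strip hF mE mB EB nuB omega0 omega_gt0 comega
    omega_small hp' hver mg hh_ge0 hgh'.
  move=> /null_of_ae[Z [mZ Z0 hZ]]; apply: le_lt_trans (finN T T0).
  apply: (ge0_le_integral_null mZ Z0) => [w _|w _|w _ nZ].
  - by apply: integral_ge0 => z _; exact: extension_bound_ge0.
  - by do 2 (apply: integral_ge0 => ? _); exact: Lnorm_ge0.
  - exact: hZ.
have finG (T : R) : 0 < T -> (\int[P]_w \int[Q]_(z in S T) (G (w, z))%:E < +oo)%E.
  move=> T0; apply: le_lt_trans (finB T T0).
  apply: (ge0_le_integral_null measurable0 (measure0 P)) => [w _|w _|w _ _].
  - exact: I0.
  - by apply: integral_ge0 => z _; exact: extension_bound_ge0.
  - apply: (ge0_le_integral_null measurable0 (measure0 Q)) => [z _|z _|z _ _].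
    + by rewrite lee_fin.
    + exact: extension_bound_ge0.
    + exact: version_bound_le.
have stripH r := version_modulus_strip hF mE mB EB nuB omega0 omega_gt0 omega_small
  hp' hver mh hh_ge0 hgh' (r := r).
have finHp1 (T : R) : 0 < T -> (\int[P]_w (\int[Q]_(z in S T) (H (w, z))%:E) `^ p < +oo)%E.
  move=> T0; have /null_of_ae[Z [mZ Z0 hZ]] := stripH 1 ler01.
  apply: le_lt_trans (hh1 T T0).
  apply: (ge0_le_integral_null mZ Z0) => [w _|w _|w _ nZ].
  - exact: poweR_ge0.
  - exact: poweR_ge0.
  - apply: gt0_ler_poweR => //; rewrite ?in_itv/= ?leey ?andbT//.
    + exact: ltW.
    + exact: I0.
    + by do 2 (apply: integral_ge0 => ? _); rewrite lee_fin.
    + have := hZ w nZ T; under eq_integral do rewrite powRr1//.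
      by under [X in (_ <= X)%E]eq_integral do under eq_integral do rewrite powRr1//.
have finHp (T : R) : 0 < T -> (\int[P]_w \int[Q]_(z in S T) (H (w, z) `^ p)%:E < +oo)%E.
  move=> T0; have /null_of_ae[Z [mZ Z0 hZ]] := stripH p (ltW p0).
  apply: le_lt_trans (hhp T T0).
  apply: (ge0_le_integral_null mZ Z0) => [w _|w _|w _ nZ].
  - by apply: integral_ge0 => z _; rewrite lee_fin powR_ge0.
  - by do 2 (apply: integral_ge0 => ? _); rewrite lee_fin powR_ge0.
  - exact: hZ.
have mHQ T : measurable_fun setT (fun w => \int[Q]_(z in S T) (H (w, z))%:E)%E.
  by apply: (proj2 (mI (EFin \o H) T _)); exact/measurable_EFinP/measurable_funTS.
have mGQ T : measurable_fun setT (fun w => \int[Q]_(z in S T) (G (w, z))%:E)%E.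
  by apply: (proj2 (mI (EFin \o G) T _)); exact/measurable_EFinP/measurable_funTS.
(* [x <= 1 + x^p] yields a first moment from the moment of order [p]; it makes the integrals of [H]
   almost surely finite for [M] as well. *)
have finH (T : R) : 0 < T -> (\int[P]_w \int[Q]_(z in S T) (H (w, z))%:E < +oo)%E.
  move=> T0; apply: (@le_lt_trans _ _
      (\int[P]_w (1 + (\int[Q]_(z in S T) (H (w, z))%:E) `^ p))%E).
    apply: (ge0_le_integral_null measurable0 (measure0 P)) => [w _|w _|w _ _].
    + exact: I0.
    + by rewrite adde_ge0// poweR_ge0.
    + by apply: le_poweR_1D => //; exact: I0.
  apply: (@lte_integralD _ _ _ P setT (fun=> 1%E)
    (fun w => (\int[Q]_(z in S T) (H (w, z))%:E) `^ p)%E).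
  - exact: measurableT.
  - exact: measurable_cst.
  - exact: (measurableT_comp (measurable_poweR _) (mHQ T)).
  - by [].
  - by move=> w; exact: poweR_ge0.
  - rewrite (_ : \int[P]_w 1 = P setT)%E; last by rewrite -[RHS]mul1e -integral_cst.
    by rewrite [P setT]probability_setT ltry.
  - exact: finHp1.
have finGH (T : R) : 0 < T ->
    (\int[P]_w \int[Q]_(z in S T) (G (w, z) + H (w, z))%:E < +oo)%E.
  move=> T0; rewrite (eq_integral (fun w => \int[Q]_(z in S T) (G (w, z))%:E +
      \int[Q]_(z in S T) (H (w, z))%:E)%E); last first.
    move=> w _; under eq_integral do rewrite EFinD.
    have msec (k : FZ -> R) : measurable_fun setT k ->
        measurable_fun (S T) (fun z => (k (w, z))%:E).
      move=> mk; apply/measurable_EFinP; apply: measurable_funTS.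
      by apply: (measurableT_comp mk); exact: measurable_pair1.
    apply: ge0_integralD.
    + exact: measurableX.
    + by move=> z _; rewrite lee_fin.
    + exact: msec.
    + by move=> z _; rewrite lee_fin.
    + exact: msec.
  apply: (lte_integralD measurableT (mGQ T) (mHQ T)).
  - by move=> w; exact: I0.
  - by move=> w; exact: I0.
  - exact: finG.
  - exact: finH.
have GH0 z : 0 <= G z + H z by exact: addr_ge0.
have hGH := strip_finite hF hN ndB GH0 (measurable_funD mGP mHP) finGH.
have hG := strip_finite hF hN ndB G0 mGP finG.
have [A [mA A0 g'A]] := smooth_version_ae hF omega0 omega_gt0 comega omega_small
  hp' hver mh hh_ge0 hgh' finB.
have fb := smooth_version_null hF omega0 omega_gt0 omega_small hp' hver mh hh_ge0 hgh' finB.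
exists (compensated_field K E M Q b G H); split.
- split.
    by move=> t x _; exact: (measurable_compensated_field hK mE mI).
  move=> x.
  have hx := compensated_integralE hF hN ndB hK mbP cb bG G0 mG
    (predictable_data_in P F B g') mf fb mA A0 g'A x.
  (* For a fixed [x] one null event serves all [t], as a realization requires. *)
  apply: (ae_imply (filterI (hcomp x) (filterI hx (filterI hGH hG)))).
  move=> w [ux [Jx [GHw Gw]]] t t0; rewrite ux// Jx; last by move=> s; have [] := Gw s.
  by rewrite /compensated_field patchE mem_set.
- apply: aeW => w t _.
  exact: (continuous_compensated_field hK mE mb cb bG bH G0 H0 mG mH omega0 omega_gt0 omega_small).
- move=> beta T c1 beta0 hbeta T0 c10.
  (* The inequality is strict because [theta] is positive, so the exponent [1 - beta p] left on
     [phi] is positive. *)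
  have bp : beta < p^-1 by rewrite (le_lt_trans hbeta)// ltrBlDr ltrDl.
  have c20 : 0 < 2 * c1 by rewrite mulr_gt0.
  (* Two points of the ball are at distance at most [2 * c1], and [r^d phi(r)^(1 - beta p)] is
     nondecreasing, so its value there is the constant. *)
  apply: (@integrable_sup_modulus R d dO Omega P alpha K hK E mE M Q mI b G H omega mb cb bG bH
    G0 H0 mG mH omega0 omega_gt0 omega_small phi p beta T c1
    ((2 * c1) `^ d%:R * phi (2 * c1) `^ (1 - beta * p))).
  + exact: hd.
  + exact: hp.
  + exact: beta0.
  + exact: T0.
  + exact: c10.
  + exact: phi_gt0.
  + exact: hphi_0.
  + exact: hphi_cont.
  + by rewrite mulr_ge0// powR_ge0.
  + by move=> r z r0 rc z0; exact: (space_modulus_ratio d hp hphi_mono phi_gt0 bp r0 rc z0).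
  + exact: (jump_integral_moment hF hN ndB T0 H0 mHP hp (finHp1 T T0) (finHp T T0)).
  + apply: le_lt_trans (finHp1 T T0).
    apply: (ge0_le_integral_null measurable0 (measure0 P)) => [w _|w _|w _ _].
    * by rewrite lee_fin powR_ge0.
    * exact: poweR_ge0.
    * by apply: fine_powR_le => //; exact: I0.
Qed.
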